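(* Let $(X,\omega)$ be a compact connected K\''ahler manifold of complex dimension $n$ and let $L$ be a holomorphic line bundle over $X$. Suppose there exists a metric $h$ on $L$ whose curvature $F=F(h)$ solves the deformed Hermitian-Yang-Mills equation $$\mathrm{Im}\,(\omega-F)^n=\tan(\hat\theta)\,\mathrm{Re}\,(\omega-F)^n .$$ Then any other metric $h'$ on $L$ that solves this equation (with $F=F(h')$) is a real constant multiple of $h$.
   Context: A metric on $L$ means a smooth Hermitian metric. Locally $\omega=\frac i2 g_{\bar kj}\,dz^j\wedge d\bar z^k$, normalized so that $\int_X\frac{\omega^n}{n!}=1$. The curvature of a metric $h$ on $L$ is $F=F(h)=\frac12F_{\bar kj}\,dz^j\wedge d\bar z^k$ with $F_{\bar kj}=-\partial_j\partial_{\bar k}\log h$, so $iF$ is a real closed $(1,1)$-form. Put $Z_L:=\int_X\frac{(\omega-F)^n}{n!}\in\mathbb C$, which does not depend on the metric; it is assumed nonzero, and $\hat\theta:=\arg Z_L$. If $\cos\hat\theta=0$ the equation is read as $\mathrm{Re}\,(\omega-F)^n=0$; in all cases the equation says $\mathrm{Im}\big(e^{-i\hat\theta}(\omega-F)^n\big)=0$. *)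

(* Defs.v *)
From HB Require Import structures.
From mathcomp Require Import all_boot all_order all_algebra all_fingroup.
From mathcomp Require Import complex.
From mathcomp Require Import all_classical all_reals all_analysis.

Set Implicit Arguments.
Unset Strict Implicit.
Unset Printing Implicit Defensive.

Import Order.TTheory GRing.Theory Num.Theory.
Import numFieldNormedType.Exports.

Local Open Scope classical_set_scope.
Local Open Scope complex_scope.
Local Open Scope ring_scope.

(** Calculus on C^n, seen as the real normed space R^n x R^n through
    z_j = x_j + i y_j. *)

Definition Cn (R : realType) (n : nat) : normedModType R :=
  ('rV[R]_n * 'rV[R]_n)%type.

Section Calculus.
Context {R : realType} {n : nat}.
Local Notation V := (Cn R n).
Local Notation C := R[i].

Definition zcoord (j : 'I_n) (z : V) : C := z.1 ord0 j +i* z.2 ord0 j.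

Definition ex (j : 'I_n) : V := (delta_mx ord0 j, 0).
Definition ey (j : 'I_n) : V := (0, delta_mx ord0 j).

(* The positively oriented real basis (d/dx_0, d/dy_0, d/dx_1, d/dy_1, ...). *)
Definition std_frame (k : 'I_(n * 2)) : V :=
  let d := \row_(j < n) (nat_of_ord j == k./2)%:R in
  if odd k then (0, d) else (d, 0).

(* W is meant to be open in the definitions below. *)
Fixpoint Ck (k : nat) (W : set V) (f : V -> R) : Prop :=
  (forall z, W z -> {for z, continuous f}) /\
  match k with
  | 0%N => True
  | k'.+1 => forall v : V,
      (forall z, W z -> derivable f z v) /\ Ck k' W (fun z => 'D_v f z)
  end.

Definition smooth (W : set V) (f : V -> R) : Prop := forall k, Ck k W f.

Definition smoothC (W : set V) (f : V -> C) : Prop :=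
  smooth W (fun z => complex.Re (f z)) /\ smooth W (fun z => complex.Im (f z)).

Definition DC (v : V) (f : V -> C) (z : V) : C :=
  'D_v (fun w => complex.Re (f w)) z +i* 'D_v (fun w => complex.Im (f w)) z.

Definition partialz (j : 'I_n) (f : V -> C) (z : V) : C :=
  2^-1 * (DC (ex j) f z - 'i%C * DC (ey j) f z).
Definition partialzbar (j : 'I_n) (f : V -> C) (z : V) : C :=
  2^-1 * (DC (ex j) f z + 'i%C * DC (ey j) f z).

Definition holomorphic (W : set V) (f : V -> C) : Prop :=
  smoothC W f /\ forall j z, W z -> partialzbar j f z = 0.

Definition holomorphic_map (W : set V) (T : V -> V) : Prop :=
  forall j, holomorphic W (fun z => zcoord j (T z)).

(** Complex-valued exterior forms.  An element of [form p] is meant to be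
    alternating and R-multilinear; a differential form is a map [V -> form p]. *)

Definition form (p : nat) : Type := ('I_p -> V) -> C.

Definition wedge (p q : nat) (a : form p) (b : form q) : form (p + q) :=
  fun v => (p`! * q`!)%:R^-1 *
    \sum_(s : 'S_(p + q)) (-1) ^+ s *
       (a (fun i => v (s (lshift q i))) * b (fun i => v (s (rshift p i)))).

Fixpoint wpow (a : form 2) (k : nat) : form (k * 2) :=
  match k with
  | 0%N => fun _ => 1
  | k'.+1 => wedge a (@wpow a k')
  end.

Definition dz (j : 'I_n) : form 1 := fun v => zcoord j (v ord0).
Definition dzbar (j : 'I_n) : form 1 := fun v => conjc (zcoord j (v ord0)).

(* The form  c \sum_(j, k) a_(kbar j) dz^j /\ dzbar^k ; the row index of the
   matrix a is the barred one. *)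
Definition form11 (c : C) (a : 'M[C]_n) : form 2 :=
  fun v => c * \sum_j \sum_k a k j * wedge (dz j) (dzbar k) v.

Definition extd (p : nat) (a : V -> form p) (z : V) : form p.+1 :=
  fun v => \sum_(i < p.+1)
    (-1) ^+ i * DC (v i) (fun w => a w (fun l => v (lift i l))) z.

Definition pullback (p : nat) (T : V -> V) (a : V -> form p) (z : V) : form p :=
  fun v => a (T z) (fun l => 'D_(v l) T z).

End Calculus.

Arguments wpow {R n} a k v.

(** Lebesgue integration on C^n, only used for continuous compactly supported
    integrands, as an iterated one-dimensional integral. *)

Fixpoint rV_integral (R : realType) (m : nat) : ('rV[R]_m -> R) -> R :=
  match m with
  | 0%N => fun f => f 0
  | m'.+1 => fun f =>
      (\int[@lebesgue_measure R]_(t in [set: R])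
         rV_integral (fun v : 'rV[R]_m' =>
           f (row_mx (const_mx t : 'rV[R]_1) v : 'rV[R]_(1 + m'))))%R
  end.

Definition Cn_integral (R : realType) (n : nat) (f : Cn R n -> R) : R :=
  rV_integral (fun x : 'rV[R]_n => rV_integral (fun y : 'rV[R]_n => f (x, y))).

Definition Cn_integralC (R : realType) (n : nat) (f : Cn R n -> R[i]) : R[i] :=
  Cn_integral (fun z => complex.Re (f z)) +i*
  Cn_integral (fun z => complex.Im (f z)).

(** Complex manifolds, given by an atlas.  [chart i] and [chart_inv i] are
    only meaningful on [chart_dom i] and [chart_img i] respectively. *)

Record complex_manifold (R : realType) (n : nat) (X : topologicalType) := {
  chart_idx : Type;
  chart_dom : chart_idx -> set X;
  chart : chart_idx -> X -> Cn R n;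
  chart_inv : chart_idx -> Cn R n -> X;
  _ : hausdorff_space X;
  _ : forall x, exists i, chart_dom i x;
  _ : forall i, open (chart_dom i);
  _ : forall i, open (chart i @` chart_dom i);
  _ : forall i x, chart_dom i x -> chart_inv i (chart i x) = x;
  _ : forall i x, chart_dom i x -> {for x, continuous (chart i)};
  _ : forall i z, (chart i @` chart_dom i) z ->
        {for z, continuous (chart_inv i)};
  _ : forall i j,
        holomorphic_map (chart i @` (chart_dom i `&` chart_dom j))
          (fun z => chart j (chart_inv i z))
}.

Section Manifold.
Context {R : realType} {n : nat} {X : topologicalType}.
Variable M : complex_manifold R n X.
Local Notation V := (Cn R n).
Local Notation C := R[i].

(* The image in the chart i of the part of W covered by that chart. *)
Definition chart_set (i : chart_idx M) (W : set X) : set V :=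
  chart i @` (chart_dom i `&` W).

Definition chart_img (i : chart_idx M) : set V := chart_set i setT.

Definition smooth_on (W : set X) (f : X -> R) : Prop :=
  forall i, smooth (chart_set i W) (fun z => f (chart_inv i z)).

Definition holomorphic_on (W : set X) (f : X -> C) : Prop :=
  forall i, holomorphic (chart_set i W) (fun z => f (chart_inv i z)).

(* Local expressions in all charts of a differential form on X. *)
Definition mform (p : nat) : Type := chart_idx M -> V -> form (R := R) (n := n) p.

Definition compatible (p : nat) (a : mform p) : Prop :=
  forall i j z, chart_set i (chart_dom j) z ->
    a i z = pullback (fun w => chart j (chart_inv i w)) (a j) z.

Definition partition_of_unity (m : nat) (idx : 'I_m -> chart_idx M)
    (rho : 'I_m -> X -> R) : Prop :=
  [/\ forall k, smooth_on setT (rho k),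
      forall k x, 0 <= rho k x,
      forall k, closure [set x | rho k x != 0] `<=` chart_dom (idx k) &
      forall x, \sum_k rho k x = 1].

(* X is meant to be compact, whence the finite partitions of unity. *)
Definition is_integral (a : mform (n * 2)) (I : C) : Prop :=
  exists m (idx : 'I_m -> chart_idx M) (rho : 'I_m -> X -> R),
    partition_of_unity idx rho /\
    I = \sum_k Cn_integralC (fun z =>
          if z \in chart_img (idx k)
          then (rho k (chart_inv (idx k) z))%:C * a (idx k) z std_frame
          else 0).

(* The integral does not depend on the partition of unity; 0 is a junk value. *)
Definition integral_form (a : mform (n * 2)) : C := xget 0 (is_integral a).

(* [kg i z k j] is the coefficient g_(kbar j) in the chart i. *)
Definition kahler_form_of (g : chart_idx M -> V -> 'M[C]_n) : mform 2 :=
  fun i z => form11 ('i%C / 2) (g i z).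

Record kahler_metric := {
  kg : chart_idx M -> V -> 'M[C]_n;
  _ : forall i k j, smoothC (chart_img i) (fun z => kg i z k j);
  _ : forall i z k j, chart_img i z -> kg i z k j = conjc (kg i z j k);
  _ : forall i z (v : 'I_n -> C), chart_img i z -> (exists j, v j != 0) ->
        0 < \sum_j \sum_k kg i z k j * v j * conjc (v k);
  _ : compatible (kahler_form_of kg);
  _ : forall i z v, chart_img i z -> extd (kahler_form_of kg i) z v = 0
}.

Definition omega (w : kahler_metric) : mform 2 := kahler_form_of (kg w).

(** A holomorphic line bundle: a family of complex lines with local frames
    [frame a] over an open cover, whose transition functions are holomorphic. *)

Record line_bundle := {
  fiber :> X -> lmodType C;
  frame_idx : Type;
  frame_dom : frame_idx -> set X;
  frame : frame_idx -> forall x, fiber x;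
  frame_cover : forall x, exists a, frame_dom a x;
  _ : forall a, open (frame_dom a);
  _ : forall a x, frame_dom a x -> frame a x != 0;
  _ : forall a x (u : fiber x), frame_dom a x -> exists c : C, u = c *: frame a x;
  _ : forall a b, exists t : X -> C,
        holomorphic_on (frame_dom a `&` frame_dom b) t /\
        forall x, frame_dom a x -> frame_dom b x -> frame b x = t x *: frame a x
}.

Record hermitian_metric (L : line_bundle) := {
  herm :> forall x, L x -> L x -> C;
  _ : forall x (c : C) (u u' v : L x),
        herm (c *: u + u') v = c * herm u v + herm u' v;
  _ : forall x (u v : L x), herm v u = conjc (herm u v);
  _ : forall x (u : L x), u != 0 -> 0 < herm u u;
  _ : forall a : frame_idx L, smooth_on (frame_dom a)
        (fun x => complex.Re (herm (frame a x) (frame a x)))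
}.

Definition frame_at (L : line_bundle) (x : X) : frame_idx L :=
  projT1 (cid (frame_cover L x)).

Definition log_metric (L : line_bundle) (h : hermitian_metric L)
    (a : frame_idx L) (x : X) : C :=
  (ln (complex.Re (h x (frame a x) (frame a x))))%:C.

(* F = 1/2 F_(kbar j) dz^j /\ dzbar^k with F_(kbar j) = - d_j d_kbar log h; at
   each point log h is computed in some frame defined around that point, the
   result being independent of that frame. *)
Definition curvature (L : line_bundle) (h : hermitian_metric L) : mform 2 :=
  fun i z =>
    let a := frame_at L (chart_inv i z) in
    form11 2^-1 (\matrix_(k, j)
      - partialz j (partialzbar k (fun w => log_metric h a (chart_inv i w))) z).

Definition volume_form (w : kahler_metric) : mform (n * 2) :=
  fun i z v => n`!%:R^-1 * wpow (omega w i z) n v.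

Definition omega_minus_F (w : kahler_metric) (L : line_bundle)
    (h : hermitian_metric L) : mform 2 :=
  fun i z v => omega w i z v - curvature h i z v.

(* Z_L, computed with any metric on L. *)
Definition ZL (w : kahler_metric) (L : line_bundle) : C :=
  xget 0 [set Z | exists h : hermitian_metric L,
    Z = integral_form (fun i z v => n`!%:R^-1 * wpow (omega_minus_F w h i z) n v)].

(* Im (omega - F)^n = tan(theta) Re (omega - F)^n, read as Re (omega - F)^n = 0
   when cos(theta) = 0. *)
Definition dHYM (w : kahler_metric) (L : line_bundle) (theta : R)
    (h : hermitian_metric L) : Prop :=
  forall i z (v : 'I_(n * 2) -> V), chart_img i z ->
    let eta := wpow (omega_minus_F w h i z) n v in
    if cos theta == 0 then complex.Re eta = 0
    else complex.Im eta = tan theta * complex.Re eta.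

End Manifold.

Definition is_arg (R : realType) (Z : R[i]) (theta : R) : Prop :=
  Z = `|Z| * (cos theta +i* sin theta).

(* Main.v *)
Require Import Defs.
From HB Require Import structures.
From mathcomp Require Import all_boot all_order all_algebra all_fingroup.
From mathcomp Require Import complex.
From mathcomp Require Import all_classical all_reals all_analysis.
From mathcomp Require Import ring lra.
Import Order.TTheory GRing.Theory Num.Theory.
Import numFieldNormedType.Exports.
Local Open Scope classical_set_scope.
Local Open Scope complex_scope.
Local Open Scope ring_scope.
Local Open Scope sesquilinear_scope.

(** Let h and h' be two solutions and u = log (h' / h), a smooth function on X.
    In a chart write g for the matrix of omega and M(f) for the complex Hessian
    of a function f.  With F = - M(log h) the curvature matrix, omega - F is the
    (1,1)-form of matrix g + iF up to a constant, and its top power is a nonzero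
    universal multiple of det (g + iF) (lemma wpow_frame).  The equation says
    that this determinant stays on a fixed real line, so the ratio of the
    determinants of h and h' is real.

    A determinant whose matrix has positive definite Hermitian part has a
    preferred continuous argument (angle): the sum of the arguments of the
    pivots of Gaussian elimination, that is, the sum of the arctangents of the
    eigenvalues of F relative to g.  It does not depend on the holomorphic
    coordinates (angle_conj), and the difference of the angles of h' and h,
    called angle_gap, is a continuous function on X whose values are multiples
    of pi.  As X is connected, it is constant.

    To see that the constant is zero, and then that u is constant, move along
    the segment from F to F' = F - M(u).  The derivative of the angle is a
    positive multiple of - tr (M(u) G), where G is a positive definite matrix
    that depends on the point of the segment (weight_trace), so by the mean
    value theorem the gap itself has this form (angle_MVT).  At a maximum of u
    the Hessian M(u) is nonpositive and the gap is >= 0; at a minimum it is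
    <= 0 (angle_gap_at_max).  Hence the gap vanishes and every point carries
    some G such that tr (M(u) G) = 0, taken from a family of positive definite
    matrices that is compact over compact sets.  This is enough ellipticity for Hopf's argument
    (strong_max): the set where u attains its maximum is open.  It is also
    closed, so u is constant.

    The calculus that this uses is built from directional derivatives: symmetry
    of second derivatives (schwarz), differentiability of functions of class
    C^1 (C1_differentiable), and the transformation of the complex Hessian
    under holomorphic maps (levi_compT, hess_compT), which makes the matrices
    of omega and F transform in the same way when the chart changes.  The
    weight log h computed in another frame differs by log |t|^2 with t
    holomorphic, whose complex Hessian is zero (levi_log_normsq). *)

Set Implicit Arguments.
Unset Strict Implicit.
Unset Printing Implicit Defensive.

Local Notation Re := complex.Re.
Local Notation Im := complex.Im.

(** * Complex numbers and continuity of complex-valued functions *)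

Section Cplx.
Context {R : realType}.
Local Notation C := R[i].
Implicit Types x y : C.

Lemma conjCE x : (x^*)%R = conjc x. Proof. by []. Qed.
Lemma ReD x y : Re (x + y) = Re x + Re y. Proof. by case: x; case: y. Qed.
Lemma ImD x y : Im (x + y) = Im x + Im y. Proof. by case: x; case: y. Qed.
Lemma ReN x : Re (- x) = - Re x. Proof. by case: x. Qed.
Lemma ImN x : Im (- x) = - Im x. Proof. by case: x. Qed.
Lemma ReM x y : Re (x * y) = Re x * Re y - Im x * Im y. Proof. by case: x; case: y. Qed.
Lemma ImM x y : Im (x * y) = Re x * Im y + Im x * Re y.
Proof. by case: x => a b; case: y => c d /=. Qed.
Lemma ReJ x : Re (conjc x) = Re x. Proof. by case: x. Qed.
Lemma ImJ x : Im (conjc x) = - Im x. Proof. by case: x. Qed.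
Lemma ReV x : Re (x^-1) = Re x / (Re x ^+ 2 + Im x ^+ 2). Proof. by case: x. Qed.
Lemma ImV x : Im (x^-1) = - Im x / (Re x ^+ 2 + Im x ^+ 2). Proof. by case: x => a b; rewrite mulNr. Qed.
Lemma ReC (r : R) : Re (r%:C) = r. Proof. by []. Qed.
Lemma Re_sum I (s : seq I) P (F : I -> C) : Re (\sum_(i <- s | P i) F i) = \sum_(i <- s | P i) Re (F i).
Proof. by rewrite (big_morph (@complex.Re R) ReD (erefl _)). Qed.
Lemma Im_sum I (s : seq I) P (F : I -> C) : Im (\sum_(i <- s | P i) F i) = \sum_(i <- s | P i) Im (F i).
Proof. by rewrite (big_morph (@complex.Im R) ImD (erefl _)). Qed.
Lemma complexP x y : Re x = Re y -> Im x = Im y -> x = y.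
Proof. by case: x => a b; case: y => c d /= -> ->. Qed.
Lemma sqn_gt0 x : x != 0 -> 0 < Re x ^+ 2 + Im x ^+ 2.
Proof.
move=> x0; rewrite lt_neqAle addr_ge0 ?sqr_ge0 // andbT eq_sym paddr_eq0 ?sqr_ge0 //.
rewrite !sqrf_eq0; apply: contra x0 => /andP[/eqP a /eqP b].
by apply/eqP/complexP.
Qed.

End Cplx.

Section Ccont.
Context {R : realType} {T : topologicalType}.
Local Notation C := R[i].
Implicit Types (f g : T -> C) (x : T).

Definition ccont f x := continuous_at x (fun y => Re (f y)) /\
  continuous_at x (fun y => Im (f y)).

Lemma ccont_cst (c : C) x : ccont (fun=> c) x.
Proof. by split; apply: cst_continuous. Qed.
Lemma ccontD f g x : ccont f x -> ccont g x -> ccont (fun y => f y + g y) x.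
Proof.
move=> [f1 f2] [g1 g2]; split.
  by under eq_fun do rewrite ReD; apply: cvgD.
by under eq_fun do rewrite ImD; apply: cvgD.
Qed.
Lemma ccontN f x : ccont f x -> ccont (fun y => - f y) x.
Proof.
move=> [f1 f2]; split.
  by under eq_fun do rewrite ReN; apply: cvgN.
by under eq_fun do rewrite ImN; apply: cvgN.
Qed.
Lemma ccontJ f x : ccont f x -> ccont (fun y => conjc (f y)) x.
Proof.
move=> [f1 f2]; split.
  by under eq_fun do rewrite ReJ.
by under eq_fun do rewrite ImJ; apply: cvgN.
Qed.
Lemma ccontM f g x : ccont f x -> ccont g x -> ccont (fun y => f y * g y) x.
Proof.
move=> [f1 f2] [g1 g2]; split.
  by under eq_fun do rewrite ReM; apply: cvgB; apply: cvgM.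
by under eq_fun do rewrite ImM; apply: cvgD; apply: cvgM.
Qed.
Lemma ccontV f x : f x != 0 -> ccont f x -> ccont (fun y => (f y)^-1) x.
Proof.
move=> f0 [f1 f2].
have n0 : {for x, continuous (fun y => (Re (f y) ^+ 2 + Im (f y) ^+ 2)^-1)}.
  apply: cvgV; first by rewrite gt_eqF // sqn_gt0.
  by apply: cvgD; apply: cvgM.
split.
  by under eq_fun do rewrite ReV; apply: cvgM.
by under eq_fun do rewrite ImV; apply: cvgM => //; apply: cvgN.
Qed.
Lemma ccont_sum I (s : seq I) P (F : I -> T -> C) x : (forall i, ccont (F i) x) ->
  ccont (fun y => \sum_(i <- s | P i) F i y) x.
Proof.
move=> cF; elim: s => [|i s IH].
  by under eq_fun do rewrite big_nil; apply: ccont_cst.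
under eq_fun do rewrite big_cons.
by case: (P i) => //; apply: ccontD.
Qed.
Lemma ccont_prod I (s : seq I) P (F : I -> T -> C) x : (forall i, ccont (F i) x) ->
  ccont (fun y => \prod_(i <- s | P i) F i y) x.
Proof.
move=> cF; elim: s => [|i s IH].
  by under eq_fun do rewrite big_nil; apply: ccont_cst.
under eq_fun do rewrite big_cons.
by case: (P i) => //; apply: ccontM.
Qed.
Lemma ccont_det n (A : T -> 'M[C]_n) x : (forall i j, ccont (fun y => A y i j) x) ->
  ccont (fun y => \det (A y)) x.
Proof.
move=> cA; apply: ccont_sum => s; apply: ccontM; first exact: ccont_cst.
by apply: ccont_prod => i.
Qed.
End Ccont.

(** * A continuous argument of the determinant of accretive matrices *)

Section Angle.
Context {R : realType}.
Local Notation C := R[i].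

Definition qf n (A : 'M[C]_n) (v : 'cV[C]_n) : C := (v ^t* *m A *m v) 0 0.

Definition accretive n (A : 'M[C]_n) := forall v : 'cV[C]_n, v != 0 -> 0 < Re (qf A v).

Definition schur n (A : 'M[C]_(1 + n)) : 'M[C]_n :=
  drsubmx A - (A 0 0)^-1 *: (dlsubmx A *m ursubmx A).

(** Meant for Re x > 0, where it is the argument of x in ]-pi/2, pi/2[. *)
Definition carg (x : C) : R := atan (Im x / Re x).

(** Elimination writes det A as the product of successive pivots. If A is
    accretive so is each Schur complement, hence each pivot has positive real
    part, and the sum of their arguments is an argument of det A that varies
    continuously with A. *)
Fixpoint angle n : 'M[C]_n -> R :=
  match n with
  | 0%N => fun=> 0
  | n'.+1 => fun A => carg (A 0 0) + @angle n' (schur A)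
  end.

Lemma cargP x : 0 < Re x -> exists2 r : R, 0 < r & x = r%:C * (cos (carg x) +i* sin (carg x)).
Proof.
move=> x0; set a := carg x.
have ca : 0 < cos a by rewrite cos_gt0_pihalf // atan_gtNpi2 atan_ltpi2.
have ta : tan a = Im x / Re x by rewrite atanK.
exists (Re x / cos a); first exact: divr_gt0.
apply: complexP; rewrite ?ReM ?ImM /= mul0r ?subr0 ?addr0.
  by rewrite divfK // gt_eqF.
have -> : Im x = Re x * tan a by rewrite ta mulrC divfK // gt_eqF.
by rewrite /tan; field; rewrite gt_eqF.
Qed.

Lemma carg_cont (T : topologicalType) (f : T -> C) x : 0 < Re (f x) -> ccont f x ->
  {for x, continuous (fun y => carg (f y))}.
Proof.
move=> f0 [f1 f2]; apply: continuous_comp; last exact: continuous_atan.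
apply: cvgM => //; apply: cvgV => //; by rewrite gt_eqF.
Qed.

Lemma accretive00 n (A : 'M[C]_n.+1) : accretive A -> 0 < Re (A 0 0).
Proof.
move=> /(_ (delta_mx 0 0)); rewrite /qf.
have -> : ((delta_mx 0 0 : 'cV[C]_n.+1) ^t*) = delta_mx 0 0.
  by apply/matrixP => i j; rewrite !mxE andbC rmorph_nat.
rewrite -rowE mxE (bigD1 0) //= big1 => [|i i0]; last first.
  by rewrite !mxE (negbTE i0) mulr0.
rewrite !mxE eqxx mulr1 addr0; apply.
by apply/eqP => /matrixP/(_ 0 0)/eqP; rewrite !mxE eqxx oner_eq0.
Qed.

(** This vector is chosen so that A sends it into the last n coordinates,
    where A acts as its Schur complement. *)
Lemma block_schur n (A : 'M[C]_(1 + n)) (v : 'cV[C]_n) : A 0 0 != 0 ->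
  A *m col_mx (- (A 0 0)^-1 *: (ursubmx A *m v)) v = col_mx 0 (schur A *m v).
Proof.
move=> a0; set w := _ *: _; rewrite -[A in LHS]submxK mul_block_col {}/w.
have ul : ulsubmx A = (A 0 0)%:M.
  by apply/matrixP => i j; rewrite !mxE !ord1 eqxx mulr1n; congr (A _ _); apply/val_inj.
congr (col_mx _ _).
  rewrite ul mul_scalar_mx scalerA mulrN.
  by rewrite divff // scaleN1r addNr.
by rewrite /schur mulmxBl scaleNr mulmxN -scalemxAr -scalemxAl mulmxA addrC.
Qed.

(** The form of the Schur complement at v is the form of A at the vector of
    block_schur. *)
Lemma schur_accretive n (A : 'M[C]_(1 + n)) : accretive A -> accretive (schur A).
Proof.
move=> acc v v0.
have a0 : A 0 0 != 0.
  by apply: contraTneq (accretive00 acc) => ->; rewrite ltxx.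
set w := col_mx (- (A 0 0)^-1 *: (ursubmx A *m v)) v.
have : 0 < Re (qf A w).
  by apply: acc; rewrite col_mx_eq0 negb_and v0 orbT.
rewrite /qf -mulmxA block_schur // tr_col_mx map_row_mx mul_row_col mulmx0 add0r.
by rewrite mulmxA.
Qed.

Lemma det_schur n (A : 'M[C]_(1 + n)) : A 0 0 != 0 -> \det A = A 0 0 * \det (schur A).
Proof.
move=> a0.
have ul : ulsubmx A = (A 0 0)%:M.
  by apply/matrixP => i j; rewrite !mxE !ord1 eqxx mulr1n; congr (A _ _); apply/val_inj.
have E : A = block_mx 1%:M 0 ((A 0 0)^-1 *: dlsubmx A) 1%:M *m
             block_mx (A 0 0)%:M (ursubmx A) 0 (schur A).
  rewrite mulmx_block !mul1mx !mul0mx ?mulmx0 ?addr0 /schur mul_mx_scalar scalerA divff //.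
  by rewrite scale1r -scalemxAl addrC subrK -ul submxK.
rewrite {1}E det_mulmx det_lblock !det1 !mul1r det_ublock.
by rewrite det_scalar expr1.
Qed.

Lemma angleP n (A : 'M[C]_n) : accretive A -> 
  exists2 r : R, 0 < r & \det A = r%:C * (cos (angle A) +i* sin (angle A)).
Proof.
elim: n A => [|n IH] A acc.
  by exists 1; rewrite ?ltr01 //= cos0 sin0 det_mx00 mul1r.
have A0 := accretive00 acc.
have a0 : A 0 0 != 0 by apply: contraTneq A0 => ->; rewrite ltxx.
rewrite (@det_schur n) //=.
have [r r0] := cargP A0; move: (carg _) => c ->.
have [s s0 ->] := IH _ (schur_accretive acc).
exists (r * s); first exact: mulr_gt0.
apply: complexP; rewrite !(ReM, ImM) /= cosD sinD. all: ring.
Qed.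

Lemma accretive_det n (A : 'M[C]_n) : accretive A -> \det A != 0.
Proof.
move=> /angleP[r r0 ->]; rewrite mulf_neq0 //.
  by apply/eqP => -[/eqP]; rewrite gt_eqF.
apply/eqP => -[c s]; have := cos2Dsin2 (angle A).
by rewrite c s expr0n /= addr0 => /eqP; rewrite eq_sym oner_eq0.
Qed.

Lemma schur_cont (T : topologicalType) n (A : T -> 'M[C]_(1 + n)) x : A x 0 0 != 0 ->
  (forall i j, ccont (fun y => A y i j) x) ->
  forall i j, ccont (fun y => schur (A y) i j) x.
Proof.
move=> A0 cA i j.
under eq_fun do rewrite !mxE; apply: ccontD => //; apply: ccontN.
apply: ccontM; first exact: ccontV.
by apply: ccont_sum => k; under eq_fun do rewrite !mxE; apply: ccontM.
Qed.

Lemma angle_cont (T : topologicalType) n (A : T -> 'M[C]_n) x : accretive (A x) ->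
  (forall i j, ccont (fun y => A y i j) x) ->
  {for x, continuous (fun y => angle (A y))}.
Proof.
elim: n A => [|n IH] A acc cA /=; first exact: cst_continuous.
have A0 := accretive00 acc.
apply: cvgD; first exact: carg_cont.
apply: IH; first exact: schur_accretive.
by apply: schur_cont => //; apply: contraTneq A0 => ->; rewrite ltxx.
Qed.

End Angle.

(** * Derivatives of complex-valued functions and of determinants *)

Section CDerive.
Context {R : realType} {V : normedModType R}.
Local Notation C := R[i].
Implicit Types (f g : V -> C) (z v : V).

Definition isDC z v f (df : C) :=
  is_derive z v (fun w => Re (f w)) (Re df) /\ is_derive z v (fun w => Im (f w)) (Im df).

Lemma isDC_cst z v c : isDC z v (fun=> c) 0.
Proof. by split; apply: is_derive_cst. Qed.

Lemma isDCD z v f g df dg : isDC z v f df -> isDC z v g dg ->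
  isDC z v (fun w => f w + g w) (df + dg).
Proof.
move=> [f1 f2] [g1 g2]; split; rewrite ?ReD ?ImD.
  by under eq_fun do rewrite ReD; apply: is_deriveD.
by under eq_fun do rewrite ImD; apply: is_deriveD.
Qed.

Lemma isDCM z v f g df dg : isDC z v f df -> isDC z v g dg ->
  isDC z v (fun w => f w * g w) (df * g z + f z * dg).
Proof.
move=> [f1 f2] [g1 g2]; split.
  under eq_fun do rewrite ReM.
  by apply: is_derive_eq; rewrite !(ReD, ReM) /GRing.scale /=; ring.
under eq_fun do rewrite ImM.
by apply: is_derive_eq; rewrite !(ImD, ImM) /GRing.scale /=; ring.
Qed.

Lemma isDC_sum z v I (s : seq I) P (F : I -> V -> C) dF : (forall i, isDC z v (F i) (dF i)) ->
  isDC z v (fun y => \sum_(i <- s | P i) F i y) (\sum_(i <- s | P i) dF i).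
Proof.
move=> cF; elim: s => [|i s IH].
  by rewrite big_nil; under eq_fun do rewrite big_nil; apply: isDC_cst.
rewrite big_cons; under eq_fun do rewrite big_cons.
by case: (P i) => //; apply: isDCD.
Qed.

(** The general term of the sum differentiates the factor j only. *)
Lemma isDC_prod z v n (F : 'I_n -> V -> C) dF : (forall i, isDC z v (F i) (dF i)) ->
  isDC z v (fun y => \prod_i F i y) (\sum_j \prod_i (if i == j then dF i else F i z)).
Proof.
elim: n F dF => [|n IH] F dF DF.
  by rewrite big_ord0; under eq_fun do rewrite big_ord0; apply: isDC_cst.
under eq_fun do rewrite big_ord_recl.
have -> : \sum_j \prod_i (if i == j then dF i else F i z) =
    dF ord0 * \prod_i F (lift ord0 i) z +
    F ord0 z * \sum_j \prod_i (if i == j then dF (lift ord0 i) else F (lift ord0 i) z).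
  rewrite big_ord_recl big_ord_recl eqxx mulr_sumr; congr (_ * _ + _).
  by apply: eq_bigr => j _; rewrite big_ord_recl.
apply: isDCM; first exact: DF.
exact: IH (fun i => DF (lift ord0 i)).
Qed.

(** Jacobi's formula. Differentiating the Leibniz expansion one factor at a
    time gives the determinants of A with one row replaced by that of dA,
    which are then expanded along that row. *)
Lemma isDC_det z v n (A : V -> 'M[C]_n) (dA : 'M[C]_n) :
  (forall i j, isDC z v (fun y => A y i j) (dA i j)) ->
  isDC z v (fun y => \det (A y)) (\tr (dA *m \adj (A z))).
Proof.
move=> DA.
have -> : \tr (dA *m \adj (A z)) = \sum_(s : 'S_n) (-1) ^+ s *
    \sum_j \prod_i (if i == j then dA i (s i) else A z i (s i)).
  under [RHS]eq_bigr do rewrite mulr_sumr.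
  rewrite exchange_big; apply: eq_bigr => j _ /=.
  pose B := \matrix_(i, k) (if i == j then dA i k else A z i k).
  have -> : \sum_(s : 'S_n) (-1) ^+ s * \prod_i (if i == j then dA i (s i) else A z i (s i)) = \det B.
    by apply: eq_bigr => s _; congr (_ * _); apply: eq_bigr => i _; rewrite mxE.
  rewrite (expand_det_row _ j) mxE; apply: eq_bigr => k _.
  have -> : B j k = dA j k by rewrite mxE eqxx.
  rewrite [\adj _ k j]mxE; congr (_ * (_ * \det _)).
  by apply/matrixP => a b; rewrite !mxE eq_sym (negbTE (neq_lift _ _)).
apply: isDC_sum => s.
have := @isDCM z v (fun=> (-1) ^+ s) _ _ _ (isDC_cst z v _) (isDC_prod (fun i => DA i (s i))).
by rewrite mul0r add0r.
Qed.

End CDerive.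

(** * Continuous functions with values in the multiples of pi *)

Section Path.
Context {R : realType}.
Local Notation C := R[i].

(** The values lie in the discrete set of multiples of pi, so psi is locally
    constant. *)
Lemma sin_eq0_const (T : topologicalType) (psi : T -> R) : connected [set: T] ->
  (forall x, {for x, continuous psi}) -> (forall x, sin (psi x) = 0) ->
  forall x y, psi x = psi y.
Proof.
move=> cT cpsi spsi x y.
have loc z : \forall w \near z, psi w = psi z.
  have := cpsi z => /cvgr_dist_lt /(_ pi (pi_gt0 R)).
  apply: filterS => w; rewrite ltr_norml => /andP[a b].
  have s0 : sin (psi z - psi w) = 0 by rewrite sinB !spsi !(mul0r, mulr0) subrr.
  have [c|c|c] := ltgtP 0 (psi z - psi w).
  - by have := @sin_gt0_pi _ (psi z - psi w); rewrite c b s0 ltxx => /(_ isT).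
  - have := @sin_gt0_pi _ (- (psi z - psi w)); rewrite sinN s0 oppr0 ltxx.
    by rewrite oppr_gt0 c ltrNl a => /(_ isT).
  - by apply/eqP; rewrite eq_sym -subr_eq0 -c.
pose S := [set w | psi w = psi x].
suff : S y by move=> ->.
  suff -> : S = setT by [].
  apply: cT; first by exists x.
    exists S; last by rewrite setTI.
    by rewrite openE => w Sw; have := loc w; apply: filterS => u /= E; rewrite /S /= E.
  exists S; last by rewrite setTI.
  rewrite -openC openE => w Sw; have := loc w; apply: filterS => u /= E; rewrite /S /= E.
  exact: Sw.
Qed.

End Path.

(** * Hermitian matrices, and invariance of the angle under congruence *)

Section Herm.
Context {R : realType}.
Local Notation C := R[i].

Definition hermmx n (A : 'M[C]_n) := A ^t* = A.

Lemma hermmxE n (A : 'M[C]_n) : hermmx A -> forall i j, A i j = conjc (A j i).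
Proof. by move=> h i j; rewrite -{1}h !mxE. Qed.

Lemma adjD m n (A B : 'M[C]_(m, n)) : (A + B) ^t* = A ^t* + B ^t*.
Proof. by apply/matrixP => i j; rewrite !mxE rmorphD. Qed.

Lemma adjZ m n c (A : 'M[C]_(m, n)) : (c *: A) ^t* = conjc c *: A ^t*.
Proof. by apply/matrixP => i j; rewrite !mxE rmorphM. Qed.

Lemma adjM m n p (A : 'M[C]_(m, n)) (B : 'M[C]_(n, p)) : (A *m B) ^t* = B ^t* *m A ^t*.
Proof. by rewrite trmx_mul map_mxM. Qed.

Lemma qfE n (A : 'M[C]_n) v : qf A v = \sum_i \sum_j A i j * v j 0 * conjc (v i 0).
Proof.
rewrite /qf -mulmxA mxE; apply: eq_bigr => i _; rewrite !mxE mulr_sumr.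
by apply: eq_bigr => j _; rewrite mulrC.
Qed.

Lemma qfD n (A B : 'M[C]_n) v : qf (A + B) v = qf A v + qf B v.
Proof. by rewrite /qf mulmxDr mulmxDl mxE. Qed.

Lemma qfZ n c (A : 'M[C]_n) v : qf (c *: A) v = c * qf A v.
Proof. by rewrite /qf -scalemxAr -scalemxAl mxE. Qed.

Lemma qf_conj m n (A : 'M[C]_n) (P : 'M[C]_(n, m)) v : qf (P ^t* *m A *m P) v = qf A (P *m v).
Proof. by rewrite /qf adjM !mulmxA. Qed.

Lemma qf_adj n (A : 'M[C]_n) v : qf (A ^t*) v = conjc (qf A v).
Proof.
rewrite /qf; have -> : v ^t* *m A ^t* *m v = (v ^t* *m A *m v) ^t* by rewrite !adjM trmxCK mulmxA.
by rewrite !mxE.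
Qed.

Lemma herm_qf_im n (A : 'M[C]_n) v : hermmx A -> Im (qf A v) = 0.
Proof.
move=> hA; have := qf_adj A v; rewrite hA => /(congr1 (@complex.Im R)); rewrite ImJ => e.
by lra.
Qed.

(** Multiplying a Hermitian matrix by i makes its form purely imaginary. *)
Lemma Re_qf_pi n (g F : 'M[C]_n) v : hermmx F -> Re (qf (g + 'i%C *: F) v) = Re (qf g v).
Proof.
move=> hF; rewrite qfD qfZ ReD ReM /= (herm_qf_im _ hF); ring.
Qed.

Lemma accretive_pi n (g F : 'M[C]_n) : accretive g -> hermmx F -> accretive (g + 'i%C *: F).
Proof. by move=> ag hF v v0; rewrite Re_qf_pi //; apply: ag. Qed.

Lemma schur_herm n (A : 'M[C]_(1 + n)) : hermmx A -> hermmx (schur A).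
Proof.
move=> hA; have e := hermmxE hA.
apply/matrixP => i j; rewrite !mxE !big_ord1 !mxE.
rewrite (e (rshift 1 i) (rshift 1 j)) (e (rshift 1 i)) (e _ (rshift 1 j)).
rewrite [in RHS](e 0 0).
rewrite conjCE -(conjc_inv) .
rewrite !(rmorphB, rmorphM) /=.
congr (_ - _ * _). by rewrite mulrC.
Qed.

(** All pivots of a Hermitian matrix are real. *)
Lemma herm_angle n (A : 'M[C]_n) : hermmx A -> angle A = 0.
Proof.
elim: n A => [//|n IH] A hA /=.
rewrite IH ?addr0 /carg; last exact: schur_herm.
have /(congr1 (@complex.Im R)) := hermmxE hA 0 0; rewrite ImJ => e.
by rewrite (_ : Im _ = 0) ?mul0r ?atan0 //; lra.
Qed.

(** The value at e_i + c e_j with c = 0, 1, -1, i isolates the coefficient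
    (i, j). *)
Lemma polarization n (A B : 'M[C]_n) : (forall v, qf A v = qf B v) -> A = B.
Proof.
move=> AB; apply/matrixP => i j.
have q (M : 'M[C]_n) (c : C) : qf M (delta_mx i 0 + c *: delta_mx j 0) =
   M i i + c * M i j + conjc c * M j i + conjc c * c * M j j.
  rewrite /qf adjD adjZ.
  have d k : (delta_mx k 0 : 'cV[C]_n) ^t* = delta_mx 0 k.
    by apply/matrixP => a b; rewrite !mxE andbC rmorph_nat.
  rewrite !d mulmxDr !mulmxDl -!scalemxAr -!scalemxAl -!rowE -!colE !mxE.
  ring.
pose X := A i j - B i j; pose Y := A j i - B j i.
pose D := A i i - B i i; pose Z := A j j - B j j.
have L c : D + c * X + conjc c * Y + conjc c * c * Z = 0.
  have := AB (delta_mx i 0 + c *: delta_mx j 0); rewrite !q => /eqP.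
  by rewrite -subr_eq0 => /eqP <-; rewrite /D /X /Y /Z; ring.
have d0 : D = 0 by rewrite -(L 0) rmorph0; ring.
have d1 : D + X + Y + Z = 0 by rewrite -(L 1) rmorph1; ring.
have d2 : D - X - Y + Z = 0 by rewrite -(L (-1)) rmorphN rmorph1; ring.
have d3 : D + 'i%C * X - 'i%C * Y - ('i%C * 'i%C) * Z = 0.
  have ci : conjc 'i%C = - 'i%C :> C by apply: complexP; rewrite /= ?oppr0.
  by rewrite -(L 'i%C) ci; ring.
have n2 : (2 : C) != 0 by rewrite pnatr_eq0.
have i0 : 'i%C != 0 :> C by apply/eqP => -[/eqP]; rewrite oner_eq0.
rewrite d0 !add0r in d1 d2 d3.
have Z0 : Z = 0.
  apply: (mulfI n2); rewrite mulr0.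
  by transitivity ((X + Y + Z) + (- X - Y + Z)); [ring|rewrite d1 d2 addr0].
rewrite Z0 mulr0 subr0 in d1 d3; rewrite addr0 in d1.
have XmY : X - Y = 0 by apply: (mulfI i0); rewrite mulr0 mulrBr.
apply/eqP; rewrite -subr_eq0 -/X; apply/eqP.
apply: (mulfI n2); rewrite mulr0.
by transitivity ((X + Y) + (X - Y)); [ring|rewrite d1 XmY addr0].
Qed.

Lemma det_adj n (P : 'M[C]_n) : \det (P ^t*) = conjc (\det P).
Proof. by rewrite (det_map_mx conjc) det_tr. Qed.

Lemma accretive_conj n (A P : 'M[C]_n) : P \in unitmx -> accretive A ->
  accretive (P ^t* *m A *m P).
Proof.
move=> uP aA v v0; rewrite qf_conj; apply: aA; apply: contra v0 => /eqP e.
by rewrite -(mulKmx uP v) e mulmx0.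
Qed.

(** The argument of det B times the conjugate of det A is the difference of
    the angles. *)
Lemma sin_angleB n (A B : 'M[C]_n) : accretive A -> accretive B ->
  (sin (angle B - angle A) == 0) = (Im (\det B * conjc (\det A)) == 0).
Proof.
move=> /angleP[r r0 ->] /angleP[s s0 ->].
have -> : Im (s%:C * (cos (angle B) +i* sin (angle B)) *
   conjc (r%:C * (cos (angle A) +i* sin (angle A)))) =
   s * r * sin (angle B - angle A).
  by rewrite !(ImM, ReM, ReJ, ImJ) /= sinB; ring.
by rewrite !mulf_eq0 (gt_eqF r0) (gt_eqF s0).
Qed.

Lemma connectedR : connected [set: R].
Proof. by apply/connected_intervalP => x y _ _ z _. Qed.

Lemma ccont_path (A B : C) (t : R) : ccont (fun s : R => A + s%:C * B) t.
Proof.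
apply: ccontD; first exact: ccont_cst.
apply: ccontM; last exact: ccont_cst.
split; first exact: cvg_id.
exact: cst_continuous.
Qed.

Lemma hermmxZ n (t : R) (F : 'M[C]_n) : hermmx F -> hermmx (t%:C *: F).
Proof. by move=> hF; rewrite /hermmx adjZ hF /= oppr0. Qed.

Lemma hermmxD n (F G : 'M[C]_n) : hermmx F -> hermmx G -> hermmx (F + G).
Proof. by move=> hF hG; rewrite /hermmx adjD hF hG. Qed.

Lemma hermmxJ m n (F : 'M[C]_n) (P : 'M[C]_(n, m)) : hermmx F -> hermmx (P ^t* *m F *m P).
Proof. by move=> hF; rewrite /hermmx !adjM trmxCK hF mulmxA. Qed.

(** Join g + iF to g by g + itF. All along, the determinants of the two
    matrices differ by the positive factor |det P|^2, so the difference of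
    their angles is a multiple of pi; it is constant, and zero at t = 0,
    where both matrices are Hermitian. *)
Lemma angle_conj n (g F P : 'M[C]_n) : P \in unitmx -> accretive g -> hermmx g -> hermmx F ->
  angle (P ^t* *m (g + 'i%C *: F) *m P) = angle (g + 'i%C *: F).
Proof.
move=> uP ag hg hF.
pose A (t : R) := g + t%:C *: ('i%C *: F).
have aA t : accretive (A t).
  by rewrite /A scalerA mulrC -scalerA; apply: accretive_pi => //; apply: hermmxZ.
have cA t i j : ccont (fun s => A s i j) t.
  by rewrite /A; under eq_fun do rewrite !mxE; apply: ccont_path.
(* The determinants differ by the positive factor |det P|^2, which is what
   makes sin (psi t) vanish. *)
pose psi t := angle (P ^t* *m A t *m P) - angle (A t).
have psiE : psi 0 = psi 1.
  apply: sin_eq0_const; first exact: connectedR.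
    move=> t; apply: cvgB; last exact: angle_cont.
    apply: angle_cont; first exact: accretive_conj.
    move=> i j; under eq_fun do rewrite mxE; apply: ccont_sum => k.
    apply: ccontM; last exact: ccont_cst.
    under eq_fun do rewrite mxE; apply: ccont_sum => l.
    by apply: ccontM; [exact: ccont_cst|exact: cA].
  move=> t; apply/eqP; rewrite sin_angleB //; last exact: accretive_conj.
  rewrite !det_mulmx det_adj; set p := \det P; set a := \det (A t).
  by rewrite !(ImM, ReM, ReJ, ImJ); apply/eqP; ring.
move: psiE; rewrite /psi /A scale0r addr0 scale1r.
rewrite (herm_angle hg) (herm_angle (hermmxJ P hg)).
by rewrite subrr => /esym/eqP; rewrite subr_eq0 => /eqP.
Qed.

End Herm.

(** * First variation of the angle *)

Section Lift.
Context {R : realType}.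
Local Notation C := R[i].

(** Close to t the function phi differs from phi t by less than pi/2, so it
    equals phi t plus the arctangent of the slope of f s in the direction of
    f t. *)
Lemma lift_derive (phi : R -> R) (f : R -> C) (t : R) (df : C) :
  (forall s, exists2 r : R, 0 < r & f s = r%:C * (cos (phi s) +i* sin (phi s))) ->
  {for t, continuous phi} -> isDC t (1 : R) f df ->
  is_derive t (1 : R) phi (Im (df * conjc (f t)) / (Re (f t) ^+ 2 + Im (f t) ^+ 2)).
Proof.
move=> fP cphi [dR dI].
pose N := Re (f t) ^+ 2 + Im (f t) ^+ 2.
have N0 : 0 < N.
  have [r r0 E] := fP t; rewrite /N E ReM ImM /=.
  have -> : (r * cos (phi t) - 0 * sin (phi t)) ^+ 2 + (r * sin (phi t) + 0 * cos (phi t)) ^+ 2 =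
    r ^+ 2 * (cos (phi t) ^+ 2 + sin (phi t) ^+ 2) by ring.
  by rewrite cos2Dsin2 mulr1 exprn_gt0.
pose P s := Re (f s) * Re (f t) + Im (f s) * Im (f t).
pose Q s := Im (f s) * Re (f t) - Re (f s) * Im (f t).
have Pt : P t = N by rewrite /P /N -!expr2.
have Qt : Q t = 0 by rewrite /Q mulrC subrr.
have near_eq : \forall s \near t, phi t + atan (Q s / P s) = phi s.
  have pi20 : 0 < pi / 2 :> R by rewrite divr_gt0 ?pi_gt0.
  have := cphi => /cvgr_dist_lt /(_ _ pi20).
  apply: filterS => s; rewrite ltr_norml => /andP[a b].
  have [r r0 Et] := fP t; have [q q0 Es] := fP s.
  have cs : 0 < cos (phi s - phi t).
    by apply: cos_gt0_pihalf; rewrite ltrNl opprB b /= -opprB ltrNl.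
  have -> : P s = q * r * cos (phi s - phi t).
    by rewrite /P Et Es !(ReM, ImM) /= cosB; ring.
  have -> : Q s = q * r * sin (phi s - phi t).
    by rewrite /Q Et Es !(ReM, ImM) /= sinB; ring.
  rewrite -mulf_div divff ?mulf_neq0 ?gt_eqF // mul1r.
  rewrite -/(tan _) tanK ?subrKC //.
  by rewrite in_itv /= ltrNl opprB b /= -opprB ltrNl.
apply: (near_eq_is_derive near_eq).
have dP : is_derive t (1 : R) P (Re df * Re (f t) + Im df * Im (f t)).
  by apply: is_derive_eq; rewrite /GRing.scale /=; ring.
have dQ : is_derive t (1 : R) Q (Im df * Re (f t) - Re df * Im (f t)).
  by apply: is_derive_eq; rewrite /GRing.scale /=; ring.
have dPV : is_derive t (1 : R) (fun s => (P s)^-1) (- (P t) ^- 2 *: (Re df * Re (f t) + Im df * Im (f t))).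
  by apply: is_deriveV; rewrite Pt gt_eqF.
have dQP : is_derive t (1 : R) (fun s => Q s / P s)
    (Im (df * conjc (f t)) / (Re (f t) ^+ 2 + Im (f t) ^+ 2)).
  apply: is_derive_eq; rewrite /GRing.scale /= Qt mul0r add0r Pt /N ImM ReJ ImJ.
  by rewrite mulrN mulrC; congr (_ / _); ring.
apply: is_derive_eq; rewrite Qt mul0r expr0n /= addr0 invr1 add0r /GRing.scale /=.
by rewrite !mul1r.
Qed.

(** For invertible A this is |det A|^2 times A^-1 g (A^-1)^H, where H is the
    conjugate transpose. When g is the Hermitian part of A this is the
    Hermitian part of A^-1, up to the factor; the adjugate keeps it
    polynomial in the entries of A. *)
Definition weight n (g A : 'M[C]_n) : 'M[C]_n := \adj A *m g *m (\adj A) ^t*.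

(** Multiplying A + A^H = 2g by adj A on the left and by its conjugate
    transpose on the right shows that twice the weight is conj(det A) adj A
    plus its conjugate transpose. *)
Lemma weight_trace n (g F H : 'M[C]_n) : hermmx g -> hermmx F -> hermmx H ->
  let A := g + 'i%C *: F in
  Im (\tr ('i%C *: H *m \adj A) * conjc (\det A)) = Re (\tr (H *m weight g A)).
Proof.
move=> hg hF hH A.
have AA : A + A ^t* = 2 *: g.
  rewrite /A adjD adjZ hg hF addrACA -mulr2n scaler_nat -scalerDl.
  have -> : 'i%C + conjc 'i%C = 0 :> C by apply: complexP; rewrite /= ?addr0 ?subrr.
  by rewrite scale0r addr0.
have E : 2 *: weight g A = conjc (\det A) *: \adj A + \det A *: (\adj A) ^t*.
  rewrite /weight scalemxAl scalemxAr -AA mulmxDr mulmxDl mul_adj_mx mul_scalar_mx addrC.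
  congr (_ + _); rewrite -mulmxA -adjM mul_adj_mx.
  have -> : ((\det A)%:M : 'M[C]_n) ^t* = (conjc (\det A))%:M.
    by rewrite tr_scalar_mx map_scalar_mx.
  by rewrite mul_mx_scalar.
have tJ : \tr (H *m (\adj A) ^t*) = conjc (\tr (H *m \adj A)).
  rewrite mxtrace_mulC -{1}hH -adjM -(trace_map_mx conjc).
  by rewrite -map_trmx mxtrace_tr.
have : Re (\tr (H *m (2 *: weight g A))) = 2 * Im (\tr ('i%C *: H *m \adj A) * conjc (\det A)).
  rewrite E mulmxDr -!scalemxAr -scalemxAl !linearD !linearZ /= tJ.
  set d := \det A; set tt := \tr _.
  by rewrite !(ReD, ReM, ImM, ReJ, ImJ) /=; ring.
rewrite -scalemxAr linearZ /= ReM /= => e.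
have : 2 * Re (\tr (H *m weight g A)) = 2 * Im (\tr ('i%C *: H *m \adj A) * conjc (\det A)).
  by rewrite -e; ring.
by move/(mulfI _) => -> //; rewrite pnatr_eq0.
Qed.

Lemma qf_weight n (g A : 'M[C]_n) v : qf (weight g A) v = qf g ((\adj A) ^t* *m v).
Proof. by rewrite -qf_conj trmxCK. Qed.

Lemma weight_gt0 n (g A : 'M[C]_n) v : accretive g -> \det A != 0 -> v != 0 ->
  0 < Re (qf (weight g A) v).
Proof.
move=> ag dA v0; rewrite qf_weight; apply: ag; apply: contra v0 => /eqP e.
have : A ^t* *m ((\adj A) ^t* *m v) = 0 by rewrite e mulmx0.
rewrite mulmxA -adjM mul_adj_mx tr_scalar_mx map_scalar_mx mul_scalar_mx => /eqP.
by rewrite scaler_eq0 conjC_eq0 (negbTE dA).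
Qed.

Lemma weight_ge0 n (g A : 'M[C]_n) v : accretive g -> \det A != 0 ->
  0 <= Re (qf (weight g A) v).
Proof.
move=> ag dA; have [->|v0] := eqVneq v 0; last exact/ltW/weight_gt0.
by rewrite /qf mulmx0 mxE.
Qed.

(** In a unitary eigenbasis w_i of N the trace is the sum of the products of
    the values of the two forms at w_i, and the values of the form of N are
    its eigenvalues. *)
Lemma trace_le0 n (N G : 'M[C]_n) : hermmx N -> (forall v, Re (qf N v) <= 0) ->
  (forall v, 0 <= Re (qf G v)) -> Re (\tr (N *m G)) <= 0.
Proof.
move=> hN N0 G0.
have hN' : N \is hermsymmx by apply/is_hermitianmxP; rewrite expr0 scale1r hN.
have /hermitian_normalmx/orthomx_spectralP := hN'.
have := spectral_unitarymx N; move: (spectralmx N) (spectral_diag N) => P S uP NE.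
rewrite invmx_unitary // in NE.
have PP := unitarymxP uP.
pose w i : 'cV[C]_n := P ^t* *m delta_mx i 0.
have q (M : 'M[C]_n) i : qf M (w i) = (P *m M *m P ^t*) i i.
  rewrite /w -qf_conj trmxCK /qf.
  have -> : (delta_mx i 0 : 'cV[C]_n) ^t* = delta_mx 0 i.
    by apply/matrixP => a b; rewrite !mxE andbC rmorph_nat.
  by rewrite -rowE -colE !mxE.
have -> : \tr (N *m G) = \sum_i qf N (w i) * qf G (w i).
  have D i : qf N (w i) = S 0 i.
    by rewrite q NE !mulmxA PP mul1mx -mulmxA PP mulmx1 !mxE eqxx mulr1n.
  rewrite {1}NE -mulmxA -mulmxA mxtrace_mulC -mulmxA -mulmxA.
  rewrite /mxtrace; apply: eq_bigr => i _; rewrite D q.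
  by rewrite mul_diag_mx mxE !mulmxA.
rewrite Re_sum; apply: sumr_le0 => i _.
by rewrite ReM (herm_qf_im _ hN) mul0r subr0 mulr_le0_ge0.
Qed.

(** The derivative of the angle along the path g + i(F + tH) is the imaginary
    part of the logarithmic derivative of the determinant, which weight_trace
    turns into a positive multiple of tr (H G) for the weight G at time t. *)
Lemma angle_MVT n (g F H : 'M[C]_n) : accretive g -> hermmx g -> hermmx F -> hermmx H ->
  exists2 t : R, 0 < t < 1 & exists2 c : R, 0 < c &
   angle (g + 'i%C *: (F + H)) - angle (g + 'i%C *: F) =
   c * Re (\tr (H *m weight g (g + 'i%C *: (F + t%:C *: H)))).
Proof.
move=> ag hg hF hH.
pose Ft (t : R) := F + t%:C *: H.
pose A t := g + 'i%C *: Ft t.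
have hFt t : hermmx (Ft t) by apply: hermmxD => //; apply: hermmxZ.
have aA t : accretive (A t) by apply: accretive_pi.
have AE t i j : A t i j = (g + 'i%C *: F) i j + t%:C * ('i%C *: H) i j.
  by rewrite !mxE; ring.
have cA t i j : ccont (fun s => A s i j) t.
  by under eq_fun do rewrite AE; apply: ccont_path.
have dA t i j : isDC t (1 : R) (fun s => A s i j) (('i%C *: H) i j).
  under eq_fun do rewrite AE.
  have i1 : isDC t (1 : R) (fun s : R => s%:C) 1.
    by split; [exact: (@is_derive_id R R t 1)|exact: (@is_derive_cst R R R 0 t 1)].
  have := isDCD (isDC_cst t 1 ((g + 'i%C *: F) i j)) (isDCM i1 (isDC_cst t 1 (('i%C *: H) i j))).
  by rewrite mul1r mulr0 addr0 add0r.
pose c t : R := (Re (\det (A t)) ^+ 2 + Im (\det (A t)) ^+ 2)^-1.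
pose phi t := angle (A t).
have cphi t : {for t, continuous phi} by apply: angle_cont.
have dphi t : is_derive t (1 : R) phi (c t * Re (\tr (H *m weight g (A t)))).
  rewrite -weight_trace // mulrC /c; apply: (@lift_derive phi (fun s => \det (A s)) t (\tr ('i%C *: H *m \adj (A t)))) => //.
    by move=> s; apply: angleP.
  exact: isDC_det.
have [] := @MVT _ phi (fun t => c t * Re (\tr (H *m weight g (A t)))) 0 1 ltr01.
- exact: continuous_subspaceT.
- move=> t; rewrite in_itv /= => t01 E.
  exists t => //; exists (c t); first by rewrite invr_gt0 sqn_gt0 // accretive_det.
  by move: E; rewrite /phi /A /Ft scale0r addr0 scale1r subr0 mulr1.
Qed.

End Lift.

(** * The top power of a (1,1)-form is a determinant *)

Section PermSum.
Variables p q : nat.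
Implicit Types (t : 'S_p) (r : 'S_q).

Definition psum_fun t r (i : 'I_(p + q)) : 'I_(p + q) :=
  match fintype.split i with inl j => lshift q (t j) | inr j => rshift p (r j) end.

Lemma psum_funl t r j : psum_fun t r (lshift q j) = lshift q (t j).
Proof. by rewrite /psum_fun -/(unsplit (inl j)) unsplitK. Qed.
Lemma psum_funr t r j : psum_fun t r (rshift p j) = rshift p (r j).
Proof. by rewrite /psum_fun -/(unsplit (inr j)) unsplitK. Qed.

Lemma psum_inj t r : injective (psum_fun t r).
Proof.
move=> i j; case: (split_ordP i) => i' ->; case: (split_ordP j) => j' ->;
  rewrite ?(psum_funl, psum_funr).
- by move/lshift_inj/perm_inj => ->.
- by move/eqP; rewrite eq_lrshift.
- by move/eqP; rewrite eq_rlshift.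
- by move/rshift_inj/perm_inj => ->.
Qed.

Definition psum t r : 'S_(p + q) := perm (@psum_inj t r).

Lemma psuml t r j : psum t r (lshift q j) = lshift q (t j).
Proof. by rewrite permE psum_funl. Qed.
Lemma psumr t r j : psum t r (rshift p j) = rshift p (r j).
Proof. by rewrite permE psum_funr. Qed.

Lemma sign_psum (K : comNzRingType) t r :
  (-1) ^+ psum t r = (-1) ^+ t * (-1) ^+ r :> K.
Proof.
rewrite -!det_perm -(det_ublock _ (0 : 'M[K]_(p, q))); congr (\det _).
apply/matrixP => i j; rewrite [LHS]mxE [LHS]mxE.
case: (split_ordP i) => i' ->; case: (split_ordP j) => j' ->;
  rewrite ?(psuml, psumr) ?(block_mxEul, block_mxEur, block_mxEdl, block_mxEdr) !mxE.
- by rewrite eq_lshift.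
- by rewrite eq_lrshift.
- by rewrite eq_rlshift.
- by rewrite eq_rshift.
Qed.
End PermSum.

Section Wedge.
Context {R : realType} {n : nat}.
Local Notation C := R[i].
Local Notation V := (Cn R n).

(** The antisymmetrisation without the factor 1/p!, which is what makes
    wedge_alt free of constants. *)
Definition alt p (al : @Defs.form R n p) : @Defs.form R n p :=
  fun v => \sum_(s : 'S_p) (-1) ^+ s * al (fun i => v (s i)).

(** Each pair of inner permutations can be absorbed into the outer one; there
    are p! q! such pairs, which cancels the normalisation of the wedge
    product. *)
Lemma wedge_alt p q (al : @Defs.form R n p) (be : @Defs.form R n q) :
  wedge (alt al) (alt be) =
  alt (fun v => al (fun i => v (lshift q i)) * be (fun i => v (rshift p i))).
Proof.
apply/funext => v; rewrite /wedge /alt.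
set X := RHS.
suff -> : \sum_(s : 'S_(p + q)) (-1) ^+ s *
   ((\sum_(t : 'S_p) (-1) ^+ t * al (fun i => v (s (lshift q (t i))))) *
    (\sum_(r : 'S_q) (-1) ^+ r * be (fun i => v (s (rshift p (r i)))))) =
   \sum_(t : 'S_p) \sum_(r : 'S_q) X.
  rewrite !sumr_const !card_Sn -mulrnA -[Y in _ * Y = _]mulr_natl [(q`! * _)%N]mulnC mulKf //.
under eq_bigr do rewrite big_distrlr /= mulr_sumr.
rewrite exchange_big; apply: eq_bigr => t _ /=.
under eq_bigr do rewrite mulr_sumr.
rewrite exchange_big; apply: eq_bigr => r _ /=.
rewrite /X [RHS](reindex_inj (mulgI (psum t r))) /=; apply: eq_bigr => s _.
rewrite odd_permM signr_addb sign_psum.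
have -> : (fun i => v ((psum t r * s)%g (lshift q i))) = (fun i => v (s (lshift q (t i)))).
  by apply/funext => i; rewrite permM psuml.
have -> : (fun i => v ((psum t r * s)%g (rshift p i))) = (fun i => v (s (rshift p (r i)))).
  by apply/funext => i; rewrite permM psumr.
move: (al _) (be _) ((-1) ^+ s) ((-1) ^+ t) ((-1) ^+ r) => A B e1 e2 e3; ring.
Qed.

Lemma evP k (l : 'I_k) : (l.*2 < k * 2)%N. Proof. by rewrite muln2 ltn_double. Qed.
Lemma odP k (l : 'I_k) : (l.*2.+1 < k * 2)%N. Proof. by rewrite muln2 ltn_Sdouble. Qed.
Definition ev k (l : 'I_k) : 'I_(k * 2) := Ordinal (evP l).
Definition od k (l : 'I_k) : 'I_(k * 2) := Ordinal (odP l).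

Definition pairs k (b : V -> V -> C) : @Defs.form R n (k * 2) :=
  fun v => \prod_(l < k) b (v (ev l)) (v (od l)).

Lemma wpow_alt (B : @Defs.form R n 2) b : B = alt (pairs (k := 1) b) ->
  forall k, wpow B k = alt (pairs (k := k) b).
Proof.
move=> HB; elim=> [|k IH]; rewrite /wpow -/wpow.
  apply/funext => v; rewrite /alt /pairs (big_pred1 (1%g : 'S_(0 * 2))) => [|s].
    by rewrite odd_perm1 expr0 mul1r big_ord0.
  by apply/esym/eqP/permP => -[].
rewrite IH HB wedge_alt; congr alt; apply/funext => v.
rewrite /pairs big_ord1 big_ord_recl; congr (_ * _).
  by congr b; congr v; apply/val_inj.
by apply: eq_bigr => l _; congr b; congr v; apply/val_inj.
Qed.

(** The form is the antisymmetrisation of a sum of products, indexed by the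
    barred coordinate k. *)
Lemma form11_alt c a : @form11 R n c a =
  alt (pairs (k := 1) (fun u w => \sum_k (\sum_j c * a k j * zcoord j u) * conjc (zcoord k w))).
Proof.
apply/funext => v; rewrite /form11 /wedge /alt /pairs.
transitivity (\sum_(j < n) \sum_(k < n) \sum_(s : 'S_(1 + 1)) (c * a k j *
  ((-1) ^+ s * (zcoord j (v (s (lshift 1 ord0))) * conjc (zcoord k (v (s (rshift 1 ord0)))))))).
  rewrite mulr_sumr; apply: eq_bigr => j _; rewrite mulr_sumr; apply: eq_bigr => k _.
  rewrite !factS fact0 !mul1n invr1 mul1r. by rewrite mulrA mulr_sumr.
under eq_bigr do rewrite exchange_big.
rewrite exchange_big; apply: eq_bigr => s _ /=; rewrite big_ord1.
rewrite exchange_big mulr_sumr; apply: eq_bigr => k _ /=.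
rewrite mulr_suml mulr_sumr; apply: eq_bigr => j _.
have -> : @lshift 1 1 ord0 = (ev (ord0 : 'I_1) : 'I_2) by apply/val_inj.
have -> : @rshift 1 1 ord0 = (od (ord0 : 'I_1) : 'I_2) by apply/val_inj.
by rewrite mulrCA !mulrA.
Qed.

End Wedge.

(** The two sizes are only propositionally equal, whence a bijection instead
    of a permutation. *)
Lemma det_mxsub_bij (K : comNzRingType) m1 m2 (f : 'I_m1 -> 'I_m2) (M : 'M[K]_m2) :
  bijective f -> \det (mxsub f f M) = \det M.
Proof.
move=> bf; have E : m1 = m2 by have := bij_eq_card bf; rewrite !card_ord.
subst m2; pose s := perm (bij_inj bf).
have -> : mxsub f f M = row_perm s (col_perm s M).
  by apply/matrixP => i j; rewrite !mxE !permE.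
by rewrite row_permE col_permE !det_mulmx !det_perm odd_permV mulrCA -signr_addb addbb mulr1.
Qed.

Section WedgePower.
Context {R : realType} {n : nat}.
Local Notation C := R[i].
Local Notation V := (Cn R n).

(** Lists the even slots, then the odd ones, which turns matrices made of
    interleaved rows into block matrices. *)
Definition interleave (i : 'I_(n + n)) : 'I_(n * 2) :=
  match fintype.split i with inl j => ev j | inr j => od j end.

Lemma interleavel j : interleave (lshift n j) = ev j.
Proof. by rewrite /interleave -/(unsplit (inl j)) unsplitK. Qed.
Lemma interleaver j : interleave (rshift n j) = od j.
Proof. by rewrite /interleave -/(unsplit (inr j)) unsplitK. Qed.

Lemma interleave_bij : bijective interleave.
Proof.
apply: inj_card_bij; last by rewrite !card_ord muln2 addnn.
move=> i j; case: (split_ordP i) => i' ->; case: (split_ordP j) => j' ->;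
  rewrite ?(interleavel, interleaver) => -[] E.
- by congr lshift; apply/val_inj/double_inj.
- by move: (congr1 odd E); rewrite /= !odd_double.
- by move: (congr1 odd E); rewrite /= !odd_double.
- by congr rshift; apply/val_inj/double_inj.
Qed.

Lemma prod_pairs (F : 'I_(n * 2) -> C) : \prod_i F i = \prod_(l < n) (F (ev l) * F (od l)).
Proof.
rewrite (reindex interleave) /=; last exact/onW_bij/interleave_bij.
rewrite big_split_ord big_split /=; congr (_ * _); apply: eq_bigr => l _.
  by rewrite interleavel.
by rewrite interleaver.
Qed.

Definition selmx (g : {ffun 'I_n -> 'I_n}) : 'M[C]_n := \matrix_(l, k) (g l == k)%:R.

Definition frame_mx (v : 'I_(n * 2) -> V) : 'M[C]_(n + n) :=
  col_mx (\matrix_(j, q) zcoord j (v (interleave q)))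
         (\matrix_(j, q) conjc (zcoord j (v (interleave q)))).

(** Expanding the product over the pairs of slots chooses a barred index g l
    for each pair l. Each choice contributes a determinant whose even rows
    are combinations of the forms dz with coefficients in row g l of c a, and
    whose odd rows are the chosen dzbar; it factors as c^n det (selmx g)^2
    det a times the determinant of all coordinates of the frame. *)
Lemma wpow_form11 c a (v : 'I_(n * 2) -> V) :
  wpow (form11 c a) n v =
  c ^+ n * (\sum_g \det (selmx g) ^+ 2) * \det (frame_mx v) * \det a.
Proof.
rewrite (wpow_alt (form11_alt c a)) /alt /pairs.
pose al (k : 'I_n) u := \sum_j c * a k j * zcoord j u.
pose be (k : 'I_n) (u : V) := conjc (zcoord k u).
transitivity (\sum_(s : 'S_(n * 2)) \sum_(g : {ffun 'I_n -> 'I_n})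
  (-1) ^+ s * \prod_l (al (g l) (v (s (ev l))) * be (g l) (v (s (od l))))).
  by apply: eq_bigr => s _; rewrite bigA_distr_bigA mulr_sumr.
rewrite exchange_big /=.
have -> : c ^+ n * (\sum_g \det (selmx g) ^+ 2) * \det (frame_mx v) * \det a =
    \sum_g c ^+ n * \det (selmx g) ^+ 2 * \det (frame_mx v) * \det a.
  by rewrite [c ^+ n * _]mulr_sumr !mulr_suml.
apply: eq_bigr => g _.
pose M : 'M[C]_(n * 2) := \matrix_(i, q)
  (if odd i then \sum_(l < n | l == i./2 :> nat) be (g l) (v q)
   else \sum_(l < n | l == i./2 :> nat) al (g l) (v q)).
have Mev l q : M (ev l) q = al (g l) (v q).
  rewrite mxE /= odd_double doubleK (big_pred1 l) // => i; exact: val_eqE.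
have Mod l q : M (od l) q = be (g l) (v q).
  rewrite mxE /= odd_double /= uphalf_double (big_pred1 l) // => i; exact: val_eqE.
transitivity (\det M).
  by apply: eq_bigr => s _; rewrite prod_pairs; under [in RHS]eq_bigr do rewrite Mev Mod.
rewrite -(det_mxsub_bij _ interleave_bij).
have -> : mxsub interleave interleave M =
    block_mx (c *: (selmx g *m a)) 0 0 (selmx g) *m frame_mx v.
  rewrite /frame_mx mul_block_col !mul0mx addr0 add0r.
  have sel m (A : 'M[C]_(n, m)) l q : (selmx g *m A) l q = A (g l) q.
    rewrite mxE (bigD1 (g l)) //= big1 => [|k kg]; first by rewrite mxE eqxx mul1r addr0.
    by rewrite mxE eq_sym (negbTE kg) mul0r.
  apply/matrixP => i q; rewrite [LHS]mxE; case: (split_ordP i) => i' ->.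
    rewrite interleavel Mev col_mxEu mxE; apply: eq_bigr => j _.
    by rewrite [in RHS]mxE sel mxE.
  by rewrite interleaver Mod col_mxEd sel mxE.
rewrite det_mulmx det_ublock detZ det_mulmx.
ring.
Qed.

(** The terms are squares of real numbers, and g = id gives 1. *)
Lemma sum_selmx_neq0 : \sum_g \det (selmx g) ^+ 2 != 0.
Proof.
rewrite gt_eqF // (bigD1 [ffun i => i]) //=.
have -> : selmx [ffun i => i] = 1%:M by apply/matrixP => i j; rewrite !mxE ffunE.
rewrite det1 expr1n; apply: ltr_wpDr; last exact: ltr01.
apply: sumr_ge0 => g _.
have -> : selmx g = map_mx (real_complex R) (\matrix_(l, k) (g l == k)%:R).
  by apply/matrixP => i j; rewrite !mxE rmorph_nat.
by rewrite det_map_mx -rmorphXn ler0c sqr_ge0.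
Qed.

(** On the standard frame the blocks are 1 and i for dz, 1 and -i for dzbar. *)
Lemma std_frame_mx_neq0 : \det (frame_mx std_frame) != 0.
Proof.
have dz (j l : 'I_n) : zcoord j (std_frame (ev l)) = (j == l)%:R :> C.
  rewrite /std_frame /= odd_double doubleK /zcoord /= !mxE.
  by apply: complexP; rewrite /= ?val_eqE; case: (j == l).
have dz' (j l : 'I_n) : zcoord j (std_frame (od l)) = 'i%C * (j == l)%:R :> C.
  rewrite /std_frame /= odd_double uphalf_double /zcoord /= !mxE.
  by apply: complexP; rewrite /= ?val_eqE; case: (j == l); rewrite /= ?mulr0n; ring.
have -> : frame_mx std_frame = block_mx 1%:M 'i%C%:M 1%:M (- 'i%C)%:M.
  rewrite /frame_mx block_mxEv; congr col_mx; apply/matrixP => j q;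
   rewrite mxE; case: (split_ordP q) => l ->;
   rewrite ?(row_mxEl, row_mxEr) mxE ?interleavel ?interleaver ?dz ?dz' //.
  - by rewrite mulr_natr.
  - by rewrite rmorph_nat.
  - by rewrite rmorphM rmorph_nat mulr_natr; congr (_ *+ _); apply: complexP; rewrite /= ?oppr0.
have L1 : \det (block_mx 1%:M 0 (- 1%:M) 1%:M : 'M[C]_(n + n)) = 1.
  by rewrite det_lblock !det1 mul1r.
rewrite -[\det _]mul1r -{1}L1 -det_mulmx mulmx_block !mul1mx !mul0mx !addr0 mulNmx mul1mx addNr.
rewrite det_ublock det1 mul1r mulNmx mul1mx -raddfN -raddfD det_scalar expf_neq0 //.
by apply/eqP => -[_ /eqP]; rewrite -opprD oppr_eq0 (_ : 1 + 1 = 2%:R) ?pnatr_eq0.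
Qed.

(** The phase of the top power on the standard frame is, up to a fixed
    rotation, that of det a. *)
Lemma wpow_frame c : c != 0 -> exists2 kappa : C, kappa != 0 &
  forall a, wpow (form11 c a) n std_frame = kappa * \det a.
Proof.
move=> c0; exists (c ^+ n * (\sum_g \det (selmx g) ^+ 2) * \det (frame_mx std_frame)).
  by rewrite !mulf_neq0 ?expf_neq0 ?sum_selmx_neq0 ?std_frame_mx_neq0.
by move=> a; rewrite wpow_form11.
Qed.
End WedgePower.

(** * Differential calculus on C^n *)

Lemma continuous_at_sum (R : realType) (T : topologicalType) I (s : seq I) (F : I -> T -> R) x :
  (forall i, continuous_at x (F i)) -> continuous_at x (fun y => \sum_(i <- s) F i y).
Proof.
move=> cF; elim: s => [|i s IH].
  by under eq_fun do rewrite big_nil; apply: cst_continuous.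
by under eq_fun do rewrite big_cons; apply: cvgD; [exact: cF|exact: IH].
Qed.

Section Line.
Context {R : realType} {V : normedModType R}.
Implicit Types (f : V -> R) (p q v w : V).

Lemma derive_line (U : normedModType R) (f : V -> U) p v s :
  (derivable (fun t : R => f (p + t *: v)) s 1 <-> derivable f (p + s *: v) v) /\
  'D_1 (fun t : R => f (p + t *: v)) s = 'D_v f (p + s *: v).
Proof.
rewrite /derivable /derive /=.
have -> : (fun h : R => h^-1 *: (f (p + (h *: (1 : R) + s) *: v) - f (p + s *: v))) =
          (fun h : R => h^-1 *: (f (h *: v + (p + s *: v)) - f (p + s *: v))).
  apply/funext => h; congr (_ *: (f _ - _)).
  by rewrite [h *: 1]mulr1 scalerDl addrCA.
by [].
Qed.

Lemma is_derive_line f p v s : derivable f (p + s *: v) v ->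
  is_derive s (1 : R) (fun t : R => f (p + t *: v)) ('D_v f (p + s *: v)).
Proof. by move=> d; have [a b] := derive_line f p v s; exact: (DeriveDef (a.2 d) b). Qed.

Lemma line_MVT f p v t : 0 < t -> (forall s, 0 <= s <= t -> derivable f (p + s *: v) v) ->
  exists2 s, 0 < s < t & f (p + t *: v) - f p = t * 'D_v f (p + s *: v).
Proof.
move=> t0 df.
have [] := @MVT _ (fun s => f (p + s *: v)) (fun s => 'D_v f (p + s *: v)) 0 t t0.
- move=> s; rewrite in_itv /= => /andP[a b]; apply: is_derive_line; apply: df.
  by rewrite !ltW.
- apply: derivable_within_continuous => s; rewrite in_itv /= => st.
  by have [a _] := derive_line f p v s; apply/a/df.
- move=> s; rewrite in_itv /= => st; rewrite scale0r addr0 subr0 mulrC => E.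
  by exists s.
Qed.

Lemma derive_shifted f c q v :
  (derivable (fun p => f (p + c)) q v <-> derivable f (q + c) v) /\
  'D_v (fun p => f (p + c)) q = 'D_v f (q + c).
Proof.
rewrite /derivable /derive /=.
have -> : (fun h : R => h^-1 *: (f (h *: v + q + c) - f (q + c))) =
          (fun h : R => h^-1 *: (f (h *: v + (q + c)) - f (q + c))).
  by apply/funext => h; rewrite addrA.
by [].
Qed.

Lemma near_box (z v w : V) (P : set V) : nbhs z P ->
  exists2 t : R, 0 < t & forall s s', 0 <= s <= t -> 0 <= s' <= t -> P (z + s *: v + s' *: w).
Proof.
move=> /nbhs_ballP[e /= e0 eP].
pose N := `|v| + `|w| + 1.
have N0 : 0 < N by rewrite /N ltr_wpDl // addr_ge0.
exists (e / 2 / N); first by rewrite !divr_gt0.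
move=> s s' /andP[s0 st] /andP[s0' st']; apply: eP.
rewrite -ball_normE /= -addrA opprD addrA subrr add0r normrN.
apply: (le_lt_trans (ler_normD _ _)); rewrite !normrZ !ger0_norm //.
apply: (@le_lt_trans _ _ (e / 2 / N * N)).
  rewrite /N mulrDr mulrDr -[leLHS]addr0; apply: lerD; last by rewrite mulr1 !divr_ge0 // ltW.
  by apply: lerD; apply: ler_wpM2r.
by rewrite divfK ?gt_eqF // ltr_pdivrMr // ltr_pMr // ltrDl.
Qed.

(** The mean value theorem on a segment that may run backwards. *)
Lemma line_MVT_sym f p v t : (forall s, `|s| <= `|t| -> derivable f (p + s *: v) v) ->
  exists2 s, `|s| <= `|t| & f (p + t *: v) - f p = t * 'D_v f (p + s *: v).
Proof.
move=> df; have [t0|t0|->] := ltgtP t 0.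
- have nt : 0 < - t by rewrite oppr_gt0.
  have [|s /andP[s0 st] E] := @line_MVT f (p + t *: v) v (- t) nt.
    move=> s /andP[s0 st]; rewrite -addrA -scalerDl; apply: df.
    by rewrite (ltr0_norm t0) ler_norml; apply/andP; split; lra.
  exists (t + s); first by rewrite (ltr0_norm t0) ler_norml; apply/andP; split; lra.
  move: E; rewrite -!addrA -!scalerDl subrr scale0r addr0 => E.
  by rewrite -opprB E mulNr opprK.
- have [|s /andP[s0 st] E] := @line_MVT f p v t t0.
    move=> s /andP[s0 st]; apply: df.
    by rewrite (gtr0_norm t0) ler_norml; apply/andP; split; lra.
  exists s => //; by rewrite (gtr0_norm t0) ler_norml; apply/andP; split; lra.
- exists 0; first by rewrite normr0.
  by rewrite scale0r addr0 subrr mul0r.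
Qed.

(** The mean value theorem is applied to the difference of f in the direction
    w, along v, and then along w. *)
Lemma second_difference f z v w t : 0 < t ->
  (forall s s', 0 <= s <= t -> 0 <= s' <= t -> derivable f (z + s *: v + s' *: w) v /\
     derivable (fun p => 'D_v f p) (z + s *: v + s' *: w) w) ->
  exists s s', [/\ 0 <= s <= t, 0 <= s' <= t &
   f (z + t *: v + t *: w) - f (z + t *: v) - f (z + t *: w) + f z =
   t ^+ 2 * 'D_w (fun p => 'D_v f p) (z + s *: v + s' *: w)].
Proof.
move=> t0 df; have tt : 0 <= t <= t by rewrite lexx ltW.
have t00 : 0 <= (0 : R) <= t by rewrite lexx ltW.
pose g q := f (q + t *: w) - f q.
have dg s : 0 <= s <= t ->
   is_derive (z + s *: v) v g ('D_v f (z + s *: v + t *: w) - 'D_v f (z + s *: v)).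
  move=> st; apply: is_deriveB.
    have [a b] := derive_shifted f (t *: w) (z + s *: v) v.
    by have [d _] := df s t st tt; exact: (DeriveDef (a.2 d) b).
  by have [d _] := df s 0 st t00; move: d; rewrite scale0r addr0 => /derivableP.
have [s s0 E] := @line_MVT g z v t t0 (fun s st => @ex_derive _ _ _ _ _ _ _ (dg s st)).
have st : 0 <= s <= t by case/andP: s0 => a b; rewrite !ltW.
have [|s' s0' E'] := @line_MVT (fun p => 'D_v f p) (z + s *: v) w t t0.
  by move=> s' st'; have [] := df s s' st st'.
exists s, s'; split => //.
  by case/andP: s0' => a b; rewrite !ltW.
have -> : f (z + t *: v + t *: w) - f (z + t *: v) - f (z + t *: w) + f z = g (z + t *: v) - g z.
  by rewrite /g; ring.
rewrite E (@derive_val _ _ _ _ _ _ _ (dg s st)) E' expr2 mulrA; congr (_ * _).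
Qed.

Lemma close_eq (f1 f2 f3 f4 t x y A B e : R) : 0 < t ->
  f1 - f2 - f3 + f4 = t ^+ 2 * x -> f1 - f3 - f2 + f4 = t ^+ 2 * y ->
  `|A - x| < e / 2 -> `|B - y| < e / 2 -> `|A - B| <= e.
Proof.
move=> t0 E E'; have -> : x = y.
  apply: (@mulfI _ (t ^+ 2)); first by rewrite expf_neq0 // gt_eqF.
  by rewrite -E -E'; ring.
rewrite !ltr_norml ler_norml => /andP[a b] /andP[c d]; apply/andP; split; lra.
Qed.

(** The second difference does not change when v and w are exchanged, so both
    mixed derivatives take a common value at points arbitrarily close to z. *)
Lemma schwarz f (W : set V) v w z : open W -> W z ->
  (forall p, W p -> [/\ derivable f p v, derivable f p w,
    derivable (fun q => 'D_v f q) p w & derivable (fun q => 'D_w f q) p v]) ->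
  {for z, continuous (fun p => 'D_w (fun q => 'D_v f q) p)} ->
  {for z, continuous (fun p => 'D_v (fun q => 'D_w f q) p)} ->
  'D_w (fun q => 'D_v f q) z = 'D_v (fun q => 'D_w f q) z.
Proof.
move=> oW Wz df c1 c2; apply/eqP; rewrite -subr_eq0 -normr_le0; apply/ler_addgt0Pl => e e0.
rewrite addr0.
have e2 : 0 < e / 2 by rewrite divr_gt0.
have /cvgr_dist_lt /(_ _ e2) n1 := c1.
have /cvgr_dist_lt /(_ _ e2) n2 := c2.
have nW : nbhs z W by apply: open_nbhs_nbhs.
have [t t0 tP] := near_box v w (filterI nW (filterI n1 n2)).
have [s [s' [a a' E]]] := @second_difference f z v w t t0
  (fun s s' a a' => let: And4 h1 _ h3 _ := df _ (tP s s' a a').1 in conj h1 h3).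
have dfs s1 s1' : 0 <= s1 <= t -> 0 <= s1' <= t ->
    derivable f (z + s1 *: w + s1' *: v) w /\
    derivable (fun p => 'D_w f p) (z + s1 *: w + s1' *: v) v.
  move=> b b'; have [Wp _] := tP s1' s1 b' b.
  by rewrite addrAC; have [_ h2 _ h4] := df _ Wp; exact: (conj h2 h4).
have [r [r' [b b' E']]] := @second_difference f z w v t t0 dfs.
have /= [_ [h _]] := tP s s' a a'.
have /= [_ [_ h']] := tP r' r b' b.
rewrite [z + t *: w + _]addrAC [z + r *: w + _]addrAC in E'.
exact: (close_eq t0 E E' h h').
Qed.
End Line.

Section Coordinates.
Context {R : realType} {n : nat}.
Local Notation V := (Cn R n).
Local Notation C := R[i].

Definition rcoord (a : 'I_n + 'I_n) (h : V) : R :=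
  match a with inl j => h.1 ord0 j | inr j => h.2 ord0 j end.
Definition rbasis (a : 'I_n + 'I_n) : V :=
  match a with inl j => ex j | inr j => ey j end.

Lemma rcoordD a h k : rcoord a (h + k) = rcoord a h + rcoord a k.
Proof. by case: a => j; rewrite /= mxE. Qed.
Lemma rcoordZ a c h : rcoord a (c *: h) = c * rcoord a h.
Proof. by case: a => j; rewrite /= mxE. Qed.
Lemma coord_sum h : h = \sum_a rcoord a h *: rbasis a.
Proof.
have sum1 (F : 'I_n + 'I_n -> V) : (\sum_a F a).1 = \sum_a (F a).1.
  by rewrite (big_morph (fun h : V => h.1) (fun _ _ => erefl) erefl).
have sum2 (F : 'I_n + 'I_n -> V) : (\sum_a F a).2 = \sum_a (F a).2.
  by rewrite (big_morph (fun h : V => h.2) (fun _ _ => erefl) erefl).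
rewrite [LHS]surjective_pairing [RHS]surjective_pairing sum1 sum2 !big_sumType /=.
congr pair.
  rewrite [X in _ + X]big1 ?addr0 => [|j _]; last by rewrite scaler0.
  by rewrite [LHS]row_sum_delta.
rewrite [X in X + _]big1 ?add0r => [|j _]; last by rewrite scaler0.
by rewrite [LHS]row_sum_delta.
Qed.

Lemma coord_le a h : `|rcoord a h| <= `|h|.
Proof.
have le_mx (M : 'rV[R]_n) j : `|M ord0 j| <= `|M|.
  by rewrite [leRHS]/Num.Def.normr/= mx_normrE; apply: le_trans; last exact: (le_bigmax _ _ (ord0, j)).
have -> : `|h| = Num.max `|h.1| `|h.2| by [].
by case: a => j /=; rewrite le_max !le_mx ?orbT.
Qed.

Lemma coord_cvg a : continuous (rcoord a).
Proof.
move=> h; apply/cvgrPdist_lt => e e0; near=> k.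
have -> : rcoord a h - rcoord a k = rcoord a (h - k) by rewrite -[in RHS]scaleN1r rcoordD rcoordZ mulN1r.
apply: (le_lt_trans (coord_le _ _)).
by near: k; exact: cvgr_dist_lt.
Unshelve. all: by end_near. Qed.

(** One coordinate moves at a time, and each move is controlled by the mean
    value theorem and the continuity of the corresponding partial derivative
    at z. *)
Lemma increment (f : V -> R) (W : set V) z : open W -> W z ->
  (forall p a, W p -> derivable f p (rbasis a)) ->
  (forall a, {for z, continuous (fun p => 'D_(rbasis a) f p)}) ->
  forall s e, 0 < e -> exists2 d, 0 < d & forall h, `|h| < d ->
    `|f (z + \sum_(a <- s) rcoord a h *: rbasis a) - f z -
      \sum_(a <- s) rcoord a h * 'D_(rbasis a) f z| <= e * (size s)%:R * `|h|.
Proof.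
move=> oW Wz df cf; elim=> [|a s IH] e e0.
  exists 1 => // h _; rewrite !big_nil addr0 subr0 subrr normr0.
  by rewrite mulr_ge0 // mulr0.
have [d1 d10 IHd] := IH e e0.
have /cvgr_dist_lt/(_ _ e0) nD := cf a.
have nW : nbhs z W by apply: open_nbhs_nbhs.
have [r /= r0 rP] := (nbhs_ballP z _).1 (filterI nW nD).
pose K := \sum_(b <- s) `|rbasis b| + `|rbasis a| + 1.
have K0 : 0 < K by rewrite /K ltr_wpDl // addr_ge0 // sumr_ge0.
exists (Num.min d1 (r / K)); first by rewrite lt_min d10 divr_gt0.
move=> h; rewrite lt_min => /andP[h1 h2].
rewrite !big_cons; set S := \sum_(b <- s) rcoord b h *: rbasis b.
set S' := \sum_(b <- s) rcoord b h * 'D_(rbasis b) f z.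
pose w := z + S.
have good t : `|t| <= `|rcoord a h| -> ball z r (w + t *: rbasis a).
  move=> th; rewrite -ball_normE /= /w -addrA opprD addrA subrr add0r normrN.
  apply: (le_lt_trans (ler_normD _ _)).
  apply: (@le_lt_trans _ _ (K * `|h|)); last by rewrite mulrC -ltr_pdivlMr.
  rewrite /K !mulrDl mul1r -[leLHS]addr0; apply: lerD => //; apply: lerD.
    apply: (le_trans (ler_norm_sum _ _ _)); rewrite mulr_suml; apply: ler_sum => b _.
    by rewrite normrZ mulrC ler_wpM2l // coord_le.
  by rewrite normrZ mulrC ler_wpM2l // (le_trans th) // coord_le.
have [|t th E] := @line_MVT_sym _ _ f w (rbasis a) (rcoord a h).
  by move=> t th; apply: df; have [] := rP _ (good t th).
have [_ /= De] := rP _ (good t th).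
have -> : f (z + (rcoord a h *: rbasis a + S)) = f (w + rcoord a h *: rbasis a).
  by congr f; rewrite /w -addrA [S + _]addrC.
have -> : f (w + rcoord a h *: rbasis a) - f z - (rcoord a h * 'D_(rbasis a) f z + S') =
  (f (z + S) - f z - S') - rcoord a h * ('D_(rbasis a) f z - 'D_(rbasis a) f (w + t *: rbasis a)).
  have -> : f (w + rcoord a h *: rbasis a) = rcoord a h * 'D_(rbasis a) f (w + t *: rbasis a) + f w.
    by rewrite -E subrK.
  by rewrite /w; ring.
apply: (le_trans (ler_normB _ _)).
have -> : e * (size (a :: s))%:R * `|h| = e * (size s)%:R * `|h| + e * `|h|.
  by rewrite /= -natr1; ring.
apply: lerD; first exact: IHd.
rewrite normrM mulrC; apply: ler_pM => //; [exact: ltW|exact: coord_le].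
Qed.

(** Summed over all coordinates, the increments say that f minus its
    candidate differential is negligible. *)
Lemma C1_differentiable (f : V -> R) (W : set V) z : open W -> W z ->
  (forall p a, W p -> derivable f p (rbasis a)) ->
  (forall a, {for z, continuous (fun p => 'D_(rbasis a) f p)}) ->
  differentiable f z.
Proof.
move=> oW Wz df cf.
pose D h := \sum_a rcoord a h * 'D_(rbasis a) f z.
have Dlin : linear D.
  move=> c h k; rewrite /D scaler_sumr -big_split; apply: eq_bigr => a _.
  by rewrite rcoordD rcoordZ mulrDl scalerAl.
(* The candidate differential, as a bundled linear map. *)
pose L : {linear V -> R} := HB.pack D (GRing.isLinear.Build _ _ _ _ D Dlin).
have Lc : continuous L.
  move=> h; rewrite /L /= /D; apply: continuous_at_sum => a.
  by apply: cvgM; [exact: coord_cvg|exact: cvg_cst].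
have E : f \o shift z = cst (f z) + L +o_ (0 : V) id.
  apply/eqaddoP => e e0.
  pose N := size (index_enum ('I_n + 'I_n)%type).
  have N0 : 0 < (N%:R + 1 : R) by rewrite ltr_wpDl.
  have [d d0 dP] := increment oW Wz df cf (index_enum _) (divr_gt0 e0 N0).
  near=> h; rewrite !fctE /=.
  have -> : f (h + z) - (f z + D h) = f (z + h) - f z - D h by rewrite [h + z]addrC opprD addrA.
  rewrite {1}[h in f (z + h)]coord_sum; apply: (le_trans (dP _ _)).
    near: h; exact: (@nbhs0_lt R V d d0).
  apply: ler_wpM2r => //; rewrite -mulrA ler_piMr ?(ltW e0) // mulrC ler_pdivrMr // mul1r.
  by rewrite lerDl.
apply/diffP => /=.
apply: (@getPex _ (fun (df : {linear V -> R}) => continuous df /\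
  forall y, f y = f (lim (nbhs z)) + df (y - lim (nbhs z))
                  +o_(y \near z) (y - lim (nbhs z)))).
exists L; split=> //; apply: eqaddoEx => y.
have E2 : (L : V -> R) = f \o shift z - cst (f z) +o_ (0 : V) id.
  have H (c d e k : V -> R) : c + d + e - c + k = d + (e + k).
    by apply/funext => x; rewrite !fctE; ring.
  apply: eqaddoE; rewrite E H -[LHS]addr0; congr (_ + _).
  by apply/eqP; rewrite eq_sym addrC addr_eq0 oppo.
rewrite E2 !addrA lim_id // /(_ \o _) /= subrK [f _ + _]addrC addrK.
rewrite -addrA -[LHS]addr0; congr (_ + _).
apply/eqP; rewrite eq_sym addrC addr_eq0 oppox; apply/eqP.
rewrite [in LHS]littleo_center0 (comp_centerK z id).
by rewrite -[- _ in RHS](comp_centerK z).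
Unshelve. all: by end_near. Qed.

End Coordinates.

(** * Functions of class C^k *)

Section CkTheory.
Context {R : realType} {n : nat}.
Local Notation V := (Cn R n).
Implicit Types (f g : V -> R) (W : set V).

Lemma near_open W z (P : V -> Prop) : open W -> W z -> (forall p, W p -> P p) ->
  \forall p \near z, P p.
Proof. by move=> oW Wz WP; apply: filterS (open_nbhs_nbhs (conj oW Wz)). Qed.

Lemma continuous_near_eq (T U : topologicalType) (f g : T -> U) z : (\forall p \near z, f p = g p) ->
  {for z, continuous f} -> {for z, continuous g}.
Proof.
move=> E cf; have := nbhs_singleton E => Ez.
rewrite /prop_for /continuous_at -Ez; apply: cvg_trans cf.
by apply: near_eq_cvg; apply: filterS E => p /esym.
Qed.

Lemma Ck_eq k W f g : open W -> (forall z, W z -> f z = g z) -> Ck k W f -> Ck k W g.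
Proof.
move=> oW; elim: k f g => [|k IH] f g fg [cf df].
  by split=> // z Wz; apply: continuous_near_eq (cf z Wz); apply: near_open Wz fg.
split=> [z Wz|v].
  by apply: continuous_near_eq (cf z Wz); apply: near_open Wz fg.
have [d c] := df v; split=> [z Wz|].
  by apply: near_eq_derivable (d z Wz); apply: near_open Wz fg.
apply: IH c => z Wz; apply: near_eq_derive; exact: near_open Wz fg.
Qed.

Lemma CkS k W f : Ck k.+1 W f -> Ck k W f.
Proof. by elim: k f => [|k IH] f [cf df]; split => // v; have [? /IH ?] := df v. Qed.

Lemma Ck0 W f k : Ck k W f -> forall z, W z -> {for z, continuous f}.
Proof. by case: k => [|k] [c _] z Wz; apply: c. Qed.

Lemma Ck_sub k W W' f : W' `<=` W -> Ck k W f -> Ck k W' f.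
Proof.
move=> WW; elim: k f => [|k IH] f [cf df].
  by split => // z /WW; exact: cf.
split=> [z /WW|v]; first exact: cf.
have [d c] := df v; split; first by move=> z /WW; exact: d.
exact: IH.
Qed.

Lemma CkD k W f g : open W -> Ck k W f -> Ck k W g -> Ck k W (fun z => f z + g z).
Proof.
move=> oW; elim: k f g => [|k IH] f g [cf df] [cg dg]; split.
- by move=> z Wz; apply: cvgD; [exact: cf|exact: cg].
- by [].
- by move=> z Wz; apply: cvgD; [exact: cf|exact: cg].
move=> v; have [d1 c1] := df v; have [d2 c2] := dg v; split=> [z Wz|].
  by apply: derivableD; [exact: d1|exact: d2].
apply: (Ck_eq oW) (IH _ _ c1 c2) => z Wz.
by rewrite deriveD; [|exact: d1|exact: d2].
Qed.

Lemma CkN k W f : open W -> Ck k W f -> Ck k W (fun z => - f z).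
Proof.
move=> oW; elim: k f => [|k IH] f [cf df]; split.
- by move=> z Wz; apply: cvgN; exact: cf.
- by [].
- by move=> z Wz; apply: cvgN; exact: cf.
move=> v; have [d1 c1] := df v; split=> [z Wz|].
  by apply: derivableN; exact: d1.
apply: (Ck_eq oW) (IH _ c1) => z Wz.
by rewrite deriveN; [|exact: d1].
Qed.

Lemma CkM k W f g : open W -> Ck k W f -> Ck k W g -> Ck k W (fun z => f z * g z).
Proof.
move=> oW; elim: k f g => [|k IH] f g Cf Cg; have [cf df] := Cf; have [cg dg] := Cg; split.
- by move=> z Wz; apply: cvgM; [exact: cf|exact: cg].
- by [].
- by move=> z Wz; apply: cvgM; [exact: cf|exact: cg].
move=> v; have [d1 c1] := df v; have [d2 c2] := dg v; split=> [z Wz|].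
  by apply: derivableM; [exact: d1|exact: d2].
apply: (Ck_eq oW) (CkD oW (IH _ _ (CkS Cf) c2) (IH _ _ (CkS Cg) c1)) => z Wz.
by rewrite deriveM; [|exact: d1|exact: d2].
Qed.

Lemma CkV k W f : open W -> (forall z, W z -> f z != 0) -> Ck k W f -> Ck k W (fun z => (f z)^-1).
Proof.
move=> oW f0; elim: k => [|k IH] Cf; have [cf df] := Cf; split.
- by move=> z Wz; apply: cvgV; [exact: f0|exact: cf].
- by [].
- by move=> z Wz; apply: cvgV; [exact: f0|exact: cf].
move=> v; have [d1 c1] := df v; split=> [z Wz|].
  by apply: derivableV; [exact: f0|exact: d1].
have CV := IH (CkS Cf).
apply: (Ck_eq oW) (CkN oW (CkM oW (CkM oW CV CV) c1)) => z Wz.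
rewrite deriveV; [|exact: f0|exact: d1].
by rewrite /GRing.scale /= expr2 invfM mulNr.
Qed.

Lemma derive_ln f z v : 0 < f z -> derivable f z v ->
  is_derive z v (fun p => ln (f p)) ('D_v f z / f z).
Proof.
move=> f0 df.
have E : is_derive (0 : R) (1 : R) (fun t : R => ln (f (z + t *: v))) ('D_v f z / f z).
  have d : is_derive (0 : R) (1 : R) (fun t : R => f (z + t *: v)) ('D_v f z).
    by have := @is_derive_line _ _ f z v 0; rewrite scale0r addr0; apply.
  have dl : is_derive (f (z + (0 : R) *: v)) (1 : R) (@ln R) ((f z)^-1).
    by rewrite scale0r addr0; apply: is_derive1_ln.
  by have := @is_derive1_comp _ (@ln R) (fun t : R => f (z + t *: v)) 0 _ _ dl d; rewrite mulrC.
have [a b] := derive_line (fun p => ln (f p)) z v 0; rewrite scale0r addr0 in a b.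
have [e1 e2] := E.
by rewrite -e2 b; apply/derivableP/a.
Qed.

Lemma Ck_ln k W f : open W -> (forall z, W z -> 0 < f z) -> Ck k W f -> Ck k W (fun z => ln (f z)).
Proof.
move=> oW f0 Cf; have fn z : W z -> f z != 0 by move=> /f0 /gt_eqF ->.
have cl z : W z -> {for z, continuous (fun z => ln (f z))}.
  move=> Wz; apply: continuous_comp; first exact: Ck0 Cf z Wz.
  by apply: continuous_ln; exact: f0.
case: k Cf => [|k] Cf; split => //.
move=> v; have [_ df] := Cf; have [d1 c1] := df v; split=> [z Wz|].
  by have [] := derive_ln (f0 z Wz) (d1 z Wz).
apply: (Ck_eq oW) (CkM oW c1 (CkV oW fn (CkS Cf))) => z Wz.
by have [_ ->] := derive_ln (f0 z Wz) (d1 z Wz).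
Qed.

Lemma Ck_derivable k W f z v : Ck k.+1 W f -> W z -> derivable f z v.
Proof. by move=> [_ /(_ v)[d _]] Wz; apply: d. Qed.

Lemma Ck_derive k W f v : Ck k.+1 W f -> Ck k W (fun p => 'D_v f p).
Proof. by move=> [_ /(_ v)[]]. Qed.

Lemma Ck_differentiable k W f z : open W -> Ck k.+1 W f -> W z -> differentiable f z.
Proof.
move=> oW Cf Wz; apply: (C1_differentiable oW Wz) => [p a Wp|a].
  exact: Ck_derivable Cf Wp.
exact: Ck0 (Ck_derive _ Cf) z Wz.
Qed.

Lemma Ck_schwarz k W f z v w : open W -> Ck k.+2 W f -> W z ->
  'D_w (fun q => 'D_v f q) z = 'D_v (fun q => 'D_w f q) z.
Proof.
move=> oW Cf Wz; apply: (schwarz oW Wz) => [p Wp||].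
- split.
  + exact: (Ck_derivable Cf Wp).
  + exact: (Ck_derivable Cf Wp).
  + exact: (Ck_derivable (Ck_derive v Cf) Wp).
  + exact: (Ck_derivable (Ck_derive w Cf) Wp).
- exact: (Ck0 (Ck_derive w (Ck_derive v Cf)) Wz).
- exact: (Ck0 (Ck_derive v (Ck_derive w Cf)) Wz).
Qed.

Lemma derive_coord f z v : differentiable f z ->
  'D_v f z = \sum_a rcoord a v * 'D_(rbasis a) f z.
Proof.
move=> df; rewrite deriveE // {1}[v]coord_sum linear_sum.
by apply: eq_bigr => a _; rewrite linearZ deriveE.
Qed.

(** The inner derivative is expanded in coordinates after exchanging it with
    the outer one. *)
Lemma Ck_derive2_coord k W f z v : open W -> Ck k.+2 W f -> W z ->
  'D_v (fun p => 'D_v f p) z = \sum_a \sum_b rcoord a v * rcoord b v *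
     'D_(rbasis a) (fun p => 'D_(rbasis b) f p) z.
Proof.
move=> oW Cf Wz.
rewrite derive_coord; last exact: Ck_differentiable oW (Ck_derive v Cf) Wz.
apply: eq_bigr => a _; rewrite (Ck_schwarz v (rbasis a) oW Cf Wz).
rewrite derive_coord; last exact: Ck_differentiable oW (Ck_derive _ Cf) Wz.
rewrite mulr_sumr; apply: eq_bigr => b _.
by rewrite mulrA (Ck_schwarz (rbasis a) (rbasis b) oW Cf Wz).
Qed.

End CkTheory.

#[local] Opaque derive.

(** * The complex Hessian *)

Section Hessian.
Context {R : realType} {n : nat}.
Local Notation V := (Cn R n).
Local Notation C := R[i].
Implicit Types (f g : V -> R) (W : set V).

(** Multiplication by i on C^n. *)
Definition Jmul (z : V) : V := (- z.2, z.1).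

Definition zvec (v : V) : 'cV[C]_n := \col_j zcoord j v.

Definition hess f (z : V) : 'M[C]_n :=
  \matrix_(k, j) partialz j (partialzbar k (fun w => (f w)%:C)) z.

Lemma hess_coef f z k j :
  hess f z k j = partialz j (partialzbar k (fun w => (f w)%:C)) z.
Proof. exact: mxE. Qed.

Lemma half_mulC (x y : R) : 2^-1 * (x +i* y) = (x / 2) +i* (y / 2) :> C.
Proof.
have -> : 2^-1 = (2^-1 : R)%:C :> C by rewrite (fmorphV (real_complex R)) rmorph_nat.
by apply: complexP; rewrite !(ReM, ImM) /=; ring.
Qed.

Lemma partialzbar_real k f z : partialzbar k (fun w => (f w)%:C) z =
  (2^-1 * 'D_(ex k) f z) +i* (2^-1 * 'D_(ey k) f z).
Proof.
rewrite /partialzbar /DC /=.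
have dc v : 'D_v (fun=> (0 : R)) z = 0 by exact: derive_cst.
rewrite !dc; move: ('D_(ex k) _ z) ('D_(ey k) _ z) => x y.
have -> : x +i* 0 + 'i%C * (y +i* 0) = x +i* y :> C.
  by apply: complexP; rewrite !(ReM, ImM, ReD, ImD) /=; ring.
by rewrite half_mulC; congr (_ +i* _); apply: mulrC.
Qed.

Lemma isDC_DC z v (F : V -> C) d : isDC z v F d -> DC v F z = d.
Proof.
move=> [a b]; apply: complexP; rewrite /DC /=; exact: derive_val.
Qed.

Lemma hess_alg (a b c d : R) :
  2^-1 * ((2^-1 * a) +i* (2^-1 * c) - 'i%C * ((2^-1 * d) +i* (2^-1 * b))) =
  (4^-1 * (a + b)) +i* (4^-1 * (c - d)) :> C.
Proof.
have -> : (2^-1 * a) +i* (2^-1 * c) - 'i%C * ((2^-1 * d) +i* (2^-1 * b)) =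
          (2^-1 * (a + b)) +i* (2^-1 * (c - d)) :> C.
  by apply: complexP; rewrite !(ReM, ImM, ReD, ImD, ReN, ImN) /=; ring.
by rewrite half_mulC; congr (_ +i* _); field.
Qed.

Lemma hessE W f z k j : open W -> Ck 2 W f -> W z -> hess f z k j =
  (4^-1 * ('D_(ex j) (fun p => 'D_(ex k) f p) z + 'D_(ey j) (fun p => 'D_(ey k) f p) z)) +i*
  (4^-1 * ('D_(ex j) (fun p => 'D_(ey k) f p) z - 'D_(ey j) (fun p => 'D_(ex k) f p) z)).
Proof.
move=> oW Cf Wz; rewrite mxE.
pose F p : C := (2^-1 * 'D_(ex k) f p) +i* (2^-1 * 'D_(ey k) f p).
have -> : partialzbar k (fun w => (f w)%:C) = F.
  by apply/funext => p; apply: partialzbar_real.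
have dF v : isDC z v F ((2^-1 * 'D_v (fun p => 'D_(ex k) f p) z) +i*
                        (2^-1 * 'D_v (fun p => 'D_(ey k) f p) z)).
  have d w : is_derive z v (fun p => 2^-1 * 'D_w f p) (2^-1 * 'D_v (fun p => 'D_w f p) z).
    by apply: (is_deriveZ (f := fun p => 'D_w f p)); apply: derivableP;
       exact: (Ck_derivable (Ck_derive w Cf) Wz).
  by split; [exact: (d (ex k))|exact: (d (ey k))].
rewrite /partialz (isDC_DC (dF (ex j))) (isDC_DC (dF (ey j))).
exact: hess_alg.
Qed.

Lemma conj_alg (a b c d a' b' c' d' : R) : a = a' -> b = b' -> c = c' -> d = d' ->
  (((4^-1 * (a + b)) +i* (4^-1 * (c - d)) : C)^*)%R = (4^-1 * (a' + b')) +i* (4^-1 * (d' - c')).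
Proof. by move=> -> -> -> ->; apply: complexP; rewrite //= -mulrN opprB. Qed.

(** Both parts of hessE have the required symmetry because second derivatives
    commute. *)
Lemma hess_herm W f z : open W -> Ck 2 W f -> W z -> hermmx (hess f z).
Proof.
move=> oW Cf Wz; apply/matrixP => k j; rewrite [LHS]mxE [(_ ^T)%R _ _]mxE.
rewrite !(hessE _ _ oW Cf Wz).
have S v w := Ck_schwarz (k := 0) v w oW Cf Wz.
exact: (conj_alg (S (ex j) (ex k)) (S (ey j) (ey k)) (S (ey j) (ex k)) (S (ex j) (ey k))).
Qed.

Lemma big_coord (F : 'I_n + 'I_n -> R) :
  \sum_a F a = \sum_(j < n) (F (inl j) + F (inr j)).
Proof. by rewrite big_sumType big_split. Qed.

Lemma big_coord2 (F : 'I_n + 'I_n -> 'I_n + 'I_n -> R) :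
  \sum_a \sum_b F a b = \sum_(j < n) \sum_(k < n)
    (F (inl j) (inl k) + F (inl j) (inr k) + F (inr j) (inl k) + F (inr j) (inr k)).
Proof.
under [RHS]eq_bigr do rewrite !big_split /=.
rewrite !big_split /= big_sumType /=.
under eq_bigr do rewrite big_sumType /=.
under [X in _ + X = _]eq_bigr do rewrite big_sumType /=.
by rewrite !big_split /= !addrA.
Qed.

Lemma levi_alg (A B D E x y x' y' : R) :
  Re (((4^-1 * (A + E)) +i* (4^-1 * (B - D))) * (x +i* y) * conjc (x' +i* y')) =
  4^-1 * ((x * x' * A + x * y' * B + y * x' * D + y * y' * E) +
   ((- y) * (- y') * A + (- y) * x' * B + x * (- y') * D + x * x' * E)).
Proof. by rewrite !(ReM, ImM, ReJ, ImJ) /=; ring. Qed.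

(** The restriction of f to the complex line spanned by v has this Laplacian;
    in real terms both sides are the same quadratic form in the second
    derivatives of f. *)
Lemma qf_hess W f z v : open W -> Ck 2 W f -> W z ->
  qf (hess f z) (zvec v) = (4^-1 * ('D_v (fun p => 'D_v f p) z +
     'D_(Jmul v) (fun p => 'D_(Jmul v) f p) z))%:C.
Proof.
move=> oW Cf Wz; apply: complexP; last first.
  by rewrite (herm_qf_im _ (hess_herm oW Cf Wz)).
rewrite qfE exchange_big Re_sum ReC.
rewrite (Ck_derive2_coord (k := 0) v oW Cf Wz) (Ck_derive2_coord (k := 0) (Jmul v) oW Cf Wz).
rewrite !big_coord2 -big_split mulr_sumr; apply: eq_bigr => j _.
rewrite Re_sum -big_split mulr_sumr; apply: eq_bigr => k _.
rewrite (hessE _ _ oW Cf Wz) !mxE /Jmul /rcoord /= !mxE.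
exact: levi_alg.
Qed.

Lemma coord_Jmul (F : 'I_n + 'I_n -> R) v :
  \sum_a rcoord a (Jmul v) * F a =
  \sum_(k < n) (v.1 ord0 k * F (inr k) - v.2 ord0 k * F (inl k)).
Proof.
rewrite big_coord; apply: eq_bigr => k _ /=.
by rewrite mxE mulNr addrC.
Qed.

(** The Cauchy-Riemann equations, extended from the coordinate directions to
    all real directions by linearity. *)
Lemma holomorphic_CR W (F : V -> C) v z : open W -> holomorphic W F -> W z ->
  'D_(Jmul v) (fun p => Re (F p)) z = - 'D_v (fun p => Im (F p)) z /\
  'D_(Jmul v) (fun p => Im (F p)) z = 'D_v (fun p => Re (F p)) z.
Proof.
move=> oW [[sR sI] CR] Wz.
have dR := Ck_differentiable oW (sR 1%N) Wz.
have dI := Ck_differentiable oW (sI 1%N) Wz.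
have cr k : 'D_(ex k) (fun p => Re (F p)) z = 'D_(ey k) (fun p => Im (F p)) z /\
            'D_(ey k) (fun p => Re (F p)) z = - 'D_(ex k) (fun p => Im (F p)) z.
  have := CR k z Wz; rewrite /partialzbar => /eqP.
  rewrite mulf_eq0 invr_eq0 pnatr_eq0 /= => /eqP E.
  have := congr1 (@complex.Re R) E; have := congr1 (@complex.Im R) E.
  rewrite ReD ImD ReM ImM /DC /= ?mul0r ?mul1r ?add0r ?sub0r ?addr0 => e1 e2.
  by split; apply/eqP; [rewrite -subr_eq0 e2|rewrite -addr_eq0 addrC e1].
rewrite !(derive_coord _ dR) !(derive_coord _ dI) !coord_Jmul !big_coord.
rewrite -sumrN; split; apply: eq_bigr => k _; have [e1 e2] := cr k.
  by rewrite /= e1 e2 mulrN -opprD addrC.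
by rewrite /= e1 e2 mulrN addrC.
Qed.

End Hessian.

(** * Composition with holomorphic maps *)

Section Chain.
Context {R : realType}.
Local Notation C := R[i].

Lemma coord_inj m (h k : Cn R m) : (forall a, rcoord a h = rcoord a k) -> h = k.
Proof. by move=> e; rewrite [h]coord_sum [k]coord_sum; apply: eq_bigr => a _; rewrite e. Qed.

Lemma is_derive_big (V : normedModType R) (z v : V) I (s : seq I) (F : I -> V -> R) dF :
  (forall i, is_derive z v (F i) (dF i)) ->
  is_derive z v (fun y => \sum_(i <- s) F i y) (\sum_(i <- s) dF i).
Proof.
move=> cF; elim: s => [|i s IH].
  by rewrite big_nil; under eq_fun do rewrite big_nil; apply: is_derive_cst.
by rewrite big_cons; under eq_fun do rewrite big_cons; apply: is_deriveD.
Qed.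

Lemma derivable_Cn m (V : normedModType R) (T : V -> Cn R m) z v :
  (forall a, derivable (fun p => rcoord a (T p)) z v) ->
  derivable T z v /\ forall a, rcoord a ('D_v T z) = 'D_v (fun p => rcoord a (T p)) z.
Proof.
move=> dT.
have d1 : derivable (fun p => (T p).1) z v.
  by apply/derivable_mxP => i j; rewrite ord1; exact: (dT (inl j)).
have d2 : derivable (fun p => (T p).2) z v.
  by apply/derivable_mxP => i j; rewrite ord1; exact: (dT (inr j)).
have cT : (fun h : R => h^-1 *: (T (h *: v + z) - T z)) @ 0^' -->
    (('D_v (fun p => (T p).1) z, 'D_v (fun p => (T p).2) z) : Cn R m).
  exact: cvg_pair d1 d2.
have -> : 'D_v T z = ('D_v (fun p => (T p).1) z, 'D_v (fun p => (T p).2) z).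
  exact: cvg_lim cT.
split; first by apply: (cvgP _ cT).
case=> j.
  by have := congr1 (fun M : 'rV[R]_m => M ord0 j) (derive_mx d1); rewrite mxE.
by have := congr1 (fun M : 'rV[R]_m => M ord0 j) (derive_mx d2); rewrite mxE.
Qed.

Variables (n m : nat) (W : set (Cn R n)) (W' : set (Cn R m)) (T : Cn R n -> Cn R m).
Hypotheses (oW : open W) (oW' : open W') (TW : forall z, W z -> W' (T z)).
Hypothesis hT : forall j, holomorphic W (fun z => zcoord j (T z)).

Let Tc a p := rcoord a (T p).

Lemma Ck_Tc k a : Ck k W (Tc a).
Proof. by case: a => j; have [[sR sI] _] := hT j; [exact: (sR k)|exact: (sI k)]. Qed.

Lemma derivable_T z v : W z ->
  derivable T z v /\ forall a, rcoord a ('D_v T z) = 'D_v (Tc a) z.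
Proof.
by move=> Wz; apply: derivable_Cn => a; exact: (Ck_derivable (Ck_Tc 1 a) Wz).
Qed.

(** The differential of a holomorphic map is complex linear. *)
Lemma derive_Jmul z v : W z -> 'D_(Jmul v) T z = Jmul ('D_v T z).
Proof.
move=> Wz; have [_ e] := derivable_T v Wz; have [_ eJ] := derivable_T (Jmul v) Wz.
apply: coord_inj; case=> j; rewrite eJ; have [e1 e2] := holomorphic_CR v oW (hT j) Wz.
  by have := e (inr j); rewrite /= mxE => ->.
by have := e (inl j); rewrite /= => ->.
Qed.

(** The Cauchy-Riemann equations are used twice, with an exchange of
    derivatives in between. *)
Lemma harmonic_T a z v : W z ->
  'D_v (fun p => 'D_v (Tc a) p) z + 'D_(Jmul v) (fun p => 'D_(Jmul v) (Tc a) p) z = 0.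
Proof.
move=> Wz.
(* One application of the Cauchy-Riemann equations, with sign s, followed by
   the exchange of the derivatives along v and iv. *)
have H b c s : (forall p, W p -> 'D_(Jmul v) (Tc b) p = s * 'D_v (Tc c) p) ->
    'D_(Jmul v) (fun p => 'D_(Jmul v) (Tc b) p) z = s * 'D_v (fun p => 'D_(Jmul v) (Tc c) p) z.
  move=> e; rewrite (near_eq_derive _ (near_open oW Wz e)).
  have d := Ck_derivable (v := Jmul v) (Ck_derive v (Ck_Tc 2 c)) Wz.
  rewrite -(Ck_schwarz v (Jmul v) oW (Ck_Tc 2 c) Wz).
  exact: (deriveZ s d).
have H' b c s : (forall p, W p -> 'D_(Jmul v) (Tc c) p = s * 'D_v (Tc b) p) ->
    'D_v (fun p => 'D_(Jmul v) (Tc c) p) z = s * 'D_v (fun p => 'D_v (Tc b) p) z.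
  move=> e; rewrite (near_eq_derive _ (near_open oW Wz e)).
  have d := Ck_derivable (v := v) (Ck_derive v (Ck_Tc 2 b)) Wz.
  exact: (deriveZ s d).
have fin (x y w s s' : R) : s * s' = -1 -> y = s * w -> w = s' * x -> x + y = 0.
  by move=> ss -> ->; rewrite mulrA ss mulN1r subrr.
case: a => j.
- have e1 p : W p -> 'D_(Jmul v) (Tc (inl j)) p = -1 * 'D_v (Tc (inr j)) p.
    by move=> Wp; have [-> _] := holomorphic_CR v oW (hT j) Wp; rewrite mulN1r.
  have e2 p : W p -> 'D_(Jmul v) (Tc (inr j)) p = 1 * 'D_v (Tc (inl j)) p.
    by move=> Wp; have [_ ->] := holomorphic_CR v oW (hT j) Wp; rewrite mul1r.
  by apply: fin (H _ _ _ e1) (H' _ _ _ e2); rewrite mulr1.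
- have e1 p : W p -> 'D_(Jmul v) (Tc (inr j)) p = 1 * 'D_v (Tc (inl j)) p.
    by move=> Wp; have [_ ->] := holomorphic_CR v oW (hT j) Wp; rewrite mul1r.
  have e2 p : W p -> 'D_(Jmul v) (Tc (inl j)) p = -1 * 'D_v (Tc (inr j)) p.
    by move=> Wp; have [-> _] := holomorphic_CR v oW (hT j) Wp; rewrite mulN1r.
  by apply: fin (H _ _ _ e1) (H' _ _ _ e2); rewrite mul1r.
Qed.

Lemma derive_compT (f : Cn R m -> R) z v : W z -> differentiable f (T z) ->
  is_derive z v (fun p => f (T p)) (\sum_a 'D_v (Tc a) z * 'D_(rbasis a) f (T z)).
Proof.
move=> Wz df; have [dT eT] := derivable_T v Wz.
pose c (t : R) := T (z + t *: v).
have [dc ec] := derive_line T z v 0; rewrite scale0r addr0 in dc ec.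
have dc0 : differentiable c 0 by apply/derivable1_diffP/dc.
have c0 : c 0 = T z by rewrite /c scale0r addr0.
have df0 : differentiable f (c 0) by rewrite c0.
have dfc : differentiable (f \o c) 0 := differentiable_comp dc0 df0.
have [a e] := derive_line (fun p => f (T p)) z v 0; rewrite scale0r addr0 in a e.
have -> : \sum_a 'D_v (Tc a) z * 'D_(rbasis a) f (T z) = 'D_v (fun p => f (T p)) z.
  rewrite -e (deriveE _ dfc) (diff_comp dc0 df0) /= -(deriveE _ dc0) ec c0 -(deriveE _ df).
  by rewrite (derive_coord _ df); apply: eq_bigr => b _; rewrite eT.
exact: (derivableP (a.1 ((derivable1_diffP _ _).2 dfc))).
Qed.

Lemma derive2_compT (f : Cn R m -> R) z v : Ck 2 W' f -> W z ->
  'D_v (fun p => 'D_v (fun q => f (T q)) p) z =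
  \sum_a 'D_v (fun p => 'D_v (Tc a) p) z * 'D_(rbasis a) f (T z) +
  'D_('D_v T z) (fun p => 'D_('D_v T z) f p) (T z).
Proof.
move=> Cf Wz.
have E : \forall p \near z, \sum_a 'D_v (Tc a) p * 'D_(rbasis a) f (T p) = 'D_v (fun q => f (T q)) p.
  apply: (near_open oW Wz) => p Wp.
  have [_ e] := derive_compT v Wp (Ck_differentiable oW' Cf (TW Wp)).
  exact: esym e.
rewrite -(near_eq_derive _ E).
have dT a : is_derive z v (fun p => 'D_v (Tc a) p) ('D_v (fun p => 'D_v (Tc a) p) z).
  by apply: derivableP; exact: (Ck_derivable (Ck_derive v (Ck_Tc 2 a)) Wz).
have df a : is_derive z v (fun p => 'D_(rbasis a) f (T p))
    (\sum_b 'D_v (Tc b) z * 'D_(rbasis b) (fun q => 'D_(rbasis a) f q) (T z)).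
  by apply: derive_compT => //; exact: (Ck_differentiable oW' (Ck_derive _ Cf) (TW Wz)).
have [_ ->] := @is_derive_big _ z v _ (index_enum _) _ _ (fun a => is_deriveM (dT a) (df a)).
rewrite (Ck_derive2_coord (k := 0) _ oW' Cf (TW Wz)) exchange_big /= -big_split /=.
apply: eq_bigr => a _; rewrite addrC; congr (_ + _).
  have [_ e] := derivable_T v Wz.
  rewrite /GRing.scale /= mulr_sumr; apply: eq_bigr => b _.
  by rewrite !e mulrA [_ * 'D_v (Tc b) z]mulrC.
exact: mulrC.
Qed.

(** In derive2_compT the terms with second derivatives of T add up to zero
    over the directions v and iv, by harmonic_T. *)
Lemma levi_compT (f : Cn R m -> R) z v : Ck 2 W' f -> W z ->
  'D_v (fun p => 'D_v (fun q => f (T q)) p) z +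
  'D_(Jmul v) (fun p => 'D_(Jmul v) (fun q => f (T q)) p) z =
  'D_('D_v T z) (fun p => 'D_('D_v T z) f p) (T z) +
  'D_(Jmul ('D_v T z)) (fun p => 'D_(Jmul ('D_v T z)) f p) (T z).
Proof.
move=> Cf Wz; rewrite !derive2_compT // (derive_Jmul v Wz) addrACA -big_split /=.
rewrite big1 ?add0r // => a _.
by rewrite -mulrDl harmonic_T // mul0r.
Qed.

End Chain.

#[local] Opaque hess Ck.

(** * The Levi form *)

Section LeviForm.
Context {R : realType} {n : nat}.
Local Notation C := R[i].
Local Notation V := (Cn R n).

Definition levi (f : V -> R) z v : R :=
  'D_v (fun p => 'D_v f p) z + 'D_(Jmul v) (fun p => 'D_(Jmul v) f p) z.

Lemma zvec_surj (u : 'cV[C]_n) : exists v : V, zvec v = u.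
Proof.
exists (\row_j Re (u j 0), \row_j Im (u j 0)).
by apply/matrixP => j k; rewrite !mxE /zcoord /= !mxE (ord1 k); case: (u j 0).
Qed.

Lemma qf_hess_levi W f z v : open W -> Ck 2 W f -> W z ->
  qf (hess f z) (zvec v) = (4^-1 * levi f z v)%:C.
Proof. exact: qf_hess. Qed.

Lemma levi_eq W (f g : V -> R) z v : open W -> W z -> (forall p, W p -> f p = g p) ->
  levi f z v = levi g z v.
Proof.
move=> oW Wz e; have H w : 'D_w (fun p => 'D_w f p) z = 'D_w (fun p => 'D_w g p) z.
  apply: near_eq_derive; apply: (near_open oW Wz) => p Wp.
  by apply: near_eq_derive; apply: (near_open oW Wp).
exact: (congr2 +%R (H v) (H (Jmul v))).
Qed.

Lemma leviB W (f g : V -> R) z v : open W -> W z -> Ck 2 W f -> Ck 2 W g ->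
  levi (fun p => f p - g p) z v = levi f z v - levi g z v.
Proof.
move=> oW Wz Cf Cg.
have H w : 'D_w (fun p => 'D_w (fun q => f q - g q) p) z =
    'D_w (fun p => 'D_w f p) z - 'D_w (fun p => 'D_w g p) z.
  have e p : W p -> 'D_w (fun q => f q - g q) p = 'D_w f p - 'D_w g p.
    by move=> Wp; exact: (deriveB (Ck_derivable Cf Wp) (Ck_derivable Cg Wp)).
  rewrite (near_eq_derive _ (near_open oW Wz e)).
  exact: (deriveB (Ck_derivable (Ck_derive w Cf) Wz) (Ck_derivable (Ck_derive w Cg) Wz)).
have alg (a b c d e f' : R) : a = b - c -> d = e - f' -> a + d = (b + e) - (c + f').
  by move=> -> ->; ring.
exact: alg (H v) (H (Jmul v)).
Qed.

(** A matrix is determined by its form, and the form of the Hessian is the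
    Levi form. *)
Lemma hessB W (f g : V -> R) z : open W -> W z -> Ck 2 W f -> Ck 2 W g ->
  hess (fun p => f p - g p) z = hess f z - hess g z.
Proof.
move=> oW Wz Cf Cg; apply: polarization => u; have [v <-] := zvec_surj u.
have Cfg : Ck 2 W (fun p => f p - g p) := CkD oW Cf (CkN oW Cg).
rewrite qfD -[- hess g z]scaleN1r qfZ.
have alg (x y w : C) (l1 l2 l3 : R) : x = (4^-1 * l1)%:C -> y = (4^-1 * l2)%:C ->
    w = (4^-1 * l3)%:C -> l1 = l2 - l3 -> x = y + (-1) * w.
  by move=> -> -> -> ->; apply: complexP; rewrite !(ReD, ImD, ReM, ImM) /=; ring.
exact: alg (qf_hess_levi v oW Cfg Wz) (qf_hess_levi v oW Cf Wz) (qf_hess_levi v oW Cg Wz)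
  (leviB v oW Wz Cf Cg).
Qed.

Lemma hess_eq W (f g : V -> R) z : open W -> W z -> Ck 2 W f -> (forall p, W p -> f p = g p) ->
  hess f z = hess g z.
Proof.
move=> oW Wz Cf e; apply: polarization => u; have [v <-] := zvec_surj u.
have Cg := Ck_eq oW e Cf.
have alg (x y : C) (l1 l2 : R) : x = (4^-1 * l1)%:C -> y = (4^-1 * l2)%:C -> l1 = l2 -> x = y.
  by move=> -> -> ->.
exact: alg (qf_hess_levi v oW Cf Wz) (qf_hess_levi v oW Cg Wz) (levi_eq v oW Wz e).
Qed.

Lemma is_derive_div (N r : V -> R) z v dN dr : r z != 0 ->
  is_derive z v N dN -> is_derive z v r dr ->
  is_derive z v (fun p => N p / r p) (dN / r z - N z * dr / (r z ^+ 2)).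
Proof.
move=> r0 [d1 <-] [d2 <-].
have dV : is_derive z v (fun p => (r p)^-1) (- (r z) ^- 2 *: 'D_v r z).
  by apply: DeriveDef; [exact: derivableV|exact: deriveV].
have := is_deriveM (derivableP d1) dV.
have -> : N z *: (- r z ^- 2 *: 'D_v r z) + (r z)^-1 *: 'D_v N z =
   'D_v N z / r z - N z * 'D_v r z / r z ^+ 2.
  by rewrite /GRing.scale /=; field.
by [].
Qed.

Lemma levi_log_alg (p q pv qv pvv qvv : R) : p ^+ 2 + q ^+ 2 != 0 ->
  let r := p ^+ 2 + q ^+ 2 in
  (2 * (pv * pv + p * pvv + (qv * qv + q * qvv)) / r
   - 2 * (p * pv + q * qv) * (2 * (p * pv + q * qv)) / r ^+ 2) +
  (2 * (pv * pv + q * (- qvv) + ((- qv) * (- qv) + p * (- pvv))) / r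
   - 2 * (q * pv + p * (- qv)) * (2 * (p * (- qv) + q * pv)) / r ^+ 2) = 0.
Proof. by move=> r0 r; rewrite /r; field. Qed.

Lemma is_derive_2MM (p a q b : V -> R) z v dp da dq db :
  is_derive z v p dp -> is_derive z v a da -> is_derive z v q dq -> is_derive z v b db ->
  is_derive z v (fun y => 2 * (p y * a y + q y * b y))
    (2 * (dp * a z + p z * da + (dq * b z + q z * db))).
Proof.
move=> d1 d2 d3 d4; apply: is_derive_eq; rewrite /GRing.scale /=; ring.
Qed.

(** The logarithm of |F|^2 is pluriharmonic where the holomorphic function F
    has no zero. The second derivatives along v and iv are computed with the
    Cauchy-Riemann equations and cancel by levi_log_alg. *)
Lemma levi_log_normsq W (F : V -> C) z v : open W -> holomorphic W F ->
  (forall p, W p -> F p != 0) -> W z ->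
  levi (fun p => ln (Re (F p) ^+ 2 + Im (F p) ^+ 2)) z v = 0.
Proof.
move=> oW hF F0 Wz; have [[sR sI] _] := hF.
pose P p := Re (F p); pose Q p := Im (F p).
have CP : Ck 2 W P := sR 2%N.
have CQ : Ck 2 W Q := sI 2%N.
pose r p := P p ^+ 2 + Q p ^+ 2.
have r0 p : W p -> 0 < r p by move=> /F0; exact: sqn_gt0.
pose Pv p := 'D_v P p; pose Qv p := 'D_v Q p.
have dP w p : W p -> is_derive p w P ('D_w P p).
  by move=> Wp; exact: derivableP (Ck_derivable CP Wp).
have dQ w p : W p -> is_derive p w Q ('D_w Q p).
  by move=> Wp; exact: derivableP (Ck_derivable CQ Wp).
have cr p : W p -> 'D_(Jmul v) P p = - Qv p /\ 'D_(Jmul v) Q p = Pv p.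
  by move=> Wp; exact: (holomorphic_CR v oW hF Wp).
have dr w p : W p -> is_derive p w r (2 * (P p * 'D_w P p + Q p * 'D_w Q p)).
  move=> Wp; have d1 := dP w p Wp; have d2 := dQ w p Wp.
  by rewrite /r; under eq_fun do rewrite !expr2; apply: is_derive_eq; rewrite /GRing.scale /=; ring.
have dln w p : W p -> 'D_w (fun q => ln (r q)) p = 2 * (P p * 'D_w P p + Q p * 'D_w Q p) / r p.
  move=> Wp; have [d e] := dr w p Wp.
  by have [_ ->] := derive_ln (r0 p Wp) d; rewrite e.
pose N1 p := 2 * (P p * Pv p + Q p * Qv p).
pose N2 p := 2 * (Q p * Pv p + P p * (- Qv p)).
have e1 p : W p -> 'D_v (fun q => ln (r q)) p = N1 p / r p := dln v p.
have e2 p : W p -> 'D_(Jmul v) (fun q => ln (r q)) p = N2 p / r p.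
  move=> Wp; rewrite (dln _ _ Wp); have [-> ->] := cr p Wp.
  by rewrite /N2 addrC.
have dPv w : is_derive z w Pv ('D_w Pv z).
  exact: derivableP (Ck_derivable (Ck_derive v CP) Wz).
have dQv w : is_derive z w Qv ('D_w Qv z).
  exact: derivableP (Ck_derivable (Ck_derive v CQ) Wz).
have crv : 'D_(Jmul v) Pv z = - 'D_v Qv z /\ 'D_(Jmul v) Qv z = 'D_v Pv z.
  have s1 := Ck_schwarz (k := 0) v (Jmul v) oW CP Wz.
  have s2 := Ck_schwarz (k := 0) v (Jmul v) oW CQ Wz.
  split; [transitivity ('D_v (fun q => 'D_(Jmul v) P q) z)|
          transitivity ('D_v (fun q => 'D_(Jmul v) Q q) z)]; [exact: s1| |exact: s2|].
    have E p : W p -> 'D_(Jmul v) P p = - Qv p by move=> /cr[].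
    rewrite (near_eq_derive _ (near_open oW Wz E)).
    exact: (deriveN (f := Qv) (@ex_derive _ _ _ _ _ _ _ (dQv v))).
  have E p : W p -> 'D_(Jmul v) Q p = Pv p by move=> /cr[].
  exact: (near_eq_derive _ (near_open oW Wz E)).
have rz : r z != 0 by rewrite gt_eqF // r0.
have d1 := is_derive_2MM (dP v z Wz) (dPv v) (dQ v z Wz) (dQv v).
have jP : is_derive z (Jmul v) P (- Qv z).
  by have [c1 _] := cr z Wz; exact: (DeriveDef (@ex_derive _ _ _ _ _ _ _ (dP (Jmul v) z Wz)) c1).
have jQ : is_derive z (Jmul v) Q (Pv z).
  by have [_ c2] := cr z Wz; exact: (DeriveDef (@ex_derive _ _ _ _ _ _ _ (dQ (Jmul v) z Wz)) c2).
have jPv : is_derive z (Jmul v) Pv (- 'D_v Qv z).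
  by have [c1 _] := crv; exact: (DeriveDef (@ex_derive _ _ _ _ _ _ _ (dPv (Jmul v))) c1).
have jQv : is_derive z (Jmul v) Qv ('D_v Pv z).
  by have [_ c2] := crv; exact: (DeriveDef (@ex_derive _ _ _ _ _ _ _ (dQv (Jmul v))) c2).
have d2 := is_derive_2MM jQ jPv jP (is_deriveN jQv).
have dr2 := dr (Jmul v) z Wz; have [c1 c2] := cr z Wz; rewrite c1 c2 in dr2.
have [_ D1] := is_derive_div rz d1 (dr v z Wz).
have [_ D2] := is_derive_div rz d2 dr2.
have L1 : 'D_v (fun p => 'D_v (fun q => ln (r q)) p) z = 'D_v (fun p => N1 p / r p) z.
  exact: (near_eq_derive _ (near_open oW Wz e1)).
have L2 : 'D_(Jmul v) (fun p => 'D_(Jmul v) (fun q => ln (r q)) p) z = 'D_(Jmul v) (fun p => N2 p / r p) z.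
  exact: (near_eq_derive _ (near_open oW Wz e2)).
have fin (a a' a'' b b' b'' : R) : a = a' -> a' = a'' -> b = b' -> b' = b'' -> a'' + b'' = 0 -> a + b = 0.
  by move=> -> -> -> ->.
apply: (fin _ _ _ _ _ _ L1 D1 L2 D2).
exact: (@levi_log_alg (P z) (Q z) (Pv z) (Qv z) ('D_v Pv z) ('D_v Qv z) rz).
Qed.

End LeviForm.

#[local] Opaque levi.

(** * Change of holomorphic coordinates *)

Section Tangent.
Context {R : realType}.
Local Notation C := R[i].
Variables (n m : nat) (W : set (Cn R n)) (W' : set (Cn R m)) (T : Cn R n -> Cn R m).
Hypotheses (oW : open W) (oW' : open W') (TW : forall z, W z -> W' (T z)).
Hypothesis hT : forall j, holomorphic W (fun z => zcoord j (T z)).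

(** The complex Jacobian matrix. *)
Definition tangent_mx (z : Cn R n) : 'M[C]_(m, n) := \matrix_(k, j) zcoord k ('D_(ex j) T z).

(** Both sides agree on the vectors ex j, and the differential of T is
    complex linear. *)
Lemma tangentP z v : W z -> zvec ('D_v T z) = tangent_mx z *m zvec v.
Proof.
move=> Wz.
have E : 'D_v T z = \sum_(j < n) (v.1 ord0 j *: 'D_(ex j) T z + v.2 ord0 j *: Jmul ('D_(ex j) T z)).
  apply: coord_inj => b.
  have [_ e] := derivable_T hT v Wz; rewrite e.
  have d := Ck_differentiable oW (Ck_Tc hT 1 b) Wz.
  rewrite (derive_coord v d) big_coord.
  have cs (F : 'I_n -> Cn R m) : rcoord b (\sum_j F j) = \sum_j rcoord b (F j).
    by apply: (big_morph (rcoord b) (rcoordD b)); rewrite -(scale0r (0 : Cn R m)) rcoordZ mul0r.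
  rewrite cs; apply: eq_bigr => j _; rewrite rcoordD !rcoordZ.
  have [_ ex_j] := derivable_T hT (ex j) Wz.
  have [_ ey_j] := derivable_T hT (ey j) Wz.
  have J : Jmul (ex j) = ey j :> Cn R n.
    by rewrite /Jmul /ex /ey /= oppr0.
  have DJ := derive_Jmul oW hT (ex j) Wz; rewrite J in DJ.
  have alg (x y c e1 c' e' : R) : c' = c -> e' = e1 -> x * c + y * e1 = x * c' + y * e'.
    by move=> -> ->.
  exact: alg (ex_j b) (etrans (congr1 (rcoord b) (esym DJ)) (ey_j b)).
have zs k (F : 'I_n -> Cn R m) : zcoord k (\sum_j F j) = \sum_j zcoord k (F j).
  apply: (big_morph (zcoord k)) => [h h'|]; apply: complexP; rewrite /zcoord /= ?mxE //.
apply/matrixP => k i; rewrite !mxE E zs; apply: eq_bigr => j _; rewrite !mxE.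
by apply: complexP; rewrite !(ReM, ImM) /zcoord /= !mxE; ring.
Qed.

(** This is the invariance of the Levi form, read on Hermitian forms. *)
Lemma hess_compT (f : Cn R m -> R) z : Ck 2 W' f -> Ck 2 W (fun p => f (T p)) -> W z ->
  hess (fun p => f (T p)) z = (tangent_mx z) ^t* *m hess f (T z) *m tangent_mx z.
Proof.
move=> Cf Cg Wz; apply: polarization => u; have [v <-] := zvec_surj u.
rewrite qf_conj -(tangentP v Wz).
have alg (x y : C) (l1 l2 : R) : x = (4^-1 * l1)%:C -> y = (4^-1 * l2)%:C -> l1 = l2 -> x = y.
  by move=> -> -> ->.
exact: alg (qf_hess_levi v oW Cg Wz) (qf_hess_levi _ oW' Cf (TW Wz)) (levi_compT oW oW' TW hT v Cf Wz).
Qed.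

End Tangent.

Section FormQf.
Context {R : realType} {n : nat}.
Local Notation C := R[i].
Local Notation V := (Cn R n).

(** The real frame (v, iv) of a complex line. *)
Definition pairJ (v : V) : 'I_2 -> V := fun i => if i == ord0 then v else Jmul v.

Lemma zcoordJ j (v : V) : zcoord j (Jmul v) = 'i%C * zcoord j v :> C.
Proof. by apply: complexP; rewrite !(ReM, ImM) /zcoord /Jmul /= ?mxE; ring. Qed.

(** Evaluated on the frame (v, iv), a (1,1)-form gives back the Hermitian
    form of its matrix. *)
Lemma form11_J c a (v : V) : form11 c a (pairJ v) = c * (- 2 * 'i%C) * qf a (zvec v).
Proof.
rewrite form11_alt /alt /pairs.
pose be u w : C := \sum_k (\sum_j c * a k j * zcoord j u) * conjc (zcoord k w).
have beE u w : be u w = c * \sum_k \sum_j a k j * zcoord j u * conjc (zcoord k w).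
  rewrite /be mulr_sumr; apply: eq_bigr => k _; rewrite mulr_suml mulr_sumr.
  by apply: eq_bigr => j _; rewrite !mulrA.
transitivity (be v (Jmul v) - be (Jmul v) v).
  have o2 (i : 'I_2) : i = ord0 \/ i = lift ord0 ord0.
    by case: (unliftP ord0 i) => [j ->|->]; [right; rewrite (ord1 j)|left].
  have S2 (s : 'S_2) : s != 1%g -> s = tperm ord0 (lift ord0 ord0).
    move=> s1; have s0 : s ord0 = lift ord0 ord0.
      have [e|//] := o2 (s ord0); case/eqP: s1; apply/permP => i; rewrite perm1.
      have [->//|->] := o2 i; have [e1|//] := o2 (s (lift ord0 ord0)).
      by have /perm_inj := etrans e1 (esym e).
    apply/permP => i; have [->|->] := o2 i; first by rewrite tpermL.
    rewrite tpermR; have [//|e1] := o2 (s (lift ord0 ord0)).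
    by have /perm_inj := etrans e1 (esym s0).
  rewrite (bigD1 (1%g : 'S_2)) //= (big_pred1 (tperm ord0 (lift ord0 ord0))) => [|s]; last first.
    apply/idP/eqP => [/S2|->] //; apply/eqP => /permP/(_ ord0).
    by rewrite tpermL perm1.
  rewrite odd_perm1 odd_tperm /= expr0 mul1r mulN1r !big_ord1 !perm1.
  have -> : ev (ord0 : 'I_1) = (ord0 : 'I_2) by apply/val_inj.
  have -> : od (ord0 : 'I_1) = (lift ord0 ord0 : 'I_2) by apply/val_inj.
  by rewrite tpermL tpermR.
rewrite !beE; have := qfE a (zvec v); move: (qf a (zvec v)) => S SE.
have -> : \sum_k \sum_j a k j * zcoord j v * conjc (zcoord k (Jmul v)) = - 'i%C * S.
  rewrite SE mulr_sumr; apply: eq_bigr => k _; rewrite mulr_sumr; apply: eq_bigr => j _.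
  rewrite zcoordJ rmorphM /= !mxE.
  have -> : 0 -i* 1 = - 'i%C :> C by apply: complexP; rewrite /= ?oppr0.
  by rewrite mulrCA !mulrA.
have -> : \sum_k \sum_j a k j * zcoord j (Jmul v) * conjc (zcoord k v) = 'i%C * S.
  rewrite SE mulr_sumr; apply: eq_bigr => k _; rewrite mulr_sumr; apply: eq_bigr => j _.
  by rewrite zcoordJ !mxE mulrCA !mulrA.
by move: ('i%C : C) => i; ring.
Qed.

End FormQf.

(** * Extrema and Euclidean geometry *)

Section Topo.
Context {R : realType}.

Lemma evt_max (T : topologicalType) (A : set T) (f : T -> R) : A !=set0 -> compact A ->
  (forall z, A z -> {for z, continuous f}) -> exists2 c, A c & forall t, A t -> f t <= f c.
Proof.
move=> A0 cA cf.
have [|c cA' cm] := compact_EVT_max A0 cA (f := f).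
  by apply: continuous_in_subspaceT => z /set_mem /cf.
by exists c; [exact: set_mem|move=> t /mem_set /cm].
Qed.

Lemma evt_min (T : topologicalType) (A : set T) (f : T -> R) : A !=set0 -> compact A ->
  (forall z, A z -> {for z, continuous f}) -> exists2 c, A c & forall t, A t -> f c <= f t.
Proof.
move=> A0 cA cf.
have [|c cA' cm] := compact_EVT_min A0 cA (f := f).
  by apply: continuous_in_subspaceT => z /set_mem /cf.
by exists c; [exact: set_mem|move=> t /mem_set /cm].
Qed.

(** Meant for functions that are continuous only on an open set around K. *)
Lemma closed_preimage_on (T : topologicalType) (K : set T) (D : set R) (f : T -> R) :
  closed K -> closed D -> (forall z, K z -> {for z, continuous f}) ->
  closed [set z | K z /\ D (f z)].
Proof.
move=> cK cD cf z clz.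
have Kz : K z by apply: cK => B nB; have [x [[Kx _] Bx]] := clz B nB; exists x.
split=> //; apply: contrapT => nD.
have nf : nbhs z (f @^-1` (~` D)).
  by apply: (cf z Kz); apply: open_nbhs_nbhs; split => //; exact: closed_openC.
by have [x [[_ Dx] /= nDx]] := clz _ nf.
Qed.

End Topo.

Section Euclid.
Context {R : realType} {n : nat}.
Local Notation V := (Cn R n).
Implicit Types (x y z v : V).

Definition dot x y : R := \sum_a rcoord a x * rcoord a y.

Lemma dotDl x y z : dot (x + y) z = dot x z + dot y z.
Proof. by rewrite /dot -big_split; apply: eq_bigr => a _; rewrite rcoordD mulrDl. Qed.
Lemma dotC x y : dot x y = dot y x.
Proof. by apply: eq_bigr => a _; rewrite mulrC. Qed.
Lemma dotZl c x z : dot (c *: x) z = c * dot x z.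
Proof. by rewrite /dot mulr_sumr; apply: eq_bigr => a _; rewrite rcoordZ mulrA. Qed.
Lemma dotDr x y z : dot z (x + y) = dot z x + dot z y.
Proof. by rewrite dotC dotDl !(dotC z). Qed.
Lemma dotZr c x z : dot z (c *: x) = c * dot z x.
Proof. by rewrite dotC dotZl dotC. Qed.
Lemma dot_ge0 x : 0 <= dot x x.
Proof. by apply: sumr_ge0 => a _; rewrite -expr2 sqr_ge0. Qed.
Lemma coord_le_dot a x : rcoord a x ^+ 2 <= dot x x.
Proof.
rewrite /dot (bigD1 a) //= -expr2 lerDl; apply: sumr_ge0 => b _.
by rewrite -expr2 sqr_ge0.
Qed.
Lemma dot_eq0 x : dot x x = 0 -> x = 0.
Proof.
move=> e; apply: coord_inj => a; have := coord_le_dot a x.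
rewrite e -(scale0r (0 : V)) rcoordZ mul0r => h.
by apply/eqP; rewrite -sqrf_eq0 eq_le h sqr_ge0.
Qed.
Lemma dot_continuous (T : topologicalType) (f g : T -> V) t :
  {for t, continuous f} -> {for t, continuous g} -> {for t, continuous (fun s => dot (f s) (g s))}.
Proof.
move=> cf cg; apply: continuous_at_sum => a.
apply: cvgM.
  by apply: (continuous_comp cf); exact: coord_cvg.
by apply: (continuous_comp cg); exact: coord_cvg.
Qed.

Lemma norm_lt_coord x e : 0 < e -> (forall a, `|rcoord a x| < e) -> `|x| < e.
Proof.
move=> e0 h.
have mx (M : 'rV[R]_n) : (forall j, `|M ord0 j| < e) -> `|M| < e.
  move=> hM; rewrite [ltLHS]/Num.Def.normr/= mx_normrE.
  by apply: bigmax_lt => // -[i j] _ /=; rewrite ord1.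
have -> : `|x| = Num.max `|x.1| `|x.2| by [].
rewrite gt_max; apply/andP; split; apply: mx => j.
  exact: (h (inl j)).
exact: (h (inr j)).
Qed.

Lemma norm_lt_dot x e : 0 < e -> dot x x < e ^+ 2 -> `|x| < e.
Proof.
move=> e0 h; apply: norm_lt_coord => // a.
have := le_lt_trans (coord_le_dot a x) h.
by rewrite -(ger0_norm (ltW e0)) -real_normK ?num_real // -[ltRHS]real_normK ?num_real // ltr_pXn2r ?nnegrE // normr_id.
Qed.

Lemma closed_ball_dot c r : closed [set z | dot (z - c) (z - c) <= r].
Proof.
have -> : [set z | dot (z - c) (z - c) <= r] =
   [set z | setT z /\ [set s | s <= r] (dot (z - c) (z - c))].
  by apply/seteqP; split=> z /=; tauto.
apply: closed_preimage_on; [exact: closedT|exact: closed_le|].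
move=> z _; apply: dot_continuous; apply: cvgB; [exact: cvg_id|exact: cvg_cst|exact: cvg_id|exact: cvg_cst].
Qed.

(** A closed Euclidean ball is a closed subset of a product of segments. *)
Lemma compact_ball_dot c r : compact [set z | dot (z - c) (z - c) <= r].
Proof.
pose e := Num.max r 1 + 1.
have box (M : 'rV[R]_n) : compact [set v : 'rV[R]_n | forall i, `[M ord0 i - e, M ord0 i + e]%classic (v ord0 i)].
  by apply: (@rV_compact _ _ (fun i => `[M ord0 i - e, M ord0 i + e]%classic)) => i; exact: segment_compact.
apply: (subclosed_compact (@closed_ball_dot c r) (compact_setX (box c.1) (box c.2))).
move=> z /= hz.
have h a : `|rcoord a (z - c)| < e.
  have e1 : 1 <= e by rewrite /e lerDr le_max ler01 orbT.
  have r0 : r < e by rewrite /e ltr_pwDr // le_max lexx.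
  have := le_trans (coord_le_dot a (z - c)) hz => h.
  have : rcoord a (z - c) ^+ 2 < e ^+ 2.
    by apply: (le_lt_trans h); apply: (lt_le_trans r0); rewrite expr2 ler_peMl // (le_trans ler01).
  by rewrite -real_normK ?num_real // ltr_pXn2r // nnegrE (le_trans ler01).
split=> i /=; rewrite in_itv /=.
  by have := h (inl i); rewrite /= !mxE ltr_norml => /andP[? ?]; apply/andP; split; lra.
by have := h (inr i); rewrite /= !mxE ltr_norml => /andP[? ?]; apply/andP; split; lra.
Qed.

Lemma nbhs_ball_dot z (W : set V) : nbhs z W -> exists2 r, 0 < r &
  forall p, dot (p - z) (p - z) <= r -> W p.
Proof.
move=> /nbhs_ballP[e /= e0 eW].
exists ((e / 2) ^+ 2); first by rewrite exprn_gt0 // divr_gt0.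
move=> p h; apply: eW; rewrite -ball_normE /= distrC; apply: norm_lt_dot => //.
apply: (le_lt_trans h); rewrite ltr_pXn2r ?nnegrE ?divr_ge0 ?(ltW e0) //.
by rewrite ltr_pdivrMr // ltr_pMr // ltr1n.
Qed.

(** The symmetric second difference of u tends to its second derivative; at
    the maximum it is at most minus that of phi, which is exactly quadratic. *)
Lemma max_second (W : set V) (u phi : V -> R) (Q : R) q v : open W -> Ck 2 W u -> W q ->
  (\forall p \near q, u p + phi p <= u q + phi q) ->
  (forall t, phi (q + t *: v) + phi (q - t *: v) - 2 * phi q = 2 * t ^+ 2 * Q) ->
  'D_v (fun p => 'D_v u p) q <= - (2 * Q).
Proof.
move=> oW Cu Wq mq eq_phi; apply/ler_addgt0Pr => e e0.
have nW : nbhs q W by apply: open_nbhs_nbhs.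
have /cvgr_dist_lt/(_ _ e0) nD := Ck0 (Ck_derive v (Ck_derive v Cu)) Wq.
have [r /= r0 rP] := (nbhs_ballP q _).1 (filterI nW (filterI nD mq)).
pose t := r / (`|v| + 1) / 2.
have v1 : 0 < `|v| + 1 by rewrite ltr_wpDl.
have t0 : 0 < t by rewrite !divr_gt0.
have near_q s : `|s| <= t -> ball q r (q + s *: v).
  move=> st; rewrite -ball_normE /= opprD addrA subrr add0r normrN normrZ.
  apply: (@le_lt_trans _ _ (t * (`|v| + 1))).
    by apply: ler_pM => //; rewrite lerDl.
  by rewrite /t mulrAC divfK ?gt_eqF // ltr_pdivrMr // ltr_pMr // ltr1n.
(* The second difference of second_difference is based at a corner; starting
   from q - t v makes it symmetric about q. *)
pose z := q - t *: v.
have zE s s' : z + s *: v + s' *: v = q + (s + s' - t) *: v.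
  by rewrite /z scalerBl scalerDl -!addrA; congr (_ + _); rewrite addrC -!addrA.
have small s s' : 0 <= s <= t -> 0 <= s' <= t -> `|s + s' - t| <= t.
  by move=> /andP[? ?] /andP[? ?]; rewrite ler_norml; apply/andP; split; lra.
have [s s' st st'|s [s' [st st' E]]] := @second_difference _ _ u z v v t t0.
  have [Wp _] := rP _ (near_q _ (small s s' st st')); rewrite zE.
  exact: (conj (Ck_derivable Cu Wp) (Ck_derivable (Ck_derive v Cu) Wp)).
have [_ [/= D _]] := rP _ (near_q _ (small s s' st st')); rewrite (zE s s') in E.
have zt : z + t *: v + t *: v = q + t *: v by rewrite zE addrK.
have zt1 : z + t *: v = q by rewrite /z subrK.
rewrite zt zt1 in E.
have tt : `|t| <= t by rewrite gtr0_norm.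
have tt' : `|- t| <= t by rewrite normrN gtr0_norm.
have [_ [_ m1]] := rP _ (near_q _ tt); have [_ [_ m2]] := rP _ (near_q _ tt').
rewrite /= scaleNr -/z in m1 m2.
have alg (a b c fa fb fc x y : R) : a - c - c + b = t ^+ 2 * x -> a + fa <= c + fc ->
   b + fb <= c + fc -> fa + fb - 2 * fc = 2 * t ^+ 2 * Q -> `|y - x| < e -> y <= - (2 * Q) + e.
  move=> h1 h2 h3 h4; rewrite ltr_norml => /andP[_ h5].
  have t20 : 0 < t ^+ 2 by rewrite exprn_gt0.
  have : t ^+ 2 * x <= t ^+ 2 * (- (2 * Q)).
    rewrite -h1; have -> : t ^+ 2 * (- (2 * Q)) = - (2 * t ^+ 2 * Q) by ring.
    by rewrite -h4; lra.
  by rewrite ler_pM2l // => h6; lra.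
exact: alg E m1 m2 (eq_phi t) D.
Qed.

End Euclid.

(** * The strong maximum principle *)

Section Hopf.
Context {R : realType} {n : nat}.
Local Notation C := R[i].
Local Notation V := (Cn R n).

Lemma dotJ (v : V) : dot (Jmul v) (Jmul v) = dot v v.
Proof.
rewrite /dot !big_coord; apply: eq_bigr => j _ /=.
by rewrite mxE mulrNN addrC.
Qed.

(** The rank one matrix whose form is the square modulus of the Hermitian
    product with d. *)
Definition outer (d : V) : 'M[C]_n := zvec d *m (zvec d) ^t*.

Lemma qf_1 (v : V) : qf 1%:M (zvec v) = (dot v v)%:C.
Proof.
rewrite /qf mulmx1 mxE /dot big_coord rmorph_sum; apply: eq_bigr => j _.
rewrite !mxE /zcoord /=; apply: complexP; rewrite !(ReM, ImM, ReJ, ImJ) /=; ring.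
Qed.

Lemma qf_outer (d v : V) : qf (outer d) (zvec v) = (dot v d ^+ 2 + dot (Jmul v) d ^+ 2)%:C.
Proof.
have E : ((zvec d) ^t* *m zvec v) 0 0 = dot v d +i* (- dot (Jmul v) d).
  rewrite mxE /dot !big_coord; apply: complexP; rewrite ?Re_sum ?Im_sum /=.
    by apply: eq_bigr => j _; rewrite !mxE /zcoord ReM ReJ ImJ /=; ring.
  rewrite -sumrN; apply: eq_bigr => j _.
  by rewrite !mxE /zcoord ImM ReJ ImJ /=; ring.
rewrite /qf /outer !mulmxA -mulmxA mxE big_ord1 E.
have -> : ((zvec v) ^t* *m zvec d) 0 0 = conjc (((zvec d) ^t* *m zvec v) 0 0).
  have -> : (zvec v) ^t* *m zvec d = ((zvec d) ^t* *m zvec v) ^t* by rewrite adjM trmxCK.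
  by rewrite !mxE.
rewrite E; move: (dot v d) (dot _ d) => x y.
by apply: complexP; rewrite !(ReM, ImM, ReJ, ImJ) /=; ring.
Qed.

Lemma tr_outer (d : V) (G : 'M[C]_n) : \tr (outer d *m G) = qf G (zvec d).
Proof. by rewrite /outer -mulmxA mxtrace_mulC /qf trace_mx11. Qed.

Lemma outer_herm (d : V) : hermmx (outer d).
Proof. by rewrite /hermmx /outer adjM trmxCK. Qed.

Lemma zvec_neq0 (d : V) : d != 0 -> zvec d != 0.
Proof.
move=> d0; apply: contra d0 => /eqP e; apply/eqP/dot_eq0.
have := qf_1 d; rewrite e /qf mulmx0 mxE => /(congr1 (@complex.Re R)) /=.
exact: esym.
Qed.

(** A quadratic barrier at a boundary point p of the ball of centre p - d.
    Its complex Hessian is positive in the direction d, by the term in B, and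
    slightly negative across; near p it is positive only inside the ball. *)
Definition barrier (p d : V) (B : R) (z : V) : R :=
  - dot (z - p) d + B * dot (z - p) d ^+ 2 - 2 * dot (z - p) (z - p).

Lemma barrier_second p d B q v t :
  barrier p d B (q + t *: v) + barrier p d B (q - t *: v) - 2 * barrier p d B q =
  2 * t ^+ 2 * (B * dot v d ^+ 2 - 2 * dot v v).
Proof.
rewrite /barrier.
have -> : q + t *: v - p = (q - p) + t *: v by rewrite addrAC.
have -> : q - t *: v - p = (q - p) + (- t) *: v by rewrite addrAC scaleNr.
move: (q - p) => x; rewrite !(dotDl, dotDr, dotZl, dotZr) (dotC v x).
move: (dot x x) (dot x v) (dot v v) (dot x d) (dot v d) => a b c e f.
ring.
Qed.

Lemma barrier_cont p d B : continuous (barrier p d B).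
Proof.
have c1 : continuous (fun z : V => z - p) by move=> z; apply: cvgB; [exact: cvg_id|exact: cvg_cst].
have c2 : continuous (fun z : V => dot (z - p) d).
  move=> z; have cd : {for z, continuous (fun _ : V => d)} by exact: cvg_cst.
  exact: (dot_continuous (c1 z) cd).
have c3 : continuous (fun z : V => dot (z - p) (z - p)).
  by move=> z; exact: (dot_continuous (c1 z) (c1 z)).
move=> z; apply: cvgB; last by apply: cvgM; [exact: cvg_cst|exact: c3].
apply: cvgD; first by apply: cvgN; exact: c2.
by apply: cvgM; [exact: cvg_cst|apply: cvgM; exact: c2].
Qed.

(** At such a maximum the complex Hessian of u + e barrier is nonpositive, so
    its trace against G is nonpositive. The Hessian of u contributes 0 and, B
    being large, the barrier contributes a positive quantity. *)
Lemma no_interior_max W (u : V -> R) (G : 'M[C]_n) p d B e q : open W -> Ck 2 W u -> W q -> 0 < e ->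
  (forall v, 0 <= Re (qf G v)) -> Re (\tr (hess u q *m G)) = 0 ->
  4 * Re (\tr G) < B * Re (qf G (zvec d)) ->
  ~ (\forall z \near q, u z + e * barrier p d B z <= u q + e * barrier p d B q).
Proof.
move=> oW Cu Wq e0 G0 trG BG mq.
pose Q v := e * (B * dot v d ^+ 2 - 2 * dot v v).
have second v t : e * barrier p d B (q + t *: v) + e * barrier p d B (q - t *: v) -
    2 * (e * barrier p d B q) = 2 * t ^+ 2 * Q v.
  have -> : 2 * t ^+ 2 * Q v = e * (2 * t ^+ 2 * (B * dot v d ^+ 2 - 2 * dot v v)).
    by rewrite /Q; ring.
  by rewrite -(barrier_second p d B q v t); ring.
have D v : 'D_v (fun z => 'D_v u z) q <= - (2 * Q v) :=
  max_second oW Cu Wq mq (second v).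
pose N := hess u q + (e / 2)%:C *: (B%:C *: outer d + (- 4)%:C *: 1%:M).
have hN : hermmx N.
  apply: hermmxD; first exact: hess_herm oW Cu Wq.
  apply: hermmxZ; apply: hermmxD; apply: hermmxZ; first exact: outer_herm.
  by rewrite /hermmx tr_scalar_mx map_scalar_mx rmorph1.
have N0 x : Re (qf N x) <= 0.
  have [v <-] := zvec_surj x.
  have L : Re (qf (hess u q) (zvec v)) = 4^-1 * levi u q v.
    by rewrite (qf_hess_levi v oW Cu Wq).
  have L' : levi u q v <= - (2 * Q v) - 2 * Q (Jmul v) := lerD (D v) (D (Jmul v)).
  rewrite /N qfD !qfZ qfD !qfZ qf_outer qf_1 ReD L; move: L'; rewrite /Q dotJ.
  move: (levi u q v) (dot v d) (dot (Jmul v) d) (dot v v) => l x1 x2 x3 L'.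
  rewrite !(ReM, ImM, ReD, ImD) /=; nra.
have := trace_le0 hN N0 G0.
rewrite /N mulmxDl -scalemxAl mulmxDl -!scalemxAl mul1mx !(mxtraceD, mxtraceZ).
rewrite tr_outer ReD trG.
move: BG; move: (qf G _) (\tr G) => x y BG.
rewrite !(ReM, ImM, ReD, ImD) /= => h.
nra.
Qed.

End Hopf.

Section StrongMax.
Context {R : realType} {n : nat}.
Local Notation C := R[i].
Local Notation V := (Cn R n).

(** Here s is the scalar product of z - p with d, and rr the square distance
    from z to p. The conclusion says that z is closer than p to the centre of
    the ball. *)
Lemma barrier_side (s rr B : R) : 0 < rr -> `|B * s| < 1 / 2 ->
  0 <= - s + B * s ^+ 2 - 2 * rr -> rr + 2 * s < 0.
Proof.
move=> r0; rewrite ltr_norml => /andP[b1 b2] h.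
have h' : 2 * rr <= - s * (1 - B * s) by move: h; nra.
by nra.
Qed.

(** Hopf's argument. The function u solves, at each point, one linear
    elliptic equation tr (M(u) G) = 0, where G ranges over a family that is
    compact and positive definite over compact sets. *)
Theorem strong_max (W : set V) (u : V -> R) (G : V -> R -> 'M[C]_n) (z0 : V) :
  open W -> Ck 2 W u ->
  (forall z t v, W z -> v != 0 -> 0 < Re (qf (G z t) v)) ->
  (forall z t i j, W z -> ccont (fun zt : V * R => G zt.1 zt.2 i j) (z, t)) ->
  (forall z, W z -> exists2 t, 0 <= t <= 1 & Re (\tr (hess u z *m G z t)) = 0) ->
  W z0 -> (forall z, W z -> u z <= u z0) ->
  \forall z \near z0, u z = u z0.
Proof.
move=> oW Cu Gpos Gcont Gtr Wz0 umax.
pose m := u z0.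
have cu z : W z -> {for z, continuous u} by move=> Wz; exact: (Ck0 Cu Wz).
have sub_cont (p : V) : continuous (fun z : V => z - p).
  by move=> z; apply: cvgB; [exact: cvg_id|exact: cvg_cst].
have dist_cont (p : V) : continuous (fun z : V => dot (z - p) (z - p)).
  by move=> z; exact: (dot_continuous (sub_cont p z) (sub_cont p z)).
have [e /= e0 eW] := (nbhs_ballP z0 W).1 (open_nbhs_nbhs (conj oW Wz0)).
have e2 : 0 < e / 2 by rewrite divr_gt0.
have n1 : \forall y \near z0, `|z0 - y| < e / 2.
  have c0 : {for z0, continuous (fun y : V => y)} by exact: cvg_id.
  have /cvgr_dist_lt/(_ _ e2) h := c0; exact: h.
have n2 : \forall y \near z0, dot (z0 - y) (z0 - y) < (e / 2) ^+ 2.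
  have c : {for z0, continuous (fun y : V => dot (z0 - y) (z0 - y))}.
    have c' : {for z0, continuous (fun y : V => z0 - y)}.
      by apply: cvgB; [exact: cvg_cst|exact: cvg_id].
    exact: (dot_continuous c' c').
  have e22 : 0 < (e / 2) ^+ 2 by rewrite exprn_gt0.
  have /cvgr_dist_lt/(_ _ e22) := c; apply: filterS => y.
  have -> : dot (z0 - z0) (z0 - z0) = 0 by rewrite subrr -(scale0r (0 : V)) dotZl mul0r.
  by rewrite sub0r normrN ger0_norm // dot_ge0.
have n3 : \forall y \near z0, W y by apply: open_nbhs_nbhs.
apply: filterS3 n1 n2 n3 => y y1 y2 Wy.
apply: contrapT => /eqP uyne.
have uy : u y < m by rewrite lt_neqAle uyne umax.
(* Suppose u y < u z0 for some y close to z0, and let p be a point closest to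
   y where u takes the value m. *)
pose K z := dot (z - y) (z - y) <= dot (z0 - y) (z0 - y).
have KW z : K z -> W z.
  move=> Kz; apply: eW; rewrite -ball_normE /=.
  rewrite -(subrKA y) (le_lt_trans (ler_normD _ _)) // [ltRHS]splitr ltrD //.
  by rewrite distrC; apply: norm_lt_dot => //; exact: le_lt_trans Kz y2.
pose K1 := [set z | K z /\ [set m] (u z)].
have cK1 : compact K1.
  apply: (subclosed_compact _ (@compact_ball_dot _ _ y (dot (z0 - y) (z0 - y)))).
    apply: closed_preimage_on; [exact: closed_ball_dot|exact: closed_eq|].
    by move=> z /KW; exact: cu.
  by move=> z [].
have K10 : K1 !=set0 by exists z0; split => //; exact: lexx.
have [p [Kp /= up] pmin] := evt_min K10 cK1 (fun z _ => dist_cont y z).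
have Wp := KW p Kp.
(* The open ball of centre y through p is in the region u < m. *)
have far z : dot (z - y) (z - y) < dot (p - y) (p - y) -> u z < m.
  move=> lt; have Kz : K z by exact: le_trans (ltW lt) Kp.
  rewrite lt_neqAle umax ?andbT; last exact: KW.
  apply: contraTneq lt => uz; rewrite -leNgt; apply: pmin; split => //.
pose d := p - y.
have d0 : d != 0.
  by apply: contraTneq uy => /eqP; rewrite subr_eq0 => /eqP <-; rewrite up ltxx.
have [r2 r20 r2W] := nbhs_ball_dot (open_nbhs_nbhs (conj oW Wp)).
pose K2 : set (V * R) := [set z | dot (z - p) (z - p) <= r2] `*` `[0, 1]%classic.
have cK2 : compact K2 by apply: compact_setX; [exact: compact_ball_dot|exact: segment_compact].
have K2W zt : K2 zt -> W zt.1 by case=> /r2W.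
have cqf zt : K2 zt -> {for zt, continuous (fun zt : V * R => Re (qf (G zt.1 zt.2) (zvec d)))}.
  move=> /K2W Wz; have [] // : ccont (fun zt : V * R => qf (G zt.1 zt.2) (zvec d)) zt.
  under eq_fun do rewrite qfE.
  apply: ccont_sum => i; apply: ccont_sum => j.
  apply: ccontM; last exact: ccont_cst.
  by apply: ccontM; [case: zt Wz => z t Wz; exact: Gcont|exact: ccont_cst].
have ctr zt : K2 zt -> {for zt, continuous (fun zt : V * R => Re (\tr (G zt.1 zt.2)))}.
  move=> /K2W Wz; have [] // : ccont (fun zt : V * R => \tr (G zt.1 zt.2)) zt.
  by apply: ccont_sum => i; case: zt Wz => z t Wz; exact: Gcont.
have K20 : K2 !=set0.
  exists (p, 0); split => /=; last by rewrite in_itv /= lexx ler01.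
  by rewrite subrr -(scale0r (0 : V)) dotZl mul0r ltW.
have qpos zt : K2 zt -> 0 < Re (qf (G zt.1 zt.2) (zvec d)).
  by move=> /K2W Wz; apply: Gpos => //; exact: zvec_neq0.
(* The ratio between the two sides of the condition of no_interior_max is
   bounded over the compact set K2, which fixes B. *)
have [zt1 _ Bmax] := evt_max K20 cK2 (fun zt h =>
  cvgM (cvgM (cvg_cst (4 : R)) (ctr zt h)) (cvgV (lt0r_neq0 (qpos zt h)) (cqf zt h))).
pose B := 4 * Re (\tr (G zt1.1 zt1.2)) * (Re (qf (G zt1.1 zt1.2) (zvec d)))^-1 + 1.
have BG zt : K2 zt -> 4 * Re (\tr (G zt.1 zt.2)) < B * Re (qf (G zt.1 zt.2) (zvec d)).
  move=> h; rewrite -ltr_pdivrMr ?qpos //.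
  by apply: (le_lt_trans (Bmax zt h)); rewrite /B ltrDl.
have n4 : \forall z \near p, `|B * dot (z - p) d| < 1 / 2.
  have cd : {for p, continuous (fun _ : V => d)} by exact: cvg_cst.
  have c : {for p, continuous (fun z : V => B * dot (z - p) d)}.
    by apply: cvgM; [exact: cvg_cst|exact: (dot_continuous (sub_cont p p) cd)].
  have h2 : (0 : R) < 1 / 2 by rewrite divr_gt0.
  have /cvgr_dist_lt/(_ _ h2) := c; apply: filterS => z.
  have -> : dot (p - p) d = 0 by rewrite subrr -(scale0r (0 : V)) dotZl mul0r.
  by rewrite mulr0 sub0r normrN.
have [r3 r30 r3P] := nbhs_ball_dot n4.
(* The radius is small enough for barrier_side to apply with this B. *)
pose r := Num.min r2 r3.
have r0 : 0 < r by rewrite lt_min r20.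
pose Q := [set z | dot (z - p) (z - p) <= r].
have QW z : Q z -> W z by move=> h; apply: r2W; apply: (le_trans h); rewrite ge_min lexx.
have QB z : Q z -> `|B * dot (z - p) d| < 1 / 2.
  by move=> h; apply: r3P; apply: (le_trans h); rewrite ge_min lexx orbT.
have cQ : compact Q by exact: compact_ball_dot.
pose b := barrier p d B.
have cb : continuous b by exact: barrier_cont.
(* The part of the sphere of radius sqrt r around p where the barrier is
   nonnegative: it lies inside the ball of centre y, so u < m there, with a
   margin by compactness. *)
pose S := [set z | [set z | Q z /\ [set r] (dot (z - p) (z - p))] z /\ [set s | 0 <= s] (b z)].
have cS : compact S.
  apply: (subclosed_compact _ cQ); last by move=> z [[]].
  apply: closed_preimage_on => [| |z _]; [|exact: closed_ge|exact: cb].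
  apply: closed_preimage_on => [| |z _]; [exact: closed_ball_dot|exact: closed_eq|exact: dist_cont].
have Slt z : S z -> u z < m.
  move=> [[Qz /= er] bz]; apply: far.
  have := barrier_side r0 (QB z Qz); rewrite -er => /(_ bz) lt0.
  have -> : z - y = (z - p) + d by rewrite /d addrA subrK.
  have sq (x x' : V) : dot (x + x') (x + x') = dot x x + 2 * dot x x' + dot x' x'.
    by rewrite !(dotDl, dotDr) (dotC x' x); ring.
  rewrite sq -/d.
  by move: lt0; move: (dot (z - p) (z - p)) (dot (z - p) d) (dot d d) => x1 x2 x3 lt0; lra.
have [e1 e10 e1P] : exists2 e1, 0 < e1 & forall z, S z -> u z + e1 * b z < m.
  have [S0|S0] := pselect (S !=set0); last first.
    by exists 1 => // z Sz; case: S0; exists z.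
  have cf z : S z -> {for z, continuous (fun z => (m - u z) * (b z + 1)^-1)}.
    move=> Sz; have Wz : W z by apply: QW; case: Sz => -[].
    have b1 : b z + 1 != 0 by rewrite gt_eqF // ltr_wpDl //; case: Sz.
    apply: cvgM; first by apply: cvgB; [exact: cvg_cst|exact: cu].
    by apply: cvgV => //; apply: cvgD; [exact: cb|exact: cvg_cst].
  have [c Sc cmin] := evt_min S0 cS cf.
  have bpos z : S z -> 0 < b z + 1 by case=> _ /= h; rewrite ltr_wpDl.
  have dpos : 0 < (m - u c) * (b c + 1)^-1.
    by rewrite mulr_gt0 ?invr_gt0 ?bpos // subr_gt0 Slt.
  (* The quotient is minimal at c, so e1 (b z + 1) <= m - u z on S; adding 1
     to b keeps the denominator positive. *)
  exists ((m - u c) * (b c + 1)^-1) => // z Sz.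
  have := cmin z Sz; rewrite ler_pdivlMr ?bpos //.
  move: dpos; move: (_ * _) => del; move: (u z) (b z) => x1 x2 h1 h2; nra.
have [q Qq qmax] : exists2 q, Q q & forall z, Q z -> u z + e1 * b z <= u q + e1 * b q.
  apply: evt_max => // [|z Qz].
    by exists p; rewrite /Q /= subrr -(scale0r (0 : V)) dotZl mul0r ltW.
  by apply: cvgD; [exact: (cu z (QW z Qz))|apply: cvgM; [exact: cvg_cst|exact: cb]].
have Wq := QW q Qq.
have qm : m <= u q + e1 * b q.
  have Qp : Q p by rewrite /Q /= subrr -(scale0r (0 : V)) dotZl mul0r ltW.
  apply: (le_trans _ (qmax p Qp)); rewrite up /b /barrier subrr.
  have e00 x : dot (0 : V) x = 0 by rewrite -(scale0r (0 : V)) dotZl mul0r.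
  rewrite !e00; have -> : - 0 + B * 0 ^+ 2 - 2 * 0 = 0 :> R by ring.
  by rewrite mulr0 addr0.
(* On the sphere u + e1 b < m: by the choice of e1 where b >= 0, and because
   u <= m where b < 0. *)
have qin : dot (q - p) (q - p) < r.
  rewrite lt_neqAle [X in _ && X]Qq andbT; apply/eqP => er.
  have [bq|bq] := leP 0 (b q).
    have Sq : S q by [].
    by have := e1P q Sq; rewrite ltNge qm.
  have := umax q Wq; rewrite -/m => h; move: qm bq h e10.
  by move: (u q) (b q) => x1 x2 h1 h2 h3 h4; nra.
have nq : \forall z \near q, u z + e1 * b z <= u q + e1 * b q.
  have rq : 0 < r - dot (q - p) (q - p) by rewrite subr_gt0.
  have /cvgr_dist_lt/(_ _ rq) := dist_cont p q; apply: filterS => z /= h.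
  apply: qmax; rewrite /Q /=; move: h; rewrite ltr_norml => /andP[h _].
  by move: h; move: (dot _ _) (dot _ _) => x1 x2 h; lra.
have [t t01 tr0] := Gtr q Wq.
apply: (no_interior_max oW Cu Wq e10 _ tr0 _ nq).
  move=> v; have [->|v0] := eqVneq v 0; first by rewrite /qf mulmx0 mxE.
  by apply: ltW; exact: Gpos.
apply: (BG (q, t)); split; last by rewrite /= in_itv.
by apply: (le_trans Qq); rewrite ge_min lexx.
Qed.

End StrongMax.

(** * Two weights with the same angle, locally *)

Section ContExtra.
Context {R : realType}.
Local Notation C := R[i].

Lemma ccont_comp (S T : topologicalType) (f : T -> C) (k : S -> T) x :
  {for x, continuous k} -> ccont f (k x) -> ccont (fun y => f (k y)) x.
Proof. by move=> ck [c1 c2]; split; [exact: (continuous_comp ck c1)|exact: (continuous_comp ck c2)]. Qed.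

Lemma ccont_adj (T : topologicalType) n (A : T -> 'M[C]_n) x :
  (forall i j, ccont (fun y => A y i j) x) -> forall i j, ccont (fun y => (\adj (A y)) i j) x.
Proof.
move=> cA i j; under eq_fun do rewrite mxE; apply: ccontM; first exact: ccont_cst.
by apply: ccont_det => k l; under eq_fun do rewrite !mxE; exact: cA.
Qed.

Lemma ccont_mulmx (T : topologicalType) m n p (A : T -> 'M[C]_(m, n)) (B : T -> 'M[C]_(n, p)) x :
  (forall i j, ccont (fun y => A y i j) x) -> (forall i j, ccont (fun y => B y i j) x) ->
  forall i j, ccont (fun y => (A y *m B y) i j) x.
Proof.
move=> cA cB i j; under eq_fun do rewrite mxE.
by apply: ccont_sum => k; apply: ccontM; [exact: cA|exact: cB].
Qed.

Lemma ccont_weight (T : topologicalType) n (g A : T -> 'M[C]_n) x :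
  (forall i j, ccont (fun y => g y i j) x) -> (forall i j, ccont (fun y => A y i j) x) ->
  forall i j, ccont (fun y => weight (g y) (A y) i j) x.
Proof.
move=> cg cA; have cadj := ccont_adj cA.
apply: ccont_mulmx; first by apply: ccont_mulmx.
by move=> i j; under eq_fun do rewrite !mxE; apply: ccontJ; have := cadj j i; under eq_fun do rewrite mxE.
Qed.

Lemma hess_ccont n (W : set (Cn R n)) (f : Cn R n -> R) z : open W -> Ck 2 W f -> W z ->
  forall k j, ccont (fun p => hess f p k j) z.
Proof.
move=> oW Cf Wz k j.
have c v w : {for z, continuous (fun p => 'D_v (fun q => 'D_w f q) p)} :=
  Ck0 (Ck_derive v (Ck_derive w Cf)) Wz.
have E1 : \forall p \near z,
   4^-1 * ('D_(ex j) (fun p => 'D_(ex k) f p) p + 'D_(ey j) (fun p => 'D_(ey k) f p) p) =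
   Re (hess f p k j).
  by apply: (near_open oW Wz) => p Wp; rewrite (hessE k j oW Cf Wp).
have E2 : \forall p \near z,
   4^-1 * ('D_(ex j) (fun p => 'D_(ey k) f p) p - 'D_(ey j) (fun p => 'D_(ex k) f p) p) =
   Im (hess f p k j).
  by apply: (near_open oW Wz) => p Wp; rewrite (hessE k j oW Cf Wp).
split.
  apply: (continuous_near_eq E1); apply: cvgM; first exact: cvg_cst.
  exact: cvgD (c (ex j) (ex k)) (c (ey j) (ey k)).
apply: (continuous_near_eq E2); apply: cvgM; first exact: cvg_cst.
exact: cvgB (c (ex j) (ey k)) (c (ey j) (ex k)).
Qed.

End ContExtra.

Section LocalUniqueness.
Context {R : realType} {n : nat}.
Local Notation C := R[i].
Local Notation V := (Cn R n).
Variables (W : set V) (g : V -> 'M[C]_n) (phi phi' : V -> R).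
Hypotheses (oW : open W) (ag : forall z, W z -> accretive (g z)) (hg : forall z, W z -> hermmx (g z)).
Hypothesis cg : forall z i j, W z -> ccont (fun p => g p i j) z.
Hypotheses (Cphi : Ck 2 W phi) (Cphi' : Ck 2 W phi').

Let u z := phi' z - phi z.
Let Cu : Ck 2 W u := CkD oW Cphi' (CkN oW Cphi).
Let A z (t : R) := g z + 'i%C *: (- hess phi z + t%:C *: (- hess u z)).

Lemma pencilE (M N K : 'M[C]_n) t a b :
  (M + 'i%C *: (- N + t *: - K)) a b = M a b + 'i%C * (- N a b + t * (- K a b)).
Proof. by rewrite !mxE. Qed.

Lemma hermmxN m (F : 'M[C]_m) : hermmx F -> hermmx (- F).
Proof. by move=> h; rewrite /hermmx -scaleN1r adjZ h rmorphN1. Qed.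

Lemma hermmx_F z : W z -> hermmx (- hess phi z).
Proof. by move=> Wz; apply: hermmxN; exact: (hess_herm oW Cphi Wz). Qed.

Lemma hermmx_H z : W z -> hermmx (- hess u z).
Proof. by move=> Wz; apply: hermmxN; exact: (hess_herm oW Cu Wz). Qed.

Lemma hessFH z : W z -> - hess phi z + - hess u z = - hess phi' z.
Proof. by move=> Wz; rewrite (hessB oW Wz Cphi' Cphi) opprB addrA addNr add0r. Qed.

Lemma accretive_path z t : W z -> accretive (A z t).
Proof.
move=> Wz; apply: accretive_pi; first exact: ag.
by apply: hermmxD; [exact: hermmx_F|apply: hermmxZ; exact: hermmx_H].
Qed.

(** This is angle_MVT for the Hermitian matrix H = - M(u), since F + H is the
    curvature matrix of the other weight. *)
Lemma angle_diff z : W z -> exists2 t : R, 0 <= t <= 1 & exists2 c : R, 0 < c &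
  angle (g z + 'i%C *: (- hess phi' z)) - angle (g z + 'i%C *: (- hess phi z)) =
  - (c * Re (\tr (hess u z *m weight (g z) (A z t)))).
Proof.
move=> Wz; have [t /andP[t0 t1] [c c0 E]] := angle_MVT (ag Wz) (hg Wz) (hermmx_F Wz) (hermmx_H Wz).
exists t; first by rewrite !ltW.
exists c => //; rewrite hessFH // in E; rewrite E mulNmx.
have -> : \tr (- (hess u z *m weight (g z) (A z t))) = - \tr (hess u z *m weight (g z) (A z t)).
  exact: raddfN.
by rewrite ReN mulrN.
Qed.

(** At a maximum of u the Hessian of u is nonpositive. *)
Lemma angle_at_max z0 : W z0 -> (forall z, W z -> u z <= u z0) ->
  0 <= angle (g z0 + 'i%C *: (- hess phi' z0)) - angle (g z0 + 'i%C *: (- hess phi z0)).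
Proof.
move=> Wz umax; have [t _ [c c0 ->]] := angle_diff Wz.
rewrite oppr_ge0 pmulr_rle0 //; apply: trace_le0.
- exact: (hess_herm oW Cu Wz).
- move=> x; have [v <-] := zvec_surj x.
  have D w : 'D_w (fun p => 'D_w u p) z0 <= 0.
    have := @max_second _ _ W u (fun=> 0) 0 z0 w oW Cu Wz; rewrite mulr0 oppr0; apply.
      by apply: (near_open oW Wz) => p Wp; rewrite !addr0; exact: umax.
    by move=> s; ring.
  have L : Re (qf (hess u z0) (zvec v)) = 4^-1 * levi u z0 v.
    by rewrite (qf_hess_levi v oW Cu Wz).
  have L' : levi u z0 v <= 0 + 0 := lerD (D v) (D (Jmul v)).
  by rewrite L; lra.
- by move=> v; apply: weight_ge0; [exact: ag|apply: accretive_det; exact: accretive_path].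
Qed.

(** If the angles agree, angle_diff gives at each point a time t where the
    trace vanishes, and strong_max applies. *)
Lemma local_unique z0 :
  (forall z, W z -> angle (g z + 'i%C *: (- hess phi' z)) = angle (g z + 'i%C *: (- hess phi z))) ->
  W z0 -> (forall z, W z -> u z <= u z0) -> \forall z \near z0, u z = u z0.
Proof.
move=> E Wz0 umax.
apply: (@strong_max _ _ W u (fun z t => weight (g z) (A z t))) => //.
- move=> z t v Wz v0; apply: weight_gt0 => //; first exact: ag.
  by apply: accretive_det; exact: accretive_path.
- move=> z t i j Wz.
  have cf : {for (z, t), continuous (@fst V R)} by exact: cvg_fst.
  have cg' a b : ccont (fun zt : V * R => g zt.1 a b) (z, t) := ccont_comp cf (cg a b Wz).
  have cphi a b : ccont (fun zt : V * R => hess phi zt.1 a b) (z, t) :=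
    ccont_comp cf (hess_ccont oW Cphi Wz a b).
  have cu a b : ccont (fun zt : V * R => hess u zt.1 a b) (z, t) :=
    ccont_comp cf (hess_ccont oW Cu Wz a b).
  have ct : ccont (fun zt : V * R => (zt.2)%:C) (z, t).
    by split; [exact: cvg_snd|exact: cst_continuous].
  apply: ccont_weight => // a b; rewrite /A.
  have -> : (fun y : V * R => (g y.1 + 'i%C *: (- hess phi y.1 + (y.2)%:C *: - hess u y.1)) a b) =
     (fun y => g y.1 a b + 'i%C * (- hess phi y.1 a b + (y.2)%:C * (- hess u y.1 a b))).
    by apply/funext => y; exact: pencilE.
  apply: ccontD; first exact: cg'.
  apply: ccontM; first exact: ccont_cst.
  apply: ccontD; first by apply: ccontN; exact: cphi.
  by apply: ccontM; [exact: ct|apply: ccontN; exact: cu].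
- move=> z Wz; have [t t01 [c c0 e]] := angle_diff Wz.
  have alg (x y s : R) : x - y = - (c * s) -> x = y -> s = 0.
    move=> h xy; move/esym/eqP: h; rewrite xy subrr oppr_eq0 mulf_eq0 (gt_eqF c0).
    by move/eqP.
  by exists t => //; exact: alg e (E z Wz).
Qed.

End LocalUniqueness.

(** * Charts and Kahler metrics *)

Section Charts.
Context {R : realType} {n : nat} {X : topologicalType}.
Variable M : complex_manifold R n X.
Local Notation V := (Cn R n).
Local Notation C := R[i].
Implicit Types (i j : chart_idx M) (x : X) (z : V) (U : set X).

Lemma chart_cover x : exists i, chart_dom (c := M) i x. Proof. by case: M x. Qed.
Lemma chart_dom_open i : open (chart_dom i). Proof. by case: M i. Qed.
Lemma chartK i x : chart_dom i x -> chart_inv i (chart i x) = x.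
Proof. by case: M i => /= ? ? ? ? ? ? ? ? h ? ? ? i; exact: h. Qed.
Lemma chart_cont i x : chart_dom i x -> {for x, continuous (chart i)}.
Proof. by case: M i => /= ? ? ? ? ? ? ? ? ? h ? ? i; exact: h. Qed.

Lemma chart_imgE i : chart_img i = chart i @` chart_dom i.
Proof. by rewrite /chart_img /chart_set setIT. Qed.

Lemma chart_inv_cont i z : chart_img i z -> {for z, continuous (chart_inv i)}.
Proof. by rewrite chart_imgE; case: M i z => /= ? ? ? ? ? ? ? ? ? ? h ? i z; exact: h. Qed.

Lemma transition_holo i j k : holomorphic (chart_set i (chart_dom j))
  (fun z => zcoord k (chart j (chart_inv i z))).
Proof. by case: M i j => /= ? ? ? ? ? ? ? ? ? ? ? h i j; exact: h. Qed.

Lemma chart_setP i U z : chart_set i U z ->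
  [/\ chart_dom i (chart_inv i z), U (chart_inv i z) & chart i (chart_inv i z) = z].
Proof. by move=> [x [dx Ux] <-]; rewrite chartK. Qed.

Lemma chart_setI i U x : chart_dom i x -> U x -> chart_set i U (chart i x).
Proof. by move=> dx Ux; exists x. Qed.

Lemma chart_set_img i U z : chart_set i U z -> chart_img i z.
Proof. by move=> [x [dx _] <-]; apply: chart_setI. Qed.

Lemma chart_set_sub i U U' z : U `<=` U' -> chart_set i U z -> chart_set i U' z.
Proof. by move=> UU [x [dx Ux] <-]; apply: chart_setI => //; exact: UU. Qed.

Lemma chart_set_open i U : open U -> open (chart_set i U).
Proof.
move=> oU; rewrite openE => z zU; have [dz Uz e] := chart_setP zU.
have oimg : open (chart_img i).
  by rewrite chart_imgE; case: M i {z zU dz Uz e} => /= ? ? ? ? ? ? ? h ? ? ? ? i; exact: h.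
have n1 : nbhs z (chart_img i).
  by apply: open_nbhs_nbhs; split => //; exact: chart_set_img zU.
have n2 : nbhs z (chart_inv i @^-1` U).
  apply: (chart_inv_cont (chart_set_img zU)).
  by apply: open_nbhs_nbhs.
apply: filterS2 n1 n2 => p pi /= pU.
by have [dp _ <-] := chart_setP pi; apply: chart_setI.
Qed.

Lemma near_chart i x (P : X -> Prop) : chart_dom i x ->
  (\forall z \near chart i x, P (chart_inv i z)) -> \forall y \near x, P y.
Proof.
move=> dx nP.
have n1 : nbhs x (chart_dom i).
  by apply: open_nbhs_nbhs; split => //; exact: chart_dom_open.
have n2 := chart_cont dx nP.
by apply: filterS2 n1 n2 => y dy /=; rewrite chartK.
Qed.

Lemma holomorphic_sub (W W' : set V) (F : V -> C) : W' `<=` W -> holomorphic W F -> holomorphic W' F.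
Proof.
move=> WW [[h1 h2] h3]; split; last by move=> j z /WW; exact: h3.
by split=> k; [exact: (Ck_sub WW (h1 k))|exact: (Ck_sub WW (h2 k))].
Qed.

Section Kahler.
Variable w : kahler_metric M.

Lemma kg_ccont i z (k j : 'I_n) : chart_img i z -> ccont (fun p => kg w i p k j) z.
Proof.
case: w => g sm /= _ _ _ _ zi; have [s1 s2] := sm i k j.
by split; [exact: (Ck0 (s1 0%N) zi)|exact: (Ck0 (s2 0%N) zi)].
Qed.

Lemma kg_herm i z : chart_img i z -> hermmx (kg w i z).
Proof.
case: w => g /= _ h _ _ _ zi; apply/matrixP => k j.
by rewrite [LHS]mxE mxE; exact: (esym (h i z k j zi)).
Qed.

Lemma kg_accretive i z : chart_img i z -> accretive (kg w i z).
Proof.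
case: w => g /= _ _ h _ _ zi v v0.
have [k vk] : exists k, v k 0 != 0.
  apply: contrapT => hv; case/eqP: v0; apply/matrixP => k l; rewrite (ord1 l) mxE.
  by apply/eqP; apply: contrapT => /negP vk; apply: hv; exists k.
have := h i z (fun k => v k 0) zi (ex_intro _ k vk).
by rewrite qfE exchange_big ltcE => /andP[].
Qed.

(** The compatibility of the Kahler forms is evaluated on the frames (v, iv),
    which the differential of a holomorphic change of charts respects. *)
Lemma kg_transition i j z v : chart_set i (chart_dom j) z ->
  let T p := chart j (chart_inv i p) in
  qf (kg w i z) (zvec v) = qf (kg w j (T z)) (zvec ('D_v T z)).
Proof.
move=> zij T; have oW : open (chart_set i (chart_dom j)).
  by apply: chart_set_open; exact: chart_dom_open.
have E : kahler_form_of (kg w) i z = pullback T (kahler_form_of (kg w) j) z.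
  by case: w => g /= _ _ _ h _; exact: h.
have := congr1 (fun f => f (pairJ v)) E; rewrite /pullback /kahler_form_of.
have -> : (fun l => 'D_(pairJ v l) T z) = pairJ ('D_v T z).
  apply/funext => l; rewrite /pairJ; case: (l == ord0) => //.
  exact: (derive_Jmul oW (transition_holo i j) v zij).
rewrite !form11_J => /mulfI; apply.
rewrite !mulf_neq0 ?invr_eq0 ?oppr_eq0 ?pnatr_eq0 //; by apply/eqP => -[/eqP]; rewrite oner_eq0.
Qed.

End Kahler.
End Charts.

(** * Hermitian metrics on a line bundle *)

Section Metrics.
Context {R : realType} {n : nat} {X : topologicalType}.
Variable M : complex_manifold R n X.
Variable L : line_bundle M.
Local Notation V := (Cn R n).
Local Notation C := R[i].
Implicit Types (h : hermitian_metric L) (a b : frame_idx L) (i j : chart_idx M) (x : X) (z : V).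

Lemma frame_open a : open (frame_dom a). Proof. by case: L a. Qed.
Lemma frame_neq0 a x : frame_dom a x -> frame a x != 0.
Proof. by case: L a => /= ? ? ? ? ? ? h ? ? a; exact: h. Qed.
Lemma frame_span a x (u : L x) : frame_dom a x -> exists c : C, u = c *: frame a x.
Proof. by case: L a u => /= ? ? ? ? ? ? ? h ? a u; exact: h. Qed.
Lemma frame_trans a b : exists t : X -> C,
  holomorphic_on M (frame_dom a `&` frame_dom b) t /\
  forall x, frame_dom a x -> frame_dom b x -> frame b x = t x *: frame a x.
Proof. by case: L a b => /= ? ? ? ? ? ? ? ? h a b; exact: h. Qed.
Lemma frame_atP x : frame_dom (frame_at L x) x.
Proof. by rewrite /frame_at; case: cid. Qed.

Lemma hermDl h x (c : C) (u u' v : L x) : h x (c *: u + u') v = c * h x u v + h x u' v.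
Proof. by case: h. Qed.
Lemma hermC h x (u v : L x) : h x v u = conjc (h x u v). Proof. by case: h. Qed.
Lemma herm_gt0 h x (u : L x) : u != 0 -> 0 < h x u u.
Proof. by case: h => /= ? _ _ h _; exact: h. Qed.
Lemma herm_smooth h a : smooth_on M (frame_dom a) (fun x => Re (h x (frame a x) (frame a x))).
Proof. by case: h => /= ? _ _ _ h; exact: h. Qed.

Lemma hermZl h x (c : C) (u v : L x) : h x (c *: u) v = c * h x u v.
Proof.
have z0 : h x 0 v = 0.
  have := hermDl h 1 0 0 v; rewrite scale1r addr0 mul1r => /eqP.
  by rewrite -subr_eq subrr eq_sym => /eqP.
by have := hermDl h c u 0 v; rewrite !addr0 z0 addr0.
Qed.

Lemma hermZ2 h x (c d : C) (u : L x) : h x (c *: u) (d *: u) = c * conjc d * h x u u.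
Proof. by rewrite hermZl hermC hermZl rmorphM /= -hermC mulrA. Qed.

Definition normsq h a x : R := Re (h x (frame a x) (frame a x)).

Lemma normsq_gt0 h a x : frame_dom a x -> 0 < normsq h a x.
Proof. by move=> /frame_neq0 /(herm_gt0 h); rewrite ltcE => /andP[]. Qed.

Lemma herm_normsq h a x : frame_dom a x -> h x (frame a x) (frame a x) = (normsq h a x)%:C.
Proof.
move=> /frame_neq0 /(herm_gt0 h); rewrite ltcE => /andP[/eqP e _].
exact: complexP.
Qed.

Lemma normsqZ h a b x (t : C) : frame_dom a x -> frame b x = t *: frame a x ->
  normsq h b x = (Re t ^+ 2 + Im t ^+ 2) * normsq h a x.
Proof.
move=> ax e; rewrite /normsq e hermZ2 (herm_normsq h ax).
by move: (normsq h a x) => r; rewrite !(ReM, ImM, ReJ, ImJ) /=; ring.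
Qed.

(** The local weight log h of the metric, in a frame and a chart. *)
Definition lweight h a i z : R := ln (normsq h a (chart_inv i z)).

Lemma lweight_Ck h a i k : Ck k (chart_set i (frame_dom a)) (lweight h a i).
Proof.
have o : open (chart_set i (frame_dom a)) by apply: chart_set_open; exact: frame_open.
apply: (Ck_ln o) => [z /chart_setP[_ az _]|]; first exact: normsq_gt0.
exact: (herm_smooth h a i k).
Qed.

(** The two weights differ by the logarithm of the square modulus of the
    transition function, which is holomorphic. *)
Lemma hess_lweight_frame h a b i z : chart_set i (frame_dom a `&` frame_dom b) z ->
  hess (lweight h a i) z = hess (lweight h b i) z.
Proof.
move=> Wz; set W := chart_set i (frame_dom a `&` frame_dom b) in Wz.
have oW : open W by apply: chart_set_open; apply: openI; exact: frame_open.
have [t [ht et]] := frame_trans a b.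
have hF : holomorphic W (fun z => t (chart_inv i z)) := ht i.
have Ca : Ck 2 W (lweight h a i).
  by apply: (Ck_sub _ (lweight_Ck h a i 2)) => p; apply: chart_set_sub => x [].
have Cb : Ck 2 W (lweight h b i).
  by apply: (Ck_sub _ (lweight_Ck h b i 2)) => p; apply: chart_set_sub => x [].
have t0 p : W p -> t (chart_inv i p) != 0.
  move=> /chart_setP[_ [ap bp] _]; have := frame_neq0 bp; rewrite (et _ ap bp).
  by apply: contra => /eqP ->; rewrite scale0r.
have E p : W p -> lweight h b i p - lweight h a i p =
    ln (Re (t (chart_inv i p)) ^+ 2 + Im (t (chart_inv i p)) ^+ 2).
  move=> Wp; have [_ [ap bp] _] := chart_setP Wp.
  rewrite /lweight (normsqZ h ap (et _ ap bp)) lnM ?posrE ?normsq_gt0 ?sqn_gt0 ?t0 //.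
  by rewrite addrK.
have Cba : Ck 2 W (fun p => lweight h b i p - lweight h a i p) := CkD oW Cb (CkN oW Ca).
have H0 : hess (fun p => lweight h b i p - lweight h a i p) z = 0.
  apply: polarization => u; have [v <-] := zvec_surj u.
  have L0 := levi_log_normsq v oW hF t0 Wz.
  have L1 := levi_eq v oW Wz E.
  have e := qf_hess_levi v oW Cba Wz.
  have -> : qf (0 : 'M[C]_n) (zvec v) = 0 by rewrite /qf mulmx0 mul0mx mxE.
  by apply: (etrans e); rewrite L1 L0 mulr0.
have := hessB oW Wz Cb Ca; rewrite H0 => /esym/eqP.
by rewrite subr_eq0 => /eqP/esym.
Qed.

Lemma curvatureE h i z : curvature h i z =
  form11 2^-1 (- hess (lweight h (frame_at L (chart_inv i z)) i) z).
Proof.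
rewrite /curvature; congr form11; apply/matrixP => k j.
by rewrite [LHS]mxE [RHS]mxE hess_coef.
Qed.
End Metrics.

(** * Comparison of two solutions *)

Section Uniqueness.
Context {R : realType} {n : nat} {X : topologicalType}.
Variables (M : complex_manifold R n X) (w : kahler_metric M) (L : line_bundle M).
Local Notation V := (Cn R n).
Local Notation C := R[i].
Implicit Types (h : hermitian_metric L) (a b : frame_idx L) (i j : chart_idx M) (x : X) (z : V).

(** The matrix g + iF, with the curvature computed in the frame a. *)
Definition pencil_at h a i z : 'M[C]_n := kg w i z + 'i%C *: (- hess (lweight h a i) z).
Definition pencil h i z := pencil_at h (frame_at L (chart_inv i z)) i z.

Lemma pencil_frame h a i z : chart_set i (frame_dom a) z -> pencil h i z = pencil_at h a i z.
Proof.
move=> zi; have [dz az e] := chart_setP zi.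
rewrite /pencil /pencil_at (@hess_lweight_frame _ _ _ _ _ h _ a) //.
by rewrite -[z in chart_set _ _ z]e; apply: chart_setI => //; split=> //; exact: frame_atP.
Qed.

Lemma in_frame_set i z : chart_img i z -> chart_set i (frame_dom (frame_at L (chart_inv i z))) z.
Proof.
move=> zi; have [dz _ e] := chart_setP zi.
by rewrite -[X in chart_set _ _ X]e; apply: chart_setI => //; exact: frame_atP.
Qed.

Lemma frame_set_open a i : open (chart_set i (frame_dom a)).
Proof. by apply: chart_set_open; exact: frame_open. Qed.

Lemma herm_hess_lweight h a i z : chart_set i (frame_dom a) z -> hermmx (- hess (lweight h a i) z).
Proof.
by move=> zi; apply: hermmxN; exact: (hess_herm (@frame_set_open a i) (lweight_Ck h a i 2) zi).
Qed.

Lemma pencil_accretive h i z : chart_img i z -> accretive (pencil h i z).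
Proof.
move=> zi; apply: accretive_pi; first exact: kg_accretive.
by apply: herm_hess_lweight; exact: in_frame_set.
Qed.

Lemma form11_pencil (g F : 'M[C]_n) v :
  form11 ('i%C / 2) g v - form11 2^-1 F v = form11 ('i%C / 2) (g + 'i%C *: F) v.
Proof.
rewrite /form11 !mulr_sumr -sumrB; apply: eq_bigr => j _.
rewrite !mulr_sumr -sumrB; apply: eq_bigr => k _; rewrite !mxE.
have ii : 'i%C * 'i%C = -1 :> C by rewrite -expr2 sqr_i.
move: (wedge _ _ _) (g k j) (F k j) => x y z.
transitivity ('i%C / 2 * (y * x) + ('i%C * 'i%C) * (2^-1 * (z * x))).
  by rewrite ii mulN1r.
by move: ('i%C : C) => i; field.
Qed.

Lemma omega_minus_FE h i z : omega_minus_F w h i z = form11 ('i%C / 2) (pencil h i z).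
Proof.
by apply/funext => v; rewrite /omega_minus_F curvatureE /omega /kahler_form_of form11_pencil.
Qed.

(** The real line through 0 to which the equation confines the values of the
    top power. *)
Definition phase_line (theta : R) (e : C) : Prop :=
  if cos theta == 0 then Re e = 0 else Im e = tan theta * Re e.

Lemma phase_line_real theta (k D D' : C) : k != 0 ->
  phase_line theta (k * D) -> phase_line theta (k * D') -> Im (D' * conjc D) == 0.
Proof.
rewrite /phase_line => k0 e e'.
have : Im ((k * D') * conjc (k * D)) = 0.
  by rewrite ImM ReJ ImJ; move: e e'; case: ifP => _ e e'; rewrite e e'; ring.
have -> : Im ((k * D') * conjc (k * D)) = (Re k ^+ 2 + Im k ^+ 2) * Im (D' * conjc D).
  by rewrite !(ImM, ReM, ReJ, ImJ); ring.
by move/eqP; rewrite mulf_eq0 (gt_eqF (sqn_gt0 k0)).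
Qed.

(** Both determinants lie on the same real line, rotated by a fixed nonzero
    constant, so their ratio is real. *)
Lemma dHYM_sin theta h h' i z : dHYM w theta h -> dHYM w theta h' -> chart_img i z ->
  sin (angle (pencil h' i z) - angle (pencil h i z)) = 0.
Proof.
move=> s s' zi; apply/eqP; rewrite sin_angleB; try exact: pencil_accretive.
have c0 : 'i%C / 2 != 0 :> C.
  by rewrite mulf_neq0 ?invr_eq0 ?pnatr_eq0 //; apply/eqP => -[/eqP]; rewrite oner_eq0.
have [k k0 kE] := wpow_frame (n := n) c0.
have eta m : wpow (omega_minus_F w m i z) n std_frame = k * \det (pencil m i z).
  exact: etrans (congr1 (fun B => wpow B n std_frame) (omega_minus_FE m i z)) (kE _).
exact: (phase_line_real k0 (eq_ind _ (phase_line theta) (s i z std_frame zi) _ (eta h))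
  (eq_ind _ (phase_line theta) (s' i z std_frame zi) _ (eta h'))).
Qed.

(** The frame used to compute the curvature changes from point to point; near
    z it can be replaced by a fixed one. *)
Lemma angle_pencil_cont h i z : chart_img i z ->
  {for z, continuous (fun p => angle (pencil h i p))}.
Proof.
move=> zi; set a := frame_at L (chart_inv i z).
have zW : chart_set i (frame_dom a) z := in_frame_set zi.
have E : \forall p \near z, angle (pencil_at h a i p) = angle (pencil h i p).
  by apply: (near_open (@frame_set_open a i) zW) => p Wp; rewrite (pencil_frame h Wp).
apply: (continuous_near_eq E); apply: angle_cont.
  by rewrite -(pencil_frame h zW); exact: pencil_accretive.
move=> k j.
have -> : (fun p => pencil_at h a i p k j) =
    (fun p => kg w i p k j + 'i%C * - hess (lweight h a i) p k j).
  by apply/funext => p; rewrite /pencil_at !mxE.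
apply: ccontD; first exact: kg_ccont.
apply: ccontM; first exact: ccont_cst.
apply: ccontN; exact: (hess_ccont (@frame_set_open a i) (lweight_Ck h a i 2) zW).
Qed.

(** In another chart both g and F are conjugated by the Jacobian matrix of
    the change of charts, which is invertible because g is positive definite
    in both. *)
Lemma angle_pencil_chart h i j x : chart_dom i x -> chart_dom j x ->
  angle (pencil h i (chart i x)) = angle (pencil h j (chart j x)).
Proof.
move=> ix jx; set a := frame_at L x; set z := chart i x.
have ax : frame_dom a x by exact: frame_atP.
pose W := chart_set i (chart_dom j `&` frame_dom a).
pose W' := chart_set j (frame_dom a).
pose T p := chart j (chart_inv i p).
have oW : open W by apply: chart_set_open; apply: openI; [exact: chart_dom_open|exact: frame_open].
have oW' : open W' := @frame_set_open a j.
have Wz : W z by apply: chart_setI.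
have TW p : W p -> W' (T p).
  by move=> /chart_setP[_ [jp ap] _]; apply: chart_setI.
have Tz : T z = chart j x by rewrite /T /z chartK.
have hT k : holomorphic W (fun p => zcoord k (T p)).
  apply: (holomorphic_sub _ (transition_holo i j k)) => p.
  by apply: chart_set_sub => y [].
have TE p : W p -> lweight h a i p = lweight h a j (T p).
  by move=> /chart_setP[_ [jp ap] _]; rewrite /lweight /T chartK.
have Ci : Ck 2 W (lweight h a i).
  by apply: (Ck_sub _ (lweight_Ck h a i 2)) => p; apply: chart_set_sub => y [].
have CT : Ck 2 W (fun p => lweight h a j (T p)) := Ck_eq oW TE Ci.
pose P := tangent_mx T z.
have hE : hess (lweight h a i) z = P ^t* *m hess (lweight h a j) (T z) *m P.
  have e1 := hess_eq oW Wz Ci TE.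
  exact: etrans e1 (hess_compT oW oW' TW hT (lweight_Ck h a j 2) CT Wz).
have zi : chart_img i z by apply: chart_setI.
have zj : chart_img j (T z) by rewrite Tz; apply: chart_setI.
have gE : kg w i z = P ^t* *m kg w j (T z) *m P.
  apply: polarization => u; have [v <-] := zvec_surj u.
  rewrite qf_conj /P -(tangentP oW hT v Wz).
  have zij : chart_set i (chart_dom j) z by apply: chart_setI.
  exact: (kg_transition w v zij).
(* A vector in the kernel of P would be isotropic for the positive definite
   matrix of omega. *)
have uP : P \in unitmx.
  rewrite unitmxE unitfE -det_tr; apply/det0P => -[u u0 uP].
  have u0' : u^T != 0 by apply: contra u0 => /eqP e; rewrite -[u]trmxK e trmx0.
  have := kg_accretive w zi u0'; rewrite gE qf_conj.
  have -> : P *m u^T = 0 by rewrite -[P]trmxK -trmx_mul uP trmx0.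
  by rewrite /qf mulmx0 mxE ltxx.
have zWi : chart_set i (frame_dom a) z by apply: chart_setI.
have zWj : chart_set j (frame_dom a) (T z) by exact: TW.
rewrite -Tz (pencil_frame h zWi) (pencil_frame h zWj).
have -> : pencil_at h a i z = P ^t* *m pencil_at h a j (T z) *m P.
  rewrite /pencil_at hE gE mulmxDr mulmxDl -scalemxAr -scalemxAl.
  by rewrite mulmxN mulNmx.
apply: angle_conj => //; [exact: kg_accretive|exact: kg_herm|exact: herm_hess_lweight].
Qed.

#[local] Opaque pencil pencil_at.

Definition chart_at x : chart_idx M := projT1 (cid (chart_cover M x)).
Lemma chart_atP x : chart_dom (chart_at x) x.
Proof. by rewrite /chart_at; case: cid. Qed.

(** By angle_pencil_chart this does not depend on the choice of the chart. *)
Definition angle_gap h h' x : R :=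
  let i := chart_at x in angle (pencil h' i (chart i x)) - angle (pencil h i (chart i x)).

Lemma angle_gapE h h' i x : chart_dom i x ->
  angle_gap h h' x = angle (pencil h' i (chart i x)) - angle (pencil h i (chart i x)).
Proof.
move=> ix; exact: (congr2 (fun s t : R => s - t) (angle_pencil_chart h' (chart_atP x) ix)
  (angle_pencil_chart h (chart_atP x) ix)).
Qed.

Lemma angle_gap_cont h h' x : {for x, continuous (angle_gap h h')}.
Proof.
set i := chart_at x; have ix : chart_dom i x := chart_atP x.
have zi : chart_img i (chart i x) by apply: chart_setI.
pose k z := angle (pencil h' i z) - angle (pencil h i z).
have ck : {for chart i x, continuous k} by apply: cvgB; exact: angle_pencil_cont.
have c : {for x, continuous (k \o chart i)} := continuous_comp (chart_cont ix) ck.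
have E : \forall y \near x, (k \o chart i) y = angle_gap h h' y.
  have n1 : nbhs x (chart_dom i) by apply: open_nbhs_nbhs; split => //; exact: chart_dom_open.
  by apply: filterS n1 => y iy; rewrite (angle_gapE h h' iy).
exact: (continuous_near_eq E c).
Qed.

(** The function log (h' / h), which depends on no frame. *)
Definition log_ratio h h' x : R :=
  let a := frame_at L x in ln (normsq h' a x) - ln (normsq h a x).

Lemma log_ratioE h h' a x : frame_dom a x ->
  log_ratio h h' x = ln (normsq h' a x) - ln (normsq h a x).
Proof.
move=> ax; rewrite /log_ratio; set b := frame_at L x.
have bx : frame_dom b x := frame_atP L x.
have [t [_ et]] := frame_trans b a; have e := et x bx ax.
have t0 : t x != 0 by have := frame_neq0 ax; rewrite e; apply: contra => /eqP ->; rewrite scale0r.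
rewrite (normsqZ h bx e) (normsqZ h' bx e) !lnM ?posrE ?normsq_gt0 ?sqn_gt0 //.
by ring.
Qed.

Lemma log_ratio_local h h' a i z : chart_set i (frame_dom a) z ->
  log_ratio h h' (chart_inv i z) = lweight h' a i z - lweight h a i z.
Proof. by move=> /chart_setP[_ az _]; rewrite (log_ratioE h h' az). Qed.

Lemma log_ratio_cont h h' x : {for x, continuous (log_ratio h h')}.
Proof.
set i := chart_at x; have ix : chart_dom i x := chart_atP x.
set a := frame_at L x; have ax : frame_dom a x := frame_atP L x.
have zi : chart_set i (frame_dom a) (chart i x) by apply: chart_setI.
pose k z := lweight h' a i z - lweight h a i z.
have ck : {for chart i x, continuous k}.
  by apply: cvgB; [exact: (Ck0 (lweight_Ck h' a i 0) zi)|exact: (Ck0 (lweight_Ck h a i 0) zi)].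
have c : {for x, continuous (k \o chart i)} := continuous_comp (chart_cont ix) ck.
have E : \forall y \near x, (k \o chart i) y = log_ratio h h' y.
  have n1 : nbhs x (chart_dom i) by apply: open_nbhs_nbhs; split => //; exact: chart_dom_open.
  have n2 : nbhs x (frame_dom a) by apply: open_nbhs_nbhs; split => //; exact: frame_open.
  apply: filterS2 n1 n2 => y iy ay; rewrite (log_ratioE h h' ay) /= /k /lweight chartK //.
exact: (continuous_near_eq E c).
Qed.

Section AtMax.
Variables (h h' : hermitian_metric L) (x : X).
Hypothesis xmax : forall y, log_ratio h h' y <= log_ratio h h' x.

Let i := chart_at x.
Let a := frame_at L x.
Let W := chart_set i (frame_dom a).
Let z := chart i x.

Lemma local_data : [/\ W z, forall p, W p -> accretive (kg w i p), forall p, W p -> hermmx (kg w i p),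
  forall p k l, W p -> ccont (fun q => kg w i q k l) p &
  forall p, W p -> lweight h' a i p - lweight h a i p <= lweight h' a i z - lweight h a i z].
Proof.
have Wz : W z by apply: chart_setI; [exact: chart_atP|exact: frame_atP].
split => //.
- by move=> p /chart_set_img; exact: kg_accretive.
- by move=> p /chart_set_img; exact: kg_herm.
- by move=> p k l /chart_set_img pi; exact: kg_ccont.
- move=> p Wp; rewrite -(log_ratio_local h h' Wp) -(log_ratio_local h h' Wz).
  by rewrite /z chartK; [exact: xmax|exact: chart_atP].
Qed.

Lemma angle_gap_at_max : 0 <= angle_gap h h' x.
Proof.
have [Wz ag hg cg umax] := local_data.
rewrite (angle_gapE h h' (chart_atP x)) -/i -/z (pencil_frame h Wz) (pencil_frame h' Wz).
exact: (angle_at_max (@frame_set_open a i) ag hg (lweight_Ck h a i 2) (lweight_Ck h' a i 2) Wz umax).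
Qed.

Lemma log_ratio_near_max : (forall y, angle_gap h h' y = 0) ->
  \forall y \near x, log_ratio h h' y = log_ratio h h' x.
Proof.
move=> gap0; have [Wz ag hg cg umax] := local_data.
have ang p : W p -> angle (pencil_at h' a i p) = angle (pencil_at h a i p).
  move=> Wp; have [ip ap e] := chart_setP Wp.
  have := angle_gapE h h' ip; rewrite gap0 e (pencil_frame h Wp) (pencil_frame h' Wp).
  by move=> /esym/eqP; rewrite subr_eq0 => /eqP.
have := local_unique (@frame_set_open a i) ag hg cg (lweight_Ck h a i 2) (lweight_Ck h' a i 2) ang Wz umax.
move=> nE; have nW := near_open (@frame_set_open a i) Wz (fun p Wp => Wp).
apply: (near_chart (chart_atP x)); apply: filterS2 nE nW => p /= Ep Wp.
rewrite (log_ratio_local h h' Wp) Ep -(log_ratio_local h h' Wz).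
by rewrite /z chartK //; exact: chart_atP.
Qed.

End AtMax.
End Uniqueness.

Theorem theorem1p1 (R : realType) (n : nat) (X : topologicalType)
  (M : complex_manifold R n X) (w : kahler_metric M) (L : line_bundle M)
  (theta : R)
  (compactX : compact [set: X])
  (connectedX : connected [set: X])
  (volX : integral_form (volume_form w) = 1)
  (ZL_neq0 : ZL w L != 0)
  (theta_arg : is_arg (ZL w L) theta)
  (h : hermitian_metric L) (h_sol : dHYM w theta h)
  (h' : hermitian_metric L) (h'_sol : dHYM w theta h') :
  exists c : R, forall (x : X) (u v : L x), h' x u v = c%:C * h x u v.
Proof.
have [[x0 _]|noX] := pselect (exists x : X, True); last first.
  by exists 0 => x; case: noX; exists x.
have sinK (k k' : hermitian_metric L) : dHYM w theta k -> dHYM w theta k' ->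
    forall x, sin (angle_gap w k k' x) = 0.
  move=> s s' x; apply: (dHYM_sin s s').
  by apply: chart_setI; [exact: chart_atP|].
have Kconst := sin_eq0_const connectedX (@angle_gap_cont _ _ _ _ w L h h') (sinK h h' h_sol h'_sol).
have X0 : [set: X] !=set0 by exists x0.
have cu x : [set: X] x -> {for x, continuous (log_ratio h h')}.
  by move=> _; exact: log_ratio_cont.
have [p _ pmax] := evt_max X0 compactX cu.
have [q _ qmin] := evt_min X0 compactX cu.
have gp : 0 <= angle_gap w h h' p by apply: angle_gap_at_max => y; exact: pmax.
have gq : angle_gap w h h' q <= 0.
  have -> : angle_gap w h h' q = - angle_gap w h' h q by rewrite /angle_gap opprB.
  rewrite oppr_le0; apply: angle_gap_at_max => y.
  have sw x : log_ratio h' h x = - log_ratio h h' x by rewrite /log_ratio opprB.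
  by rewrite !sw lerN2; exact: qmin.
have gap0 y : angle_gap w h h' y = 0.
  apply/eqP; rewrite eq_le {1}(Kconst y q) gq (Kconst y p).
  exact: gp.
pose S := [set x | log_ratio h h' x = log_ratio h h' p].
have SX : S = [set: X].
  apply: connectedX; first by exists p.
    exists S; last by rewrite setTI.
    rewrite openE => x Sx.
    have := @log_ratio_near_max _ _ _ _ w L h h' x _ gap0.
    rewrite (Sx : log_ratio h h' x = _); apply=> y; exact: pmax.
  exists S; last by rewrite setTI.
  have -> : S = [set x | setT x /\ [set log_ratio h h' p] (log_ratio h h' x)].
    by apply/seteqP; split=> x /=; tauto.
  by apply: closed_preimage_on; [exact: closedT|exact: closed_eq|].
exists (expR (log_ratio h h' p)) => x u v.
set a := frame_at L x; have ax : frame_dom a x := frame_atP L x.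
have [c ->] := frame_span u ax; have [d ->] := frame_span v ax.
rewrite !hermZ2 mulrCA; congr (_ * _).
rewrite (herm_normsq h' ax) (herm_normsq h ax) -rmorphM; congr (_%:C).
have Sx : S x by rewrite SX.
have := log_ratioE h h' ax; rewrite (Sx : log_ratio h h' x = _) => ->.
rewrite -{2}[normsq h a x]lnK ?posrE ?normsq_gt0 // -expRD subrK lnK //.
by rewrite posrE normsq_gt0.
Qed.
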